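(* There are no parameters $\ell_1>0$, $\ell_3>0$, $b\in[0,1]$ such that the filtered structure $(\mathcal M,\mathcal D_{\ell_1,\ell_3,b})$ of the generalized $3$-link snake robot admits a $14$-dimensional Lie algebra of infinitesimal symmetries; that is, $\dim\mathcal S\neq 14$ for all $(\ell_1,\ell_3,b)\in\mathbb R^+\times\mathbb R^+\times[0,1]$.
   Context: Let $\mathcal C=S^1\times S^1\times S^1\times\mathbb R^2$ with coordinates $(v_1,v_2,v_3,x,y)$ ($v_i$ angles). For $\ell_1,\ell_3>0$, $b\in[0,1]$ the rank $2$ distribution $\mathcal D_{\ell_1,\ell_3,b}$ on $\mathcal C$ (velocities of the planar $3$-link snake robot with segment lengths $\ell_1,1,\ell_3$ satisfying the non-slipping condition in its three wheels) is the common kernel of the one-forms $$\varphi_1=-\sin v_2\,dx+\cos v_2\,dy,$$ $$\varphi_2=-\sin(v_3+v_2)\,dx+\cos(v_3+v_2)\,dy+\big((1-b)\cos v_3+\ell_3\big)dv_2+\ell_3\,dv_3,$$ $$\varphi_3=-\sin(v_1+v_2)\,dx+\cos(v_1+v_2)\,dy-\ell_1\,dv_1-(b\cos v_1+\ell_1)\,dv_2 .$$ It is spanned by $$X_1=\Big(1+\tfrac{b}{\ell_1}\cos v_1\Big)\partial_{v_1}-\partial_{v_2}+\Big(1+\tfrac{1-b}{\ell_3}\cos v_3\Big)\partial_{v_3},\quad X_2=-\tfrac1{\ell_1}\sin v_1\,\partial_{v_1}+\tfrac1{\ell_3}\sin v_3\,\partial_{v_3}+\cos v_2\,\partial_x+\sin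 v_2\,\partial_y.$$ Put $X_3=[X_1,X_2]$, $X_4=[X_1,X_3]$, $X_5=[X_2,X_3]$. Standing convention: $\mathcal M$ denotes a nonempty connected open subset of $\mathcal C$, diffeomorphic to an open simply connected subset of $\mathbb R^5$, on which $X_1,\dots,X_5$ form a frame of the tangent bundle (so that $\mathcal D_{\ell_1,\ell_3,b}$ has growth vector $(2,3,5)$ at every point of $\mathcal M$). The filtered structure is $T\mathcal M=\mathcal D^3\supset\mathcal D^2\supset\mathcal D^1=\mathcal D$ with $\mathcal D=\mathcal D_{\ell_1,\ell_3,b}|_{\mathcal M}$ and $\mathcal D^{i+1}=\mathcal D^i+[\mathcal D,\mathcal D^i]$. The Lie algebra of infinitesimal symmetries is $\mathcal S=\{S\in\mathfrak X(\mathcal M)\mid [S,X]\in\mathcal D\text{ for all }X\in\mathcal D\}$, where $X \in \mathcal D$ means $X$ is a vector field on $\mathcal M$ tangent to $\mathcal D$. *)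

(* Defs.v *)
From mathcomp Require Import all_boot all_order all_algebra.
From mathcomp Require Import generic_quotient.
From mathcomp Require Import all_classical all_reals all_analysis.
From mathcomp Require Import ring.

Set Implicit Arguments.
Unset Strict Implicit.
Unset Printing Implicit Defensive.

Import Order.TTheory GRing.Theory Num.Theory.
Import numFieldNormedType.Exports.

Local Open Scope classical_set_scope.
Local Open Scope ring_scope.
Local Open Scope quotient_scope.

Section SmoothFunctions.
Context {R : realType}.

Definition partial n (i : 'I_n.+1) (f : 'rV[R]_n.+1 -> R) : 'rV[R]_n.+1 -> R :=
  fun u => 'D_(delta_mx 0 i) f u.

Fixpoint of_class_C n (k : nat) (U : set 'rV[R]_n.+1)
    (f : 'rV[R]_n.+1 -> R) : Prop :=
  (forall u, U u -> {for u, continuous f}) /\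
  (if k is k'.+1 then forall i : 'I_n.+1,
      (forall u, U u -> derivable f u (delta_mx 0 i)) /\
      of_class_C k' U (partial i f)
   else True).

(* Only used for open U. *)
Definition smooth n (U : set 'rV[R]_n.+1) (f : 'rV[R]_n.+1 -> R) : Prop :=
  forall k, of_class_C k U f.

Definition smooth_map n m (U : set 'rV[R]_n.+1)
    (f : 'rV[R]_n.+1 -> 'rV[R]_m.+1) : Prop :=
  forall j, smooth U (fun u => f u 0 j).

Definition simply_connected (T : topologicalType) (V : set T) : Prop :=
  (forall x y, V x -> V y ->
     exists g : R -> T,
       [/\ {within `[0, 1], continuous g}, g @` `[0, 1] `<=` V,
           g 0 = x & g 1 = y]) /\
  (forall g : R -> T,
     {within `[0, 1], continuous g} -> g @` `[0, 1] `<=` V -> g 0 = g 1 ->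
     exists H : R * R -> T,
       [/\ {within `[0, 1] `*` `[0, 1], continuous H},
           H @` (`[0, 1] `*` `[0, 1]) `<=` V,
           forall t, t \in `[0, 1] -> H (0, t) = g t /\ H (1, t) = g 0 &
           forall s, s \in `[0, 1] -> H (s, 0) = g 0 /\ H (s, 1) = g 0]).

(* S is a linear subspace of dimension n. *)
Definition has_dim (V : lmodType R) (S : set V) (n : nat) : Prop :=
  exists B : 'I_n -> V,
    (forall c : 'I_n -> R, \sum_i c i *: B i = 0 -> forall i, c i = 0) /\
    S = [set v | exists c : 'I_n -> R, v = \sum_i c i *: B i].

End SmoothFunctions.

Section ConfigurationSpace.
Variable R : realType.

(* Coordinates 0, 1, 2 are the angles v_1, v_2, v_3; 3, 4 are x, y. *)
Definition same_config (u w : 'rV[R]_5) : bool :=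
  `[< exists k : 'rV[int]_5, [/\ k 0 3%:R = 0, k 0 4%:R = 0 &
        w = u + \row_i (2 * pi * (k 0 i)%:~R)] >].

Lemma same_config_refl : reflexive same_config.
Proof.
move=> u; apply/asboolP; exists 0; split; rewrite ?mxE//.
by apply/rowP => i; rewrite !mxE mulr0 addr0.
Qed.

Lemma same_config_sym : symmetric same_config.
Proof.
suff h u w : same_config u w -> same_config w u.
  by move=> u w; apply/idP/idP; exact: h.
move=> /asboolP[k [k3 k4 ->]]; apply/asboolP; exists (- k).
split; rewrite ?mxE ?k3 ?k4 ?oppr0//.
by apply/rowP => i; rewrite !mxE mulrNz mulrN addrK.
Qed.

Lemma same_config_trans : transitive same_config.
Proof.
move=> w u z /asboolP[k [k3 k4 ->]] /asboolP[k' [k'3 k'4 ->]].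
apply/asboolP; exists (k + k').
split; rewrite ?mxE ?k3 ?k4 ?k'3 ?k'4 ?addr0//.
by apply/rowP => i; rewrite !mxE intrD -addrA -mulrDr.
Qed.

Definition config_equiv :=
  EquivRel same_config same_config_refl same_config_sym same_config_trans.

(* S^1 x S^1 x S^1 x R^2, as the quotient of R^5 by (2 pi Z)^3 x {0}. *)
Definition config : Type := quotient_topology {eq_quot config_equiv}.

(* The universal covering R^5 -> config; its local inverses are the charts, so
   a function on an open subset M of config is smooth iff its composition with
   config_proj is smooth on the preimage of M. *)
Definition config_proj : 'rV[R]_5 -> config := \pi_config.

Definition smooth_on m (M : set config) (f : config -> 'rV[R]_m.+1) : Prop :=
  smooth_map (config_proj @^-1` M) (f \o config_proj).

(* A map into config is smooth iff it locally lifts to a smooth map into R^5. *)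
Definition smooth_into n (V : set 'rV[R]_n.+1) (f : 'rV[R]_n.+1 -> config)
    : Prop :=
  forall u, V u -> exists (W : set 'rV[R]_n.+1) (g : 'rV[R]_n.+1 -> 'rV[R]_5),
    [/\ open W, W u, smooth_map W g & forall w, W w -> f w = config_proj (g w)].

Definition diffeomorphic n (M : set config) (V : set 'rV[R]_n.+1) : Prop :=
  exists (f : config -> 'rV[R]_n.+1) (g : 'rV[R]_n.+1 -> config),
    [/\ forall p, M p -> V (f p) /\ g (f p) = p,
        forall u, V u -> M (g u) /\ f (g u) = u,
        smooth_on M f & smooth_into V g].

(* Vector fields are given by their components in the global frame
   d/dv_1, d/dv_2, d/dv_3, d/dx, d/dy. *)
Definition vfield : Type := config -> 'rV[R]_5.

(* f \o config_proj is periodic, so the choice of repr p among the lifts of p is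
   immaterial. *)
Definition pderiv (i : 'I_5) (f : config -> R) : config -> R :=
  fun p => partial i (f \o config_proj) (repr p).

Definition bracket (X Y : vfield) : vfield := fun p =>
  \row_i \sum_j (X p 0 j * pderiv j (fun q => Y q 0 i) p
               - Y p 0 j * pderiv j (fun q => X q 0 i) p).

(* A vector field on the open set M is represented by its extension by zero, so
   that distinct elements are distinct vector fields on M; brackets of such
   fields are again of this form. *)
Definition vector_fields (M : set config) : set vfield :=
  [set X | smooth_on M X /\ forall p, ~ M p -> X p = 0].

Definition sections (M : set config) (D : config -> set 'rV[R]_5) : set vfield :=
  [set X | vector_fields M X /\ forall p, M p -> D p (X p)].

Definition infinitesimal_symmetries (M : set config)
    (D : config -> set 'rV[R]_5) : set vfield :=
  [set S | vector_fields M S /\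
           forall X, sections M D X -> sections M D (bracket S X)].

End ConfigurationSpace.

Section Snake.
Context {R : realType}.
Variables l1 l3 b : R.

Definition row5 (a1 a2 a3 a4 a5 : R) : 'rV[R]_5 :=
  \row_i [:: a1; a2; a3; a4; a5]`_i.

(* The angles are only defined up to 2 pi Z; below they occur only inside sin
   and cos. *)
Definition angle (i : 'I_5) (p : config R) : R := repr p 0 i.

Local Notation v1 p := (angle 0 p).
Local Notation v2 p := (angle 1 p).
Local Notation v3 p := (angle 2%:R p).

Definition phi1 (p : config R) : 'rV[R]_5 :=
  row5 0 0 0 (- sin (v2 p)) (cos (v2 p)).

Definition phi2 (p : config R) : 'rV[R]_5 :=
  row5 0 ((1 - b) * cos (v3 p) + l3) l3
       (- sin (v3 p + v2 p)) (cos (v3 p + v2 p)).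

Definition phi3 (p : config R) : 'rV[R]_5 :=
  row5 (- l1) (- (b * cos (v1 p) + l1)) 0
       (- sin (v1 p + v2 p)) (cos (v1 p + v2 p)).

Definition pairing (w v : 'rV[R]_5) : R := \sum_i w 0 i * v 0 i.

Definition snake_distribution (p : config R) : set 'rV[R]_5 :=
  [set v | [/\ pairing (phi1 p) v = 0, pairing (phi2 p) v = 0 &
               pairing (phi3 p) v = 0]].

Definition X1 : vfield R := fun p =>
  row5 (1 + b / l1 * cos (v1 p)) (- 1) (1 + (1 - b) / l3 * cos (v3 p)) 0 0.

Definition X2 : vfield R := fun p =>
  row5 (- (l1^-1 * sin (v1 p))) 0 (l3^-1 * sin (v3 p))
       (cos (v2 p)) (sin (v2 p)).

Definition X3 : vfield R := bracket X1 X2.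
Definition X4 : vfield R := bracket X1 X3.
Definition X5 : vfield R := bracket X2 X3.

Definition frame_at (p : config R) : Prop :=
  (\matrix_(i < 5) [:: X1 p; X2 p; X3 p; X4 p; X5 p]`_i) \in unitmx.

Lemma pairingE (w v : 'rV[R]_5) :
  pairing w v = w 0 0 * v 0 0 + w 0 1 * v 0 1 + w 0 2%:R * v 0 2%:R
              + w 0 3%:R * v 0 3%:R + w 0 4%:R * v 0 4%:R.
Proof.
rewrite /pairing !big_ord_recr big_ord0 /= add0r.
by congr (_ + _ + _ + _ + _); congr (w _ _ * v _ _); exact: val_inj.
Qed.

Lemma snake_distribution_span (l1_gt0 : 0 < l1) (l3_gt0 : 0 < l3) p v :
  snake_distribution p v <-> exists s t, v = s *: X1 p + t *: X2 p.
Proof.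
have l1n : l1 != 0 by rewrite gt_eqF.
have l3n : l3 != 0 by rewrite gt_eqF.
rewrite /snake_distribution /= !pairingE !mxE /= !cosD !sinD.
set s1 := sin (v1 p); set c1 := cos (v1 p).
set s2 := sin (v2 p); set c2 := cos (v2 p).
set s3 := sin (v3 p); set c3 := cos (v3 p).
have cs : c2 ^+ 2 = 1 - s2 ^+ 2 by rewrite -(cos2Dsin2 (v2 p)) addrK.
split.
  move=> [e1 e2 e3]; exists (- v 0 1), (c2 * v 0 3%:R + s2 * v 0 4%:R).
  set t := c2 * v 0 3%:R + s2 * v 0 4%:R.
  have e1' : s2 * v 0 3%:R = c2 * v 0 4%:R.
    apply/eqP; rewrite eq_sym -subr_eq0; apply/eqP; rewrite -[RHS]e1; ring.
  have x3 : v 0 3%:R = t * c2.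
    have -> : t * c2 = c2 ^+ 2 * v 0 3%:R + s2 * (c2 * v 0 4%:R) by rewrite /t; ring.
    by rewrite -e1' cs; ring.
  have x4 : v 0 4%:R = t * s2.
    have -> : t * s2 = c2 * (s2 * v 0 3%:R) + s2 ^+ 2 * v 0 4%:R by rewrite /t; ring.
    have -> : c2 * (s2 * v 0 3%:R) = c2 ^+ 2 * v 0 4%:R by rewrite e1'; ring.
    by rewrite cs; ring.
  have x2 : v 0 2%:R = - v 0 1 * (1 + (1 - b) / l3 * c3) + t * (l3^-1 * s3).
    apply: (mulfI l3n).
    transitivity (- (((1 - b) * c3 + l3) * v 0 1) + s3 * (s2 ^+ 2 + c2 ^+ 2) * t); last first.
      by rewrite cs; field.
    apply/eqP; rewrite -subr_eq0; apply/eqP; rewrite -[RHS]e2 x3 x4; ring.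
  have x0 : v 0 0 = - v 0 1 * (1 + b / l1 * c1) + t * (- (l1^-1 * s1)).
    apply: (mulfI l1n).
    transitivity (- ((b * c1 + l1) * v 0 1) - s1 * (s2 ^+ 2 + c2 ^+ 2) * t); last first.
      by rewrite cs; field.
    apply/eqP; rewrite -subr_eq0 -oppr_eq0; apply/eqP; rewrite -[RHS]e3 x3 x4; ring.
  apply/rowP => -[[|[|[|[|[|//]]]]] ?]; rewrite !mxE /=;
    (set i := Ordinal _).
  - by rewrite (_ : i = 0) ?x0//; exact/val_inj.
  - by rewrite (_ : i = 1); [ring | exact/val_inj].
  - by rewrite (_ : i = 2%:R) ?x2//; exact/val_inj.
  - by rewrite (_ : i = 3%:R) ?x3 -/c2; [ring | exact/val_inj].
  - by rewrite (_ : i = 4%:R) ?x4 -/s2; [ring | exact/val_inj].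
move=> [s [t ->]]; rewrite !mxE /= -/s1 -/c1 -/s2 -/c2 -/s3 -/c3; split.
- ring.
- transitivity (t * s3 * (1 - (s2 ^+ 2 + c2 ^+ 2))).
    by field; rewrite l1n l3n.
  by rewrite cs; ring.
- transitivity (t * s1 * (1 - (s2 ^+ 2 + c2 ^+ 2))).
    by field; rewrite l1n l3n.
  by rewrite cs; ring.
Qed.

Definition admissible (M : set (config R)) : Prop :=
  [/\ M !=set0, connected M, open M,
      exists V : set 'rV[R]_5,
        [/\ open V, simply_connected (R := R) V & diffeomorphic M V] &
      forall p, M p -> frame_at p].

End Snake.

(* Main.v *)
Require Import Defs.
From HB Require Import structures.
From mathcomp Require Import all_boot all_order all_algebra generic_quotient.
From mathcomp Require Import all_classical all_reals all_analysis.
From mathcomp Require Import ring lra.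

(** Write the components of a symmetry S along X3, X4 + X2, X5 as f, g, h. The
    equations [S, X1], [S, X2] in D express S and everything else through f, g, h
    and prolong to a closed linear first order system for fourteen functions:
    f, g, h and eleven iterated derivatives of f along X1 and X2. A symmetry is
    therefore determined by fourteen values at a point, and if there is a
    14-dimensional space of them then all values occur. In particular every point
    carries a symmetry that vanishes there and satisfies [S, X1] = X1, [S, X2] = X2
    at that point. It multiplies the Wilczynski invariant of the abnormal curve
    tangent to a distinguished field l in D by a nonzero weight, so the invariant
    vanishes at every point. Up to a nonvanishing factor this invariant is a
    trigonometric polynomial in v1 and v3; vanishing on an open set, it vanishes
    identically. But its value at the straight configuration v1 = v3 = 0 is
    -224 eta^4 with eta > 0. *)

Set Implicit Arguments.
Unset Strict Implicit.
Unset Printing Implicit Defensive.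

Import Order.TTheory GRing.Theory Num.Theory.

Local Open Scope ring_scope.

(** * Vector fields over a ring with commuting derivations *)

(** The bracket computations take place in an abstract commutative ring with commuting derivations,
    where they are polynomial identities; the smooth functions on the preimage of M in R^5 form one
    instance, those on all of R^5 another, and the same formulas transfer between them. The field l
    comes from the geometry: only the d/dv1 components of X1 and X2 depend on v1, so D projects to a
    rank 2 distribution in v2, v3, x, y, of Engel type where [abn_norm] is nonzero, and l lifts its
    characteristic field. Hence iterated brackets with l end in multiples of d/dv1, which makes the
    invariant computable. The straight configuration lies outside M, because the growth determinant
    ([abn_y] up to a factor) vanishes there. The invariant has a fourth order pole in [abn_y], so
    only its numerator is continued; since [abn_y] is 0 at the straight configuration, every term
    containing k drops out and only eta, the derivative of [abn_y] along the unnormalised l,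
    survives. *)

Record derivations (A : comNzRingType) (n : nat) := Derivations {
  der :> 'I_n -> A -> A;
  derD : forall i a b, der i (a + b) = der i a + der i b;
  derM : forall i a b, der i (a * b) = der i a * b + a * der i b;
  der_comm : forall i j a, der i (der j a) = der j (der i a) }.

Lemma eq_of_sub (V : zmodType) (a b c d : V) : a = b -> c - d = a - b -> c = d.
Proof. by move=> -> /eqP; rewrite subrr subr_eq0 => /eqP. Qed.

Section VectorFields.
Variables (A : comNzRingType) (n : nat) (D : derivations A n).
Implicit Types (X Y Z : 'rV[A]_n) (a b : A).

Definition act X a : A := \sum_i X 0 i * D i a.

Definition br X Y : 'rV[A]_n := \row_i (act X (Y 0 i) - act Y (X 0 i)).

Lemma actD X a b : act X (a + b) = act X a + act X b.
Proof.
by rewrite /act -big_split/=; apply: eq_bigr => i _; rewrite derD mulrDr.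
Qed.

Lemma actM X a b : act X (a * b) = act X a * b + a * act X b.
Proof.
rewrite /act mulr_suml mulr_sumr -big_split/=.
by apply: eq_bigr => i _; rewrite derM; ring.
Qed.

Lemma act0 X : act X 0 = 0.
Proof. by apply: (addrI (act X 0)); rewrite -actD !addr0. Qed.

Lemma actN X a : act X (- a) = - act X a.
Proof. by apply: (addrI (act X a)); rewrite -actD !subrr act0. Qed.

Lemma actB X a b : act X (a - b) = act X a - act X b.
Proof. by rewrite actD actN. Qed.

Lemma act1 X : act X 1 = 0.
Proof.
by apply: (addrI (act X 1)); rewrite addr0 -[in RHS](mulr1 1) actM mulr1 mul1r.
Qed.

Lemma act_nat X k : act X k%:R = 0.
Proof. by elim: k => [|k IH]; rewrite ?act0// -natr1 actD IH act1 addr0. Qed.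

Lemma actDl X Y a : act (X + Y) a = act X a + act Y a.
Proof.
by rewrite /act -big_split/=; apply: eq_bigr => i _; rewrite mxE mulrDl.
Qed.

Lemma actZl c X a : act (c *: X) a = c * act X a.
Proof. by rewrite /act mulr_sumr; apply: eq_bigr => i _; rewrite mxE mulrA. Qed.

Lemma actNl X a : act (- X) a = - act X a.
Proof. by rewrite -scaleN1r actZl mulN1r. Qed.

Lemma actBl X Y a : act (X - Y) a = act X a - act Y a.
Proof. by rewrite actDl actNl. Qed.

Lemma act_sum X I (r : seq I) (P : pred I) F :
  act X (\sum_(i <- r | P i) F i) = \sum_(i <- r | P i) act X (F i).
Proof. exact: (big_morph (act X) (actD X) (act0 X)). Qed.

Lemma act_br X Y a : act (br X Y) a = act X (act Y a) - act Y (act X a).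
Proof.
have key U V : act U (act V a) =
    \sum_i act U (V 0 i) * D i a + \sum_i \sum_j U 0 j * V 0 i * D j (D i a).
  rewrite [act V a]/act act_sum -big_split/=; apply: eq_bigr => i _.
  rewrite actM; congr (_ + _); rewrite /act mulr_sumr; apply: eq_bigr => j _.
  by rewrite mulrCA mulrA.
rewrite !key [X in _ - (_ + X)]exchange_big/=.
rewrite [X in _ - (_ + X)](eq_bigr (fun i => \sum_j X 0 j * Y 0 i * D j (D i a))).
  rewrite opprD addrACA subrr addr0 /act -sumrB; apply: eq_bigr => i _.
  by rewrite mxE mulrBl.
by move=> i _; apply: eq_bigr => j _; rewrite der_comm [Y 0 _ * _]mulrC.
Qed.

Lemma brC X Y : br X Y = - br Y X.
Proof. by apply/rowP => i; rewrite !mxE opprB. Qed.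

Lemma brxx X : br X X = 0.
Proof. by apply/rowP => i; rewrite !mxE subrr. Qed.

Lemma brDr X Y Z : br X (Y + Z) = br X Y + br X Z.
Proof. by apply/rowP => i; rewrite !mxE actD actDl; ring. Qed.

Lemma brZr X c Y : br X (c *: Y) = act X c *: Y + c *: br X Y.
Proof. by apply/rowP => i; rewrite !mxE actM actZl; ring. Qed.

Lemma brNr X Y : br X (- Y) = - br X Y.
Proof. by apply/rowP => i; rewrite !mxE actN actNl; ring. Qed.

Lemma brDl X Y Z : br (X + Y) Z = br X Z + br Y Z.
Proof. by apply/rowP => i; rewrite !mxE actD actDl; ring. Qed.

Lemma brZl c X Y : br (c *: X) Y = c *: br X Y - act Y c *: X.
Proof. by apply/rowP => i; rewrite !mxE actM actZl; ring. Qed.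

Lemma jacobi X Y Z : br X (br Y Z) = br (br X Y) Z + br Y (br X Z).
Proof. by apply/rowP => i; rewrite !mxE !act_br !actB; ring. Qed.

Definition pairv X (w : 'cV[A]_n) : A := (X *m w) 0 0.

Lemma pairvD X Y w : pairv (X + Y) w = pairv X w + pairv Y w.
Proof. by rewrite /pairv mulmxDl mxE. Qed.

Lemma pairvZ c X w : pairv (c *: X) w = c * pairv X w.
Proof. by rewrite /pairv -scalemxAl mxE. Qed.

Lemma pairvN X w : pairv (- X) w = - pairv X w.
Proof. by rewrite /pairv mulNmx mxE. Qed.

Lemma pairv0 w : pairv 0 w = 0.
Proof. by rewrite /pairv mul0mx mxE. Qed.

End VectorFields.

(** * Relative invariance of the Wilczynski invariant under a symmetry *)

Section WilczynskiInvariant.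
Variables (A : comNzRingType) (n : nat) (D : derivations A n).
Variables (K : numFieldType) (ev : {rmorphism A -> K}).
Variables (S l Y Y1 U Z : 'rV[A]_n) (k x zeta om nu tau ga de : A).
Local Notation "X *> a" := (act D X a) (at level 30, right associativity).
Local Notation "[[ X , T ]]" := (br D X T) (at level 0).

Hypotheses (lY : [[l, Y]] = Y1) (lY1 : [[l, Y1]] = U - k *: Y).
Hypotheses (lU : [[l, U]] = x *: U) (YY1 : [[Y, Y1]] = Z).
Hypotheses (lZ : [[l, Z]] = zeta *: U) (YU : [[Y, U]] = om *: U).
Hypotheses (Sl : [[S, l]] = nu *: l + tau *: Y).
Hypotheses (SY : [[S, Y]] = ga *: l + de *: Y).

Variables wY1 wU wZ : 'cV[A]_n.
Hypotheses (w1l : pairv l wY1 = 0) (w1Y : pairv Y wY1 = 0).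
Hypotheses (w1Y1 : pairv Y1 wY1 = 1) (w1U : pairv U wY1 = 0).
Hypotheses (w1Z : pairv Z wY1 = 0).
Hypotheses (wUl : pairv l wU = 0) (wUY : pairv Y wU = 0).
Hypotheses (wUY1 : pairv Y1 wU = 0) (wUU : pairv U wU = 1).
Hypotheses (wUZ : pairv Z wU = 0).
Hypotheses (wZl : pairv l wZ = 0) (wZY : pairv Y wZ = 0).
Hypotheses (wZY1 : pairv Y1 wZ = 0) (wZU : pairv U wZ = 0).
Hypotheses (wZZ : pairv Z wZ = 1).

(** By the hypotheses on brackets, (ad l)^2 + k sends Y to U and ad l - x kills U. The adjoint
    factor l + x completes these to the self-adjoint operator (l - x)(l^2 + k)(l + x) = l^4 + P l^2
    + P' l + Q with P = 3 x' + k - x^2 and Q = x''' + (k x)' - x x'' - k x^2. The formula is 100 Q -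
    30 P'' - 9 P^2, the fourth order Wilczynski invariant of that operator. *)
Definition wilczynski : A :=
  10 * (l *> l *> l *> x) - 40 * x * (l *> l *> x) - 21 * (l *> x) ^+ 2
  + 54 * x ^+ 2 * (l *> x) - 9 * x ^+ 4
  + k * (46 * (l *> x) - 82 * x ^+ 2) + 100 * (l *> k) * x
  - 30 * (l *> l *> k) - 9 * k ^+ 2.

Hypothesis S0 : forall a, ev (S *> a) = 0.
Hypotheses (tau0 : ev tau = 0) (nu0 : ev nu != 0).

(* The flat functions form an ideal stable under l, and tau is flat because
   l tau = x tau. Modulo flat functions S acts on x and k as if tau were 0, and
   multiplies [wilczynski] by 4 nu. *)
Let flat a := forall j, ev (iter j (act D l) a) = 0.

Let flatD a b : flat a -> flat b -> flat (a + b).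
Proof.
move=> fa fb j; suff -> : iter j (act D l) (a + b) =
    iter j (act D l) a + iter j (act D l) b by rewrite rmorphD fa fb addr0.
by elim: j => //= j ->; rewrite actD.
Qed.

Let flatN a : flat a -> flat (- a).
Proof.
move=> fa j; suff -> : iter j (act D l) (- a) = - iter j (act D l) a.
  by rewrite rmorphN fa oppr0.
by elim: j => //= j ->; rewrite actN.
Qed.

Let flatS a : flat a -> flat (l *> a).
Proof. by move=> fa j; rewrite -iterSr. Qed.

Let flatM a b : flat b -> flat (a * b).
Proof.
move=> fb j; elim: j a b fb => [|j IH] a b fb /=.
  by rewrite rmorphM (fb 0) mulr0.
rewrite -iterS iterSr actM.
have /(_ _ _ _)/= h := flatD; move: j IH => j IH.
suff -> : iter j (act D l) (l *> a * b + a * l *> b) =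
   iter j (act D l) (l *> a * b) + iter j (act D l) (a * l *> b).
  by rewrite rmorphD !IH ?addr0//; exact: flatS.
by elim: j {IH} => //= j ->; rewrite actD.
Qed.

Let flat_ev a : flat a -> ev a = 0.
Proof. by move/(_ 0). Qed.

Let SY1 : [[S, Y1]] = (l *> ga - Y *> nu) *: l + (l *> de - Y *> tau) *: Y
   + (de + nu) *: Y1.
Proof.
rewrite -[in LHS]lY jacobi Sl SY brDl !brZl !brDr !brZr !brxx lY.
by apply/rowP => i; rewrite !mxE; ring.
Qed.

Let a0 := l *> l *> de - l *> Y *> tau - Y1 *> tau + S *> k - 2 * nu * k.
Let a1 := l *> de + l *> de + l *> nu - Y *> tau.
Let a2 := de + 2 * nu.
Let c0 := l *> l *> ga - l *> Y *> nu - Y1 *> nu + k * ga.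

Let SU : [[S, U]] = a0 *: Y + a1 *: Y1 + a2 *: U + tau *: Z + c0 *: l.
Proof.
have -> : U = [[l, Y1]] + k *: Y by rewrite lY1 subrK.
rewrite brDr jacobi Sl SY1 brZr SY brDl !brZl !brDr !brZr !brxx !lY lY1 YY1.
rewrite !actB !actD /a0 /a1 /a2 /c0.
by apply/rowP => i; rewrite !mxE; ring.
Qed.

(** Two expansions of [S, [l, U]]. The components along Z, U and Y1 give the laws for tau, x and k
    respectively. *)
Let SlU : (S *> x) *: U + x *: [[S, U]] =
  nu *: (x *: U) - (U *> nu) *: l + (tau * om) *: U - (U *> tau) *: Y
  + ((l *> a0) *: Y + a0 *: Y1 + (l *> a1) *: Y1 + a1 *: (U - k *: Y)
     + (l *> a2) *: U + a2 *: (x *: U) + (l *> tau) *: Z + tau *: (zeta *: U)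
     + (l *> c0) *: l).
Proof.
rewrite -brZr -lU jacobi Sl brDl !brZl lU YU SU !brDr !brZr lY lY1 lU lZ brxx.
by apply/rowP => i; rewrite !mxE; ring.
Qed.

Let ltau : l *> tau = x * tau.
Proof.
have := congr1 (fun T => pairv T wZ) SlU; rewrite SU.
rewrite !(pairvD, pairvZ, pairvN, wZl, wZY, wZY1, wZU, wZZ) => h.
by apply: (eq_of_sub (esym h)); ring.
Qed.

Let flat_tau : flat tau.
Proof.
suff h j a : ev (iter j (act D l) (a * tau)) = 0 by move=> j; rewrite -[tau]mul1r.
elim: j a => [|j IH] a; first by rewrite /= rmorphM tau0 mulr0.
by rewrite iterSr actM ltau mulrA -mulrDl IH.
Qed.

Let sg := Y *> tau.

(** Comes from the Z-component of the two expansions of [S, [l, Z]]. Modulo flat functions it ties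
    the weight nu of l to the weight de of Y. *)
Let flat_nu : flat (2 * (l *> de) + l *> nu).
Proof.
have snakeZ : [[S, Z]] = ga *: (U - k *: Y) - (Y1 *> ga) *: l + de *: Z
  - (Y1 *> de) *: Y + (Y *> (l *> ga - Y *> nu)) *: l - (l *> ga - Y *> nu) *: Y1
  + (Y *> (l *> de - Y *> tau)) *: Y + (Y *> (de + nu)) *: Y1 + (de + nu) *: Z.
  rewrite -{1}YY1 jacobi SY SY1 brDl !brZl !brDr !brZr lY1 YY1 (brC D Y l) lY brxx.
  by apply/rowP => i; rewrite !mxE; ring.
have : [[S, [[l, Z]]]] = [[S, zeta *: U]] by rewrite lZ.
rewrite jacobi Sl brDl !brZl lZ brZr SU snakeZ.
move/(congr1 (fun T => pairv T wZ)).
rewrite !(brDr, brNr, brZr, brxx, lY, lY1, lU, lZ).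
rewrite !(pairvD, pairvZ, pairvN, pairv0, wZl, wZY, wZY1, wZU, wZZ) !actD => h.
have -> : 2 * (l *> de) + l *> nu = (zeta - pairv [[Y, Z]] wZ) * tau by apply: (eq_of_sub h); ring.
exact: flatM.
Qed.

Let flat_Sx : flat (S *> x - (nu * x - 3 * (l *> de) - sg)).
Proof.
have := congr1 (fun T => pairv T wU) SlU; rewrite SU.
rewrite !(pairvD, pairvZ, pairvN, wUl, wUY, wUY1, wUU, wUZ) /a1 /a2 => h.
have -> : S *> x - (nu * x - 3 * (l *> de) - sg) =
  (om + zeta) * tau + 3 * (2 * (l *> de) + l *> nu).
  by move: h; rewrite !actD actM act_nat /sg => h; apply: (eq_of_sub h); ring.
by apply: flatD; apply: flatM.
Qed.

Let flat_Y1tau : flat (Y1 *> tau - (l *> sg - x * sg)).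
Proof.
rewrite -lY act_br ltau actM.
have -> : l *> sg - (Y *> x * tau + x * sg) - (l *> sg - x * sg) =
  (- (Y *> x)) * tau by ring.
exact: flatM.
Qed.

Let flat_Sk :
  flat (S *> k - (2 * nu * k - l *> l *> de + 3 * (l *> sg) - 2 * x * sg)).
Proof.
have := congr1 (fun T => pairv T wY1) SlU; rewrite SU.
rewrite !(pairvD, pairvZ, pairvN, w1l, w1Y, w1Y1, w1U, w1Z) => h.
have {h} -> : S *> k - (2 * nu * k - l *> l *> de + 3 * (l *> sg) - 2 * x * sg) =
  x * (2 * (l *> de) + l *> nu) - l *> (2 * (l *> de) + l *> nu)
  + (Y1 *> tau - (l *> sg - x * sg)).
  move: h; rewrite /a0 /a1 /sg !actB !actD !actM !act_nat => h.
  by apply: (eq_of_sub (esym h)); ring.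
apply: flatD => //; apply: flatD; first exact: flatM.
by apply: flatN; apply: flatS.
Qed.

(** Modulo the flat function tau, S and l commute up to nu l. Each derivative along l therefore
    raises the weight by nu. *)
Let flat_S a b : flat (S *> a - b) -> flat (S *> (l *> a) - (l *> b + nu * (l *> a))).
Proof.
move=> h; have -> : S *> (l *> a) = l *> (S *> a) + [[S, l]] *> a.
  by rewrite act_br addrC subrK.
rewrite Sl actDl !actZl.
have -> : l *> (S *> a) + (nu * (l *> a) + tau * (Y *> a)) -
   (l *> b + nu * (l *> a)) = l *> (S *> a - b) + (Y *> a) * tau.
  by rewrite actB; ring.
by apply: flatD; [exact: flatS | exact: flatM].
Qed.

Let flat_Utau :
  flat (U *> tau - (l *> (l *> sg - x * sg) - x * (l *> sg - x * sg) + k * sg)).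
Proof.
have -> : U *> tau = [[l, Y1]] *> tau + k * sg.
  by rewrite -actZl -actDl lY1 subrK.
rewrite act_br ltau actM.
set v := l *> sg - x * sg.
have -> : l *> Y1 *> tau - (Y1 *> x * tau + x * (Y1 *> tau)) + k * sg
  - (l *> v - x * v + k * sg) =
  l *> (Y1 *> tau - v) + (- (Y1 *> x)) * tau - x * (Y1 *> tau - v).
  by rewrite actB; ring.
apply: flatD; last by apply: flatN; exact: flatM.
by apply: flatD; [exact: flatS | exact: flatM].
Qed.

(** By [flat_Utau] the expression u stands for U tau, and [l, U] = x U applied to tau yields the
    equation. It is needed because sg = Y tau, unlike tau, is not flat in general and enters the
    laws of x and k. *)
Let flat_sg : let u := l *> (l *> sg - x * sg) - x * (l *> sg - x * sg) + k * sg in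
  flat (l *> u - 2 * x * u).
Proof.
move=> u; have e : l *> (U *> tau) = 2 * x * (U *> tau) + (U *> x) * tau.
  have := act_br D l U tau; rewrite lU actZl ltau !actM => h.
  by apply: (eq_of_sub (esym h)); ring.
have -> : l *> u - 2 * x * u = (U *> x) * tau + 2 * x * (U *> tau - u)
   - l *> (U *> tau - u) by rewrite actB e; ring.
apply: flatD; last by apply: flatN; exact: flatS.
by apply: flatD; exact: flatM.
Qed.

Lemma wilczynski_eq0 : ev wilczynski = 0.
Proof.
have evS a b : flat (S *> a - b) -> ev b = 0.
  by move/flat_ev; rewrite rmorphB S0 => /eqP; rewrite sub0r oppr_eq0 => /eqP.
have gx1 := flat_S flat_Sx; have gx2 := flat_S gx1; have gx3 := flat_S gx2.
have gk1 := flat_S flat_Sk; have gk2 := flat_S gk1.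
have evE := (rmorph_nat ev, act_nat, act0, rmorph0 ev, actN, actM, actD,
  rmorphXn ev, rmorphN ev, rmorphM ev, rmorphD ev).
rewrite /wilczynski !evE.
have /evS := flat_Sx; rewrite !evE => g0.
move/evS: gx1; rewrite !evE => g1.
move/evS: gx2; rewrite !evE => g2.
move/evS: gx3; rewrite !evE => g3.
have /evS := flat_Sk; rewrite !evE => h0.
move/evS: gk1; rewrite !evE => h1.
move/evS: gk2; rewrite !evE => h2.
have /flat_ev := flat_sg; rewrite !evE => r.
have /flat_ev := flat_nu; rewrite !evE => N1.
have /flatS/flat_ev := flat_nu; rewrite !evE => N2.
have /flatS/flatS/flat_ev := flat_nu; rewrite !evE => N3.
move: nu0 g0 g1 g2 g3 h0 h1 h2 r N1 N2 N3.
move: (ev nu) (ev (l *> nu)) (ev (l *> l *> nu)) (ev (l *> l *> l *> nu)).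
move=> n0 n1 n2 n3.
move: (ev sg) (ev (l *> sg)) (ev (l *> l *> sg)) (ev (l *> l *> l *> sg)).
move=> s0 s1 s2 s3.
move: (ev x) (ev (l *> x)) (ev (l *> l *> x)) (ev (l *> l *> l *> x)).
move=> x0 x1 x2 x3.
move: (ev k) (ev (l *> k)) (ev (l *> l *> k)) => k0 k1 k2.
move: (ev (l *> de)) (ev (l *> l *> de)) (ev (l *> l *> l *> de)) (ev (l *> l *> l *> l *> de)).
move=> d1 d2 d3 d4 n0N0 g0 g1 g2 g3 h0 h1 h2 r N1 N2 N3.
have e1 : n1 = - 2 * d1 by apply: (eq_of_sub N1); ring.
have e2 : n2 = - 2 * d2 by apply: (eq_of_sub N2); ring.
have e3 : n3 = - 2 * d3 by apply: (eq_of_sub N3); ring.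
have n04 : 4 * n0 != 0 by rewrite mulf_neq0// pnatr_eq0.
apply: (mulfI n04); rewrite mulr0; subst n1 n2 n3.
have comb c (a b : K) : a = 0 -> b = 0 -> c * a + b = 0.
  by move=> -> ->; rewrite mulr0 addr0.
(* The factors of h0, h1, h2 and g0, ..., g3 are the partial derivatives of [wilczynski] in k, l k,
   l l k and in x and its derivatives, so the sum is the chain rule for S applied to the invariant.
   Adding 100 times the equation [r] cancels all terms in sg. *)
have := comb (46 * x1 - 82 * x0 ^+ 2 - 18 * k0) _ _ h0
  (comb (100 * x0) _ _ h1 (comb (- 30) _ _ h2 (comb 100 _ _ r erefl))).
move/(comb (- 40 * x2 + 108 * x0 * x1 - 36 * x0 ^+ 3 - 164 * k0 * x0
            + 100 * k1) _ _ g0).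
move/(comb (- 42 * x1 + 54 * x0 ^+ 2 + 46 * k0) _ _ g1).
move/(comb (- 40 * x0) _ _ g2)/(comb 10 _ _ g3) => e.
by apply: (eq_of_sub e); ring.
Qed.

End WilczynskiInvariant.

(** * Prolongation of the symmetry equations *)

Inductive spans (A : comNzRingType) (ys : seq A) : A -> Prop :=
| spans_mem y : y \in ys -> spans ys y
| spans0 : spans ys 0
| spansD a b : spans ys a -> spans ys b -> spans ys (a + b)
| spansM c a : spans ys a -> spans ys (c * a).

Section Spans.
Variables (A : comNzRingType) (n : nat) (D : derivations A n).
Implicit Types (ys zs : seq A) (a b c : A).

Lemma spansN ys a : spans ys a -> spans ys (- a).
Proof. by move=> h; rewrite -mulN1r; exact: spansM. Qed.

Lemma spansB ys a b : spans ys a -> spans ys b -> spans ys (a - b).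
Proof. by move=> ha hb; apply: spansD => //; exact: spansN. Qed.

Lemma spans_eq ys a b : spans ys (a - b) -> spans ys b -> spans ys a.
Proof. by move=> ab hb; rewrite -(subrK b a); exact: spansD. Qed.

Lemma spans_sub ys zs a : (forall y, y \in ys -> spans zs y) ->
  spans ys a -> spans zs a.
Proof.
move=> yz; elim=> [y /yz//||b c _ hb _ hc|c b _ hb].
- exact: spans0.
- exact: spansD.
- exact: spansM.
Qed.

Lemma spans_act X ys zs a : (forall y, y \in ys -> spans zs y) ->
  (forall y, y \in ys -> spans zs (act D X y)) ->
  spans ys a -> spans zs (act D X a).
Proof.
move=> yz dyz; elim=> [y /dyz//||b c _ hb _ hc|c b hb' hb].
- by rewrite act0; exact: spans0.
- by rewrite actD; exact: spansD.
- rewrite actM; apply: spansD; last exact: spansM.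
  by apply: spansM; exact: (spans_sub yz).
Qed.

End Spans.

Section Prolongation.
Variables (A : comNzRingType) (n : nat) (D : derivations A n).
Hypothesis nat_inv : forall m, exists j : A, m.+1%:R * j = 1.
Variables (X1 X2 : 'rV[A]_n) (a b c d : A).
Local Notation "X *> u" := (act D X u) (at level 30, right associativity).
Let X3 := br D X1 X2.
Let W := br D X1 X3 + X2.
Let Z := br D X2 X3.
Hypotheses (X1W : br D X1 W = a *: W + b *: Z) (X2W : br D X2 W = 0).
Hypotheses (X1Z : br D X1 Z = 0) (X2Z : br D X2 Z = c *: W + d *: Z).
Variables (f g h : A).
Hypotheses (X1g : X1 *> g = - f - a * g) (X2g : X2 *> g = - (c * h)).
Hypotheses (X1h : X1 *> h = - (b * g)) (X2h : X2 *> h = - f - d * h).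

(* f, g, h are the components of a symmetry along X3, W, Z; fij is X_i X_j f. *)
Let f1 := X1 *> f.
Let f2 := X2 *> f.
Let f11 := X1 *> f1.
Let f12 := X1 *> f2.
Let f21 := X2 *> f1.
Let f22 := X2 *> f2.
Let w1 := X1 *> f21.
Let w2 := X2 *> f12.
Let m := X1 *> w2.

Let L0 := [:: f; g; h].
Let L1 := L0 ++ [:: f1; f2].
Let L2 := L1 ++ [:: f11; f12; f21; f22].
Let L3 := L2 ++ [:: w1; w2].
Let L4 := L3 ++ [:: m].

(* Beyond this point nothing new appears: the six order relations express the
   second derivatives of m through the entries of the list. *)
Definition sym_data := L4 ++ [:: X1 *> m; X2 *> m].

Let L5 := sym_data.

Let X3E u : X3 *> u = X1 *> X2 *> u - X2 *> X1 *> u.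
Proof. exact: act_br. Qed.

Let WE u : W *> u = X1 *> X3 *> u - X3 *> X1 *> u + X2 *> u.
Proof. by rewrite actDl act_br. Qed.

Let ZE u : Z *> u = X2 *> X3 *> u - X3 *> X2 *> u.
Proof. exact: act_br. Qed.

Let spans_div k (ys : seq A) u : spans ys (k.+1%:R * u) -> spans ys u.
Proof.
move=> hu; have [j hj] := nat_inv k.
by rewrite -[u]mul1r -hj -mulrA mulrCA; exact: spansM.
Qed.

Let mono (ys zs : seq A) u : spans ys u -> spans (ys ++ zs) u.
Proof.
by apply: spans_sub => y yi; apply: spans_mem; rewrite mem_cat yi.
Qed.

Let deriv X (ys us : seq A) u : (forall y, y \in ys -> spans (ys ++ us) (X *> y)) ->
  spans ys u -> spans (ys ++ us) (X *> u).
Proof.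
move=> dy; apply: spans_act => // y yi.
by apply: mono; exact: spans_mem.
Qed.

Let allP2 (ys zs : seq A) (P : A -> Prop) : (forall y, y \in ys -> P y) ->
  (forall y, y \in zs -> P y) -> forall y, y \in ys ++ zs -> P y.
Proof. by move=> hy hz y; rewrite mem_cat => /orP[/hy|/hz]. Qed.

Ltac inl := apply: spans_mem;
  cbv [L5 sym_data L4 L3 L2 L1 L0 cat]; rewrite !inE eqxx ?orbT; done.
Ltac leaf := first [assumption | inl | apply: mono; leaf].
Ltac sp := repeat first [leaf | apply: spansD | apply: spansN | apply: spansM].

Let L0d X : X = X1 \/ X = X2 -> forall y, y \in L0 -> spans L1 (X *> y).
Proof.
move=> hX y; rewrite !inE => /or3P[] /eqP->.
- by case: hX => ->; sp.
- by case: hX => ->; rewrite ?X1g ?X2g; sp.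
- by case: hX => ->; rewrite ?X1h ?X2h; sp.
Qed.

Let d1 : forall X u, X = X1 \/ X = X2 -> spans L0 u -> spans L1 (X *> u).
Proof. by move=> X u hX; apply: deriv; exact: L0d. Qed.

Let L1d X : X = X1 \/ X = X2 -> forall y, y \in L1 -> spans L2 (X *> y).
Proof.
move=> hX; apply: allP2 => y; first by move=> /(L0d hX) ?; sp.
by rewrite !inE => /orP[] /eqP->; case: hX => ->; sp.
Qed.

Let d2 : forall X u, X = X1 \/ X = X2 -> spans L1 u -> spans L2 (X *> u).
Proof. by move=> X u hX; apply: deriv; exact: L1d. Qed.

(** Cross differentiation: [X1, X2] applied to g through [X1g] and [X2g] leaves only X2 f modulo f,
    g, h. [Wg], [Zg], [Wh] and [Zh] repeat this one bracket higher. *)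
Let X3g : spans L0 (X3 *> g - f2).
Proof.
rewrite X3E X2g X1g !(actD, actN, actM) X1h X2g /f2.
rewrite [X in spans _ X](_ : _ = - (X1 *> c * h) + c * (b * g) + (X2 *> a) * g
  - (a * c) * h); last by ring.
by sp.
Qed.

Let X3h : spans L0 (X3 *> h + f1).
Proof.
rewrite X3E X2h X1h !(actD, actN, actM) X1h X2g /f1.
rewrite [X in spans _ X](_ : _ = - (X1 *> d) * h + (d * b) * g + (X2 *> b) * g
  - (b * c) * h); last by ring.
by sp.
Qed.

Let hX1 : X1 = X1 \/ X1 = X2. Proof. by left. Qed.
Let hX2 : X2 = X1 \/ X2 = X2. Proof. by right. Qed.

Let Wg : spans L1 (W *> g - (2 * f12 - f21)).
Proof.
have := d1 hX1 X3g; rewrite WE X1g X2g !(actD, actN, actM) => h1.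
have h2 := X3g.
have -> : X1 *> X3 *> g - (- (X3 *> f) - (X3 *> a * g + a * (X3 *> g)))
    - c * h - (2 * f12 - f21) =
  (X1 *> X3 *> g - X1 *> f2) + (X3 *> a * g + a * (X3 *> g - f2) + a * f2) - c * h.
  by rewrite (X3E f) /f12 /f21 -/f1 -/f2; ring.
by sp.
Qed.

Let Zg : spans L1 (Z *> g - f22).
Proof.
have := d1 hX2 X3g; rewrite ZE X2g !(actD, actN, actM) => h1.
have h2 := X3h.
have -> : X2 *> X3 *> g - - (X3 *> c * h + c * (X3 *> h)) - f22 =
  (X2 *> X3 *> g - X2 *> f2) + (X3 *> c * h + c * (X3 *> h + f1) - c * f1).
  by rewrite /f22; ring.
by sp.
Qed.

Let Wh : spans L1 (W *> h + f11).
Proof.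
have := d1 hX1 X3h; rewrite WE X1h X2h !(actD, actN, actM) => h1.
have h2 := X3g.
have -> : X1 *> X3 *> h - - (X3 *> b * g + b * (X3 *> g)) + (- f - d * h) + f11 =
  (X1 *> X3 *> h + X1 *> f1) + (X3 *> b * g + b * (X3 *> g - f2) + b * f2) - f - d * h.
  by rewrite /f11; ring.
by sp.
Qed.

Let Zh : spans L1 (Z *> h - (f12 - 2 * f21)).
Proof.
have := d1 hX2 X3h; rewrite ZE X2h !(actD, actN, actM) => h1.
have h2 := X3h.
have -> : X2 *> X3 *> h - (- (X3 *> f) - (X3 *> d * h + d * (X3 *> h)))
    - (f12 - 2 * f21) =
  (X2 *> X3 *> h + X2 *> f1) + (X3 *> d * h + d * (X3 *> h + f1) - d * f1).
  by rewrite (X3E f) /f12 /f21 -/f1 -/f2; ring.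
by sp.
Qed.

Let Wg2 : spans L2 (W *> g).
Proof. by apply: (@spans_eq _ _ _ (2 * f12 - f21)); have ? := Wg; sp. Qed.

Let Zg2 : spans L2 (Z *> g).
Proof. by apply: (@spans_eq _ _ _ f22); have ? := Zg; sp. Qed.

Let Wh2 : spans L2 (W *> h).
Proof. by apply: (@spans_eq _ _ _ (- f11)); rewrite ?opprK; have ? := Wh; sp. Qed.

Let Zh2 : spans L2 (Z *> h).
Proof. by apply: (@spans_eq _ _ _ (f12 - 2 * f21)); have ? := Zh; sp. Qed.

Let comm X T V u : br D X T = V -> X *> T *> u = T *> X *> u + V *> u.
Proof. by move=> <-; rewrite act_br addrC subrK. Qed.

Let act0l u : (0 : 'rV[A]_n) *> u = 0.
Proof. by rewrite -(subrr X1) actBl subrr. Qed.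

Let X1Wu u : X1 *> W *> u = W *> X1 *> u + a * (W *> u) + b * (Z *> u).
Proof. by rewrite (comm _ X1W) (actDl _ (a *: W)) !actZl addrA. Qed.

Let X2Wu u : X2 *> W *> u = W *> X2 *> u.
Proof. by rewrite (comm _ X2W) act0l addr0. Qed.

Let X2Zu u : X2 *> Z *> u = Z *> X2 *> u + c * (W *> u) + d * (Z *> u).
Proof. by rewrite (comm _ X2Z) (actDl _ (c *: W)) !actZl addrA. Qed.

Let Wf : W *> f = X1 *> f12 - 2 * w1 + X2 *> f11 + f2.
Proof. by rewrite WE !X3E !(actD, actN) -/f1 -/f2 /w1 -/f12 -/f21; ring. Qed.

Let Zf : Z *> f = 2 * w2 - X2 *> f21 - X1 *> f22.
Proof.
by rewrite ZE !X3E !(actD, actN) -/f1 -/f2 /w2 -/f12 -/f21 -/f22; ring.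
Qed.

Let lin (ys : seq A) k e s t : spans ys e -> t = k * e + s -> spans ys s ->
  spans ys t.
Proof. by move=> he -> hs; apply: spansD => //; exact: spansM. Qed.

Ltac expand := rewrite !(act_nat, actN, actM, actD).

(** Commuting X1 and X2 past W and Z on g and h gives six conditions on the eight third derivatives
    of f, which leaves [w1] and [w2] as parameters. This one is [X2, W] = 0 applied to g. *)
Let f221 : spans L2 (X2 *> f21 - 2 * w2).
Proof.
have e0 := d2 hX2 Wg; have h2 := Wh2.
apply: (lin (k := 1) e0 (s := W *> c * h + c * (W *> h))); last by sp.
by expand; rewrite X2Wu X2g; expand; rewrite -/w2; ring.
Qed.

Let f211 : spans L2 (3 * (X1 *> f12) - 3 * w1 + X2 *> f11).
Proof.
have e0 := d2 hX1 Wg; have h2 := Wg2; have h3 := Zg2.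
apply: (lin (k := - 1) e0
  (s := a * (W *> g) + b * (Z *> g) - W *> a * g - a * (W *> g) - f2)); last by sp.
by expand; rewrite X1Wu X1g; expand; rewrite Wf -/w1; ring.
Qed.

Let f222 : spans L2 (X2 *> f22).
Proof.
have e0 := d2 hX2 Zg; have h2 := Wg2; have h3 := Zg2; have h4 := Zh2.
apply: (lin (k := - 1) e0
  (s := c * (W *> g) + d * (Z *> g) - (Z *> c * h + c * (Z *> h)))); last by sp.
by expand; rewrite X2Zu X2g; expand; ring.
Qed.

Let f111 : spans L2 (X1 *> f11).
Proof.
have e0 := d2 hX1 Wh; have h2 := Wg2; have h3 := Zh2; have h4 := Wh2.
apply: (lin (k := 1) e0
  (s := - a * (W *> h) - b * (Z *> h) + (W *> b * g + b * (W *> g)))); last by sp.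
by expand; rewrite X1Wu X1h; expand; ring.
Qed.

Let f112 : spans L2 (X1 *> f12 - 2 * w1).
Proof.
have e0 := d2 hX2 Wh; have h4 := Wh2.
apply: (lin (k := - 1) e0 (s := - (W *> d * h + d * (W *> h)) - f2)); last by sp.
by expand; rewrite X2Wu X2h; expand; rewrite Wf; ring.
Qed.

Let f122 : spans L2 (X1 *> f22 + 3 * w2).
Proof.
have e0 := d2 hX2 Zh; have h2 := Wh2; have h3 := Zh2; have h4 := f221.
apply: (lin (k := 1) e0 (s := - 3 * (X2 *> f21 - 2 * w2) -
  (c * (W *> h) + d * (Z *> h) - (Z *> d * h + d * (Z *> h))))); last by sp.
by expand; rewrite X2Zu X2h; expand; rewrite Zf -/w2; ring.
Qed.

Let f211' : spans L2 (X2 *> f11 + 3 * w1).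
Proof.
have e0 := f211; have h2 := f112.
by apply: (lin (k := 1) e0 (s := - 3 * (X1 *> f12 - 2 * w1))); [ring | sp].
Qed.

Let L2d X : X = X1 \/ X = X2 -> forall y, y \in L2 -> spans L3 (X *> y).
Proof.
move=> hX; apply: allP2 => y; first by move=> /(L1d hX) ?; sp.
have [h1 h2 h3] := And3 f221 f222 f111.
have [h4 h5 h6] := And3 f112 f122 f211'.
rewrite !inE => /or4P[] /eqP->; case: hX => ->; try by sp.
- by apply: (@spans_eq _ _ _ (- 3 * w1)); rewrite ?mulNr ?opprK; sp.
- by apply: (@spans_eq _ _ _ (2 * w1)); sp.
- by apply: (@spans_eq _ _ _ (2 * w2)); sp.
- by apply: (@spans_eq _ _ _ (- 3 * w2)); rewrite ?mulNr ?opprK; sp.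
Qed.

Let d3 : forall X u, X = X1 \/ X = X2 -> spans L2 u -> spans L3 (X *> u).
Proof. by move=> X u hX; apply: deriv; exact: L2d. Qed.

Let WE' u : W *> u = X1 *> X1 *> X2 *> u - 2 * (X1 *> X2 *> X1 *> u)
  + X2 *> X1 *> X1 *> u + X2 *> u.
Proof. by rewrite WE !X3E !(actD, actN); ring. Qed.

Let ZE' u : Z *> u = 2 * (X2 *> X1 *> X2 *> u) - X2 *> X2 *> X1 *> u
  - X1 *> X2 *> X2 *> u.
Proof. by rewrite ZE !X3E !(actD, actN); ring. Qed.

Let Wf3 : spans L3 (W *> f).
Proof.
have h1 := d3 hX1 (_ : spans L2 f12); have h2 := d3 hX2 (_ : spans L2 f11).
by rewrite Wf; have {}h1 := h1 ltac:(sp); have {}h2 := h2 ltac:(sp); sp.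
Qed.

Let Zf3 : spans L3 (Z *> f).
Proof.
have h1 := d3 hX1 (_ : spans L2 f22); have h2 := d3 hX2 (_ : spans L2 f21).
by rewrite Zf; have {}h1 := h1 ltac:(sp); have {}h2 := h2 ltac:(sp); sp.
Qed.

Let e112 := X1 *> f12 - 2 * w1.
Let e211 := X2 *> f11 + 3 * w1.
Let e221 := X2 *> f21 - 2 * w2.
Let e122 := X1 *> f22 + 3 * w2.

(** At fourth order the brackets with W and Z are applied to f itself. With [r2E] and [r3E] a single
    fourth derivative, [m], stays free. *)
Let r1E : spans L3 (X1 *> w1).
Proof.
have h1 := Wf3; have h2 := Zf3; have h3 := d3 hX1 f112.
have h4 := d3 hX1 f211'; have h5 := d3 hX2 f111.
(* [spans_div 9] divides by 10, the coefficient with which X1 w1 survives the elimination. *)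
apply: (@spans_div 9); have := X1Wu f; rewrite Wf WE' => e.
apply: (lin (k := -a) h1 (s := - b * (Z *> f) + (X1 *> e112 + 3 * (X1 *> e211)
  - X2 *> X1 *> f11 - f21 + f12))); last by sp.
move: e; rewrite /e112 /e211 Wf !(act0, act_nat, actN, actM, actD).
by rewrite -/f1 -/f2 -/f21 -/f11 -/f12 -/w1 => e; apply: (eq_of_sub (esym e)); ring.
Qed.

Let r2E : spans L3 (X2 *> w2).
Proof.
have h1 := Wf3; have h2 := Zf3; have h3 := d3 hX2 f221.
have h4 := d3 hX2 f122; have h5 := d3 hX1 f222.
apply: (@spans_div 9); have := X2Zu f; rewrite Zf ZE' => e.
apply: (lin (k := c) h1 (s := d * (Z *> f) + (X2 *> e221 + 3 * (X2 *> e122)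
  - X1 *> X2 *> f22))); last by sp.
move: e; rewrite /e221 /e122 Zf !(act0, act_nat, actN, actM, actD).
by rewrite -/f1 -/f2 -/f21 -/f22 -/f12 -/w2 => e; apply: (eq_of_sub e); ring.
Qed.

Let r3 := X2 *> w1 - m.

Let r3E : spans L3 r3.
Proof.
have h1 := d3 hX2 f211'; have h2 := d3 hX1 f122.
apply: (@spans_div 4); have := X2Wu f; rewrite Wf WE' => e.
apply: (lin (k := 1) h1 (s := - (X1 *> e122))); last by sp.
move: e; rewrite /r3 /e211 /e122 !(act0, act_nat, actN, actM, actD).
rewrite -/f1 -/f2 -/f21 -/f22 -/f11 -/f12 -/w2 -/m => e.
by apply: (eq_of_sub (esym e)); ring.
Qed.

Let L3d X : X = X1 \/ X = X2 -> forall y, y \in L3 -> spans L4 (X *> y).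
Proof.
move=> hX; apply: allP2 => y; first by move=> /(L2d hX) ?; sp.
have [h1 h2 h3] := And3 r1E r2E r3E.
rewrite !inE => /orP[] /eqP->; case: hX => ->; try by sp.
by apply: (@spans_eq _ _ _ m); sp.
Qed.

Let d4 : forall X u, X = X1 \/ X = X2 -> spans L3 u -> spans L4 (X *> u).
Proof. by move=> X u hX; apply: deriv; exact: L3d. Qed.

Let L4d X : X = X1 \/ X = X2 -> forall y, y \in L4 -> spans L5 (X *> y).
Proof.
move=> hX; apply: allP2 => y; first by move=> /(L3d hX) ?; sp.
by rewrite !inE => /eqP->; case: hX => ->; sp.
Qed.

Let d5 : forall X u, X = X1 \/ X = X2 -> spans L4 u -> spans L5 (X *> u).
Proof. by move=> X u hX; apply: deriv; exact: L4d. Qed.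

Let WZ5 u : spans L2 u -> spans L5 (W *> u) /\ spans L5 (Z *> u).
Proof.
move=> hu; have h1 := d3 hX1 hu; have h2 := d3 hX2 hu.
have h12 := d4 hX1 h2; have h21 := d4 hX2 h1.
have h11 := d4 hX1 h1; have h22 := d4 hX2 h2.
have h112 := d5 hX1 h12; have h121 := d5 hX1 h21; have h211 := d5 hX2 h11.
have h212 := d5 hX2 h12; have h221 := d5 hX2 h21; have h122 := d5 hX1 h22.
by rewrite WE' ZE'; split; sp.
Qed.

Let f12_2 : spans L2 f12. Proof. by sp. Qed.
Let f21_2 : spans L2 f21. Proof. by sp. Qed.

Let ex112 : exists2 q, spans L2 q & X1 *> f12 = q + 2 * w1.
Proof. by exists e112; [exact: f112 | rewrite /e112 subrK]. Qed.

Let ex221 : exists2 q, spans L2 q & X2 *> f21 = q + 2 * w2.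
Proof. by exists e221; [exact: f221 | rewrite /e221 subrK]. Qed.

Let exw1 : exists2 q, spans L3 q & X2 *> w1 = q + m.
Proof. by exists r3; [exact: r3E | rewrite /r3 subrK]. Qed.

(** At fifth order only X1 m and X2 m are new. [Wf12], [Zf21] and [Wf21] record how they enter, so
    that one more commutation reaches the second derivatives of [m]. *)
Let Wf12 : spans L4 (W *> f12 + 3 * (X1 *> m)).
Proof.
have [q hq fE] := ex112; have [r hr w12] := exw1.
have e21 := d4 hX1 (d3 hX2 hq); have e12 := d4 hX2 (d3 hX1 hq).
have h1 := d4 hX1 hr; have h2 := d4 hX2 r1E.
apply: (lin (k := - 2) e21 (s := - 4 * (X1 *> r) + X2 *> X1 *> q
  + 2 * (X2 *> X1 *> w1) + w2)); last by sp.
rewrite WE' fE !(act0, act_nat, actM, actD) w12.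
by rewrite !(act0, act_nat, actM, actD) -/w2 -/m; ring.
Qed.

Let Zf21 : spans L4 (Z *> f21 - 3 * (X2 *> m)).
Proof.
have [q hq fE] := ex221; have [r hr w12] := exw1.
have e21 := d4 hX2 (d3 hX1 hq); have e12 := d4 hX1 (d3 hX2 hq).
have h1 := d4 hX2 hr; have h2 := d4 hX1 r2E.
apply: (lin (k := 2) e21 (s := - (X2 *> r) - X1 *> X2 *> q
  - 2 * (X1 *> X2 *> w2))); last by sp.
rewrite ZE' fE !(act0, act_nat, actM, actD) -/w1 w12.
by rewrite !(act0, act_nat, actM, actD) -/m; ring.
Qed.

Let Wf21 : spans L4 (W *> f21).
Proof.
have [q hq fE] := ex221; have [r hr w12] := exw1.
have e11 := d4 hX1 (d3 hX1 hq); have e1 := hq.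
have h1 := d4 hX1 hr; have h2 := d4 hX2 r1E.
apply: (lin (k := 1) e11 (s := - 2 * (X1 *> r) + X2 *> X1 *> w1
  + q + 2 * w2)); last by sp.
rewrite WE' fE !(act0, act_nat, actM, actD) -/w1 w12.
by rewrite !(act0, act_nat, actM, actD) -/m; ring.
Qed.

Let m11 : spans L5 (X1 *> X1 *> m).
Proof.
have [q hq fE] := ex112; have [r hr w12] := exw1.
have h1 := d5 hX1 Wf12; have [hW hZ] := WZ5 f12_2; have [h2 _] := WZ5 hq.
have h3 := d5 hX1 (d4 hX1 hr); have h4 := d5 hX1 (d4 hX2 r1E).
have h5 := d5 hX2 (d4 hX1 r1E); have h6 := hr.
apply: (@spans_div 4); have := X1Wu f12; rewrite fE => e.
apply: (lin (k := 1) h1 (s := - (W *> q) - 2 * (X1 *> X1 *> r)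
  + 4 * (X1 *> X2 *> X1 *> w1) - 2 * (X2 *> X1 *> X1 *> w1) - 2 * (r + m)
  - a * (W *> f12) - b * (Z *> f12))); last by sp.
move: e; rewrite !(act0, act_nat, actM, actD) (WE' w1) w12.
rewrite !(act0, act_nat, actM, actD) => e.
by apply: (eq_of_sub (esym e)); ring.
Qed.

Let m22 : spans L5 (X2 *> X2 *> m).
Proof.
have [q hq fE] := ex221; have [r hr w12] := exw1.
have h1 := d5 hX2 Zf21; have [hW hZ] := WZ5 f21_2; have [_ h2] := WZ5 hq.
have h3 := d5 hX2 (d4 hX1 r2E); have h4 := d5 hX1 (d4 hX2 r2E).
apply: (@spans_div 4); have := X2Zu f21; rewrite fE => e.
apply: (lin (k := - 1) h1 (s := Z *> q + 4 * (X2 *> X1 *> X2 *> w2)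
  - 2 * (X1 *> X2 *> X2 *> w2) + c * (W *> f21) + d * (Z *> f21))); last by sp.
move: e; rewrite !(act0, act_nat, actN, actM, actD) (ZE' w2) -/m => e.
by apply: (eq_of_sub e); ring.
Qed.

(** [X2, W] = 0 applied to f12 here, and to f21 in [m12b], gives two independent equations for X1 X2
    m and X2 X1 m. Elimination leaves the factor 6 for either unknown, hence [spans_div 5] below. *)
Let m12a : spans L5 (2 * (X1 *> X2 *> m) - 4 * (X2 *> X1 *> m)).
Proof.
have h1 := d5 hX2 Wf12; have h2 := d5 hX1 (d4 hX1 r2E); have h3 := r2E.
have := X2Wu f12; rewrite -/w2 (WE' w2) -/m => e.
apply: (lin (k := - 1) h1 (s := X1 *> X1 *> X2 *> w2 + X2 *> w2)); last by sp.
rewrite !(act0, act_nat, actM, actD) e.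
by ring.
Qed.

Let m12b : spans L5 (4 * (X1 *> X2 *> m) - 2 * (X2 *> X1 *> m)).
Proof.
have [q hq fE] := ex221; have [r hr w12] := exw1.
have h1 := d5 hX2 Wf21; have h2 := d5 hX1 (d4 hX1 r2E); have h3 := r2E.
have [h4 _] := WZ5 hq.
have := X2Wu f21; rewrite fE => e.
apply: (lin (k := - 1) h1 (s := W *> q + 2 * (X1 *> X1 *> X2 *> w2 + X2 *> w2)));
  last by sp.
rewrite e !(act0, act_nat, actM, actD) (WE' w2) -/m.
by ring.
Qed.

Let m12 : spans L5 (X1 *> X2 *> m).
Proof.
have e0 := m12b; apply: (@spans_div 5).
by apply: (lin (k := -1) m12a (s := 2 * (4 * (X1 *> X2 *> m) - 2 * (X2 *> X1 *> m))));
  [ring | sp].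
Qed.

Let m21 : spans L5 (X2 *> X1 *> m).
Proof.
have e0 := m12b; apply: (@spans_div 5).
by apply: (lin (k := -2) m12a (s := 4 * (X1 *> X2 *> m) - 2 * (X2 *> X1 *> m)));
  [ring | sp].
Qed.

Lemma sym_data_closed y :
  y \in sym_data -> spans sym_data (X1 *> y) /\ spans sym_data (X2 *> y).
Proof.
move: y; apply: allP2 => y.
  by move=> hy; split; [exact: (L4d hX1) | exact: (L4d hX2)].
have [h1 h2] := (m11, m12); have [h3 h4] := (m21, m22).
by rewrite !inE => /orP[] /eqP->.
Qed.

End Prolongation.

(** * The snake frame *)

Section Derivations.
Variables (A : comNzRingType) (n : nat) (D : derivations A n).
Lemma der0 i : D i 0 = 0.
Proof. by apply: (addrI (D i 0)); rewrite -derD !addr0. Qed.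
Lemma derN i a : D i (- a) = - D i a.
Proof. by apply: (addrI (D i a)); rewrite -derD !subrr der0. Qed.
Lemma der1 i : D i 1 = 0.
Proof.
by apply: (addrI (D i 1)); rewrite addr0 -[in RHS](mulr1 1) derM mulr1 mul1r.
Qed.
Lemma der_nat i k : D i k%:R = 0.
Proof. by elim: k => [|k IH]; rewrite ?der0// -natr1 derD IH der1 addr0. Qed.
End Derivations.

(** * Brackets in a frame moving with the middle segment *)

Section MovingFrame.
Variables (A : comNzRingType) (D : derivations A 5) (c s : 'I_5 -> A).
Hypothesis Dc : forall i j, D i (c j) = - ((j == i)%:R * s j).
Hypothesis Dsn : forall i j, D i (s j) = (j == i)%:R * c j.
Hypothesis cs1 : forall j, c j * c j + s j * s j = 1.

Definition mrow (a0 a1 a2 a3 a4 : A) : 'rV[A]_5 := \row_i [:: a0; a1; a2; a3; a4]`_i.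

(* The moving frame is d/dv1, d/dv3, d/dv2 and the translations along and across
   the middle segment. *)
Definition frame_comb (x1 x3 x0 xf xl : A) : 'rV[A]_5 :=
  mrow x1 x0 x3 (c 1 * xf - s 1 * xl) (s 1 * xf + c 1 * xl).

Definition frame_cocomb (x1 x3 x0 xf xl : A) : 'cV[A]_5 := (frame_comb x1 x3 x0 xf xl)^T.

Lemma big_ord5 (F : 'I_5 -> A) :
  \sum_i F i = F 0 + F 1 + F 2%:R + F 3%:R + F 4%:R.
Proof.
rewrite !big_ord_recr big_ord0 /= add0r.
by congr (F _ + F _ + F _ + F _ + F _); apply: val_inj.
Qed.

Lemma ord5P (P : 'I_5 -> Prop) :
  P 0 -> P 1 -> P 2%:R -> P 3%:R -> P 4%:R -> forall i, P i.
Proof.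
move=> P0 P1 P2 P3 P4 [[|[|[|[|[|//]]]]] hi].
- by rewrite (_ : Ordinal hi = 0)//; exact: val_inj.
- by rewrite (_ : Ordinal hi = 1)//; exact: val_inj.
- by rewrite (_ : Ordinal hi = 2%:R)//; exact: val_inj.
- by rewrite (_ : Ordinal hi = 3%:R)//; exact: val_inj.
- by rewrite (_ : Ordinal hi = 4%:R)//; exact: val_inj.
Qed.

Lemma row5P (X Y : 'rV[A]_5) : X 0 0 = Y 0 0 -> X 0 1 = Y 0 1 ->
  X 0 2%:R = Y 0 2%:R -> X 0 3%:R = Y 0 3%:R -> X 0 4%:R = Y 0 4%:R -> X = Y.
Proof. by move=> *; apply/rowP; apply: ord5P. Qed.

Lemma combE x1 x3 x0 xf xl : let X := frame_comb x1 x3 x0 xf xl in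
  (X 0 0 = x1) * (X 0 1 = x0) * (X 0 2%:R = x3) *
  (X 0 3%:R = c 1 * xf - s 1 * xl) * (X 0 4%:R = s 1 * xf + c 1 * xl).
Proof. by rewrite /frame_comb /mrow !mxE. Qed.

Lemma comb_pair x1 x3 x0 xf xl y1 y3 y0 yf yl :
  pairv (frame_comb x1 x3 x0 xf xl) (frame_cocomb y1 y3 y0 yf yl) =
  x1 * y1 + x3 * y3 + x0 * y0 + xf * yf + xl * yl.
Proof.
rewrite /pairv mxE big_ord5 ![frame_cocomb _ _ _ _ _ _ _]mxE !combE.
transitivity (x1 * y1 + x3 * y3 + x0 * y0
  + (c 1 * c 1 + s 1 * s 1) * (xf * yf + xl * yl)); first by ring.
by rewrite cs1; ring.
Qed.

(** Functions of the shape angles v1 and v3 alone. The moving frame is used because all snake fields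
    have such components in it. *)
Definition base F := [/\ D 1 F = 0, D 3%:R F = 0 & D 4%:R F = 0].

Lemma act_comb x1 x3 x0 xf xl F : base F ->
  act D (frame_comb x1 x3 x0 xf xl) F = x1 * D 0 F + x3 * D 2%:R F.
Proof. by case=> F1 F3 F4; rewrite /act big_ord5 !combE F1 F3 F4; ring. Qed.

Lemma baseD F G : base F -> base G -> base (F + G).
Proof. by move=> [f1 f3 f4] [g1 g3 g4]; split; rewrite derD ?(f1, f3, f4) ?(g1, g3, g4) addr0. Qed.
Lemma baseM F G : base F -> base G -> base (F * G).
Proof.
move=> [f1 f3 f4] [g1 g3 g4]; split;
by rewrite derM ?(f1, f3, f4) ?(g1, g3, g4) mul0r mulr0 addr0.
Qed.
Lemma baseN F : base F -> base (- F).
Proof. by move=> [f1 f3 f4]; split; rewrite derN ?(f1, f3, f4) oppr0. Qed.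
Lemma base0 : base 0. Proof. by split; exact: der0. Qed.
Lemma base1 : base 1. Proof. by split; exact: der1. Qed.
Lemma base_nat k : base k%:R. Proof. by split; exact: der_nat. Qed.
Lemma base_der i F : base F -> base (D i F).
Proof. by move=> [f1 f3 f4]; split; rewrite der_comm ?(f1, f3, f4) der0. Qed.

Lemma base_inv F G : F * G = 1 -> base F -> base G.
Proof.
move=> FG [f1 f3 f4].
have key i : D i F = 0 -> D i G = 0.
  move=> dF; have := congr1 (D i) FG; rewrite derM dF mul0r add0r der1 => h.
  by rewrite -[D i G]mul1r -FG mulrAC h mul0r.
by split; apply: key.
Qed.

Lemma base_c1 : base (c 0).
Proof. by split; rewrite Dc mul0r oppr0. Qed.
Lemma base_s1 : base (s 0).
Proof. by split; rewrite Dsn mul0r. Qed.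
Lemma base_c3 : base (c 2%:R).
Proof. by split; rewrite Dc mul0r oppr0. Qed.
Lemma base_s3 : base (s 2%:R).
Proof. by split; rewrite Dsn mul0r. Qed.

(** The derivative-free terms are the structure constants of the Lie algebra of plane motions: the
    directions along and across the middle segment turn into each other under d/dv2. *)
Lemma comb_br x1 x3 x0 xf xl y1 y3 y0 yf yl :
  base x1 -> base x3 -> base x0 -> base xf -> base xl ->
  base y1 -> base y3 -> base y0 -> base yf -> base yl ->
  let X F := x1 * D 0 F + x3 * D 2%:R F in
  let Y F := y1 * D 0 F + y3 * D 2%:R F in
  br D (frame_comb x1 x3 x0 xf xl) (frame_comb y1 y3 y0 yf yl) =
  frame_comb (X y1 - Y x1) (X y3 - Y x3) (X y0 - Y x0)
    (X yf - Y xf - (x0 * yl - xl * y0)) (X yl - Y xl + (x0 * yf - xf * y0)).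
Proof.
move=> bx1 bx3 bx0 bxf bxl by1 by3 by0 byf byl X Y.
have Ac Z_1 Z_3 Z0 Zf Zl : act D (frame_comb Z_1 Z_3 Z0 Zf Zl) (c 1) = - (Z0 * s 1).
  by rewrite /act big_ord5 !combE !Dc /= !mul0r !mul1r; ring.
have As Z_1 Z_3 Z0 Zf Zl : act D (frame_comb Z_1 Z_3 Z0 Zf Zl) (s 1) = Z0 * c 1.
  by rewrite /act big_ord5 !combE !Dsn /= !mul0r !mul1r; ring.
apply: row5P; rewrite /br mxE !combE; rewrite ?(actD, actN, actM) ?Ac ?As.
all: rewrite !act_comb// /X /Y; ring.
Qed.

End MovingFrame.

Section RowEntries.
Variable A : comNzRingType.
Implicit Types (X Y : 'rV[A]_5).
Lemma rowD X Y i : (X + Y) 0 i = X 0 i + Y 0 i. Proof. exact: mxE. Qed.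
Lemma rowZ a X i : (a *: X) 0 i = a * X 0 i. Proof. exact: mxE. Qed.
Lemma rowN X i : (- X) 0 i = - X 0 i. Proof. exact: mxE. Qed.
Lemma row0E i : (0 : 'rV[A]_5) 0 i = 0. Proof. exact: mxE. Qed.
End RowEntries.

Section SnakeFrame.
Variables (A : comNzRingType) (D : derivations A 5) (c s : 'I_5 -> A).
Hypothesis Dc : forall i j, D i (c j) = - ((j == i)%:R * s j).
Hypothesis Dsn : forall i j, D i (s j) = (j == i)%:R * c j.
Hypothesis cs1 : forall j, c j * c j + s j * s j = 1.
Variables (ka la kb lb : A).
Hypotheses (Dka : forall i, D i ka = 0) (Dla : forall i, D i la = 0).
Hypotheses (Dkb : forall i, D i kb = 0) (Dlb : forall i, D i lb = 0).

Local Notation c1 := (c 0).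
Local Notation s1 := (s 0).
Local Notation c3 := (c 2%:R).
Local Notation s3 := (s 2%:R).
Local Notation comb := (frame_comb c s).
Local Notation base := (base D).

Lemma trig_der :
  (D 0 c1 = - s1) * (D 0 s1 = c1) * (D 2%:R c1 = 0) * (D 2%:R s1 = 0) *
  ((D 0 c3 = 0) * (D 0 s3 = 0) * (D 2%:R c3 = - s3) * (D 2%:R s3 = c3)).
Proof. by rewrite !Dc !Dsn /= !mul0r !mul1r oppr0. Qed.

Let dE := (derD, derM, derN, der1, der0, der_nat, trig_der, Dka, Dla, Dkb, Dlb).

Let cc1 : c1 * c1 = 1 - s1 * s1.
Proof. by rewrite -(cs1 0) addrK. Qed.
Let cc3 : c3 * c3 = 1 - s3 * s3.
Proof. by rewrite -(cs1 2%:R) addrK. Qed.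

Let bka : base ka. Proof. by split; rewrite Dka. Qed.
Let bla : base la. Proof. by split; rewrite Dla. Qed.
Let bkb : base kb. Proof. by split; rewrite Dkb. Qed.
Let blb : base lb. Proof. by split; rewrite Dlb. Qed.
Let bc1 : base c1 := base_c1 Dc.
Let bs1 : base s1 := base_s1 Dsn.
Let bc3 : base c3 := base_c3 Dc.
Let bs3 : base s3 := base_s3 Dsn.

Ltac basis := repeat first [assumption | apply: base0 | apply: base1 |
  apply: base_nat | apply: baseD | apply: baseN | apply: baseM |
  apply: base_der].

Definition snakeX1 := comb (1 + ka * c1) (1 + kb * c3) (- 1) 0 0.
Definition snakeX2 := comb (- (la * s1)) (lb * s3) 0 1 0.
Definition snakeX3 := comb (- (la * (c1 + ka))) (lb * (c3 + kb)) 0 0 (- 1).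
(** W = [X1, X3] + X2 and Z = [X2, X3] have components only along d/dv1 and d/dv3; adding X2 cancels
    the translation in [X1, X3]. Their 2 by 2 determinant decides whether the five fields form a
    frame. *)
Definition W_1 := - (ka * ka * la * s1).
Definition W_3 := kb * kb * lb * s3.
Definition Z_1 := - (la * la * (1 + ka * c1)).
Definition Z_3 := - (lb * lb * (1 + kb * c3)).
Definition snakeW := comb W_1 W_3 0 0 0.
Definition snakeZ := comb Z_1 Z_3 0 0 0.

Lemma br_snakeX1_X2 : br D snakeX1 snakeX2 = snakeX3.
Proof.
rewrite comb_br; try by basis.
by congr frame_comb; rewrite !dE; ring: cc1 cc3.
Qed.

Lemma br_snakeX1_X3 : br D snakeX1 snakeX3 + snakeX2 = snakeW.
Proof.
rewrite comb_br; try by basis.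
apply: row5P; rewrite !(rowD, combE) /W_1 /W_3 !dE; ring: cc1 cc3.
Qed.

Lemma br_snakeX2_X3 : br D snakeX2 snakeX3 = snakeZ.
Proof.
rewrite comb_br; try by basis.
by congr frame_comb; rewrite /Z_1 /Z_3 !dE; ring: cc1 cc3.
Qed.

Let Wp := - (ka * ka * la * (c1 + ka)).
Let Wq := kb * kb * lb * (c3 + kb).
Let Zp := - (la * la * la * (c1 + ka)).
Let Zq := lb * lb * lb * (c3 + kb).

Let br_snakeX1_W : br D snakeX1 snakeW = comb Wp Wq 0 0 0.
Proof.
rewrite comb_br; try by rewrite /W_1 /W_3; basis.
by congr frame_comb; rewrite /W_1 /W_3 /Wp /Wq !dE; ring: cc1 cc3.
Qed.

Lemma br_snakeX2_W : br D snakeX2 snakeW = 0.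
Proof.
rewrite comb_br; try by rewrite /W_1 /W_3; basis.
by apply: row5P; rewrite combE row0E /W_1 /W_3 !dE; ring: cc1 cc3.
Qed.

Lemma br_snakeX1_Z : br D snakeX1 snakeZ = 0.
Proof.
rewrite comb_br; try by rewrite /Z_1 /Z_3; basis.
by apply: row5P; rewrite combE row0E /Z_1 /Z_3 !dE; ring: cc1 cc3.
Qed.

Let br_snakeX2_Z : br D snakeX2 snakeZ = comb Zp Zq 0 0 0.
Proof.
rewrite comb_br; try by rewrite /Z_1 /Z_3; basis.
by congr frame_comb; rewrite /Z_1 /Z_3 /Zp /Zq !dE; ring: cc1 cc3.
Qed.

Variable iD : A.
Hypothesis iDP : (W_1 * Z_3 - W_3 * Z_1) * iD = 1.

(** Cramer's rule in the plane of d/dv1 and d/dv3. *)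
Let vertical p q :
  comb p q 0 0 0 = ((p * Z_3 - q * Z_1) * iD) *: snakeW + ((W_1 * q - W_3 * p) * iD) *: snakeZ.
Proof.
apply: row5P; rewrite !(rowD, rowZ, combE).
- rewrite -[LHS]mulr1 -iDP; ring.
- ring.
- rewrite -[LHS]mulr1 -iDP; ring.
- ring.
- ring.
Qed.

Definition coefW1 := (Wp * Z_3 - Wq * Z_1) * iD.
Definition coefW2 := (W_1 * Wq - W_3 * Wp) * iD.
Definition coefZ1 := (Zp * Z_3 - Zq * Z_1) * iD.
Definition coefZ2 := (W_1 * Zq - W_3 * Zp) * iD.

Lemma br_snakeX1_WE : br D snakeX1 snakeW = coefW1 *: snakeW + coefW2 *: snakeZ.
Proof. by rewrite br_snakeX1_W vertical. Qed.

Lemma br_snakeX2_ZE : br D snakeX2 snakeZ = coefZ1 *: snakeW + coefZ2 *: snakeZ.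
Proof. by rewrite br_snakeX2_Z vertical. Qed.

(** [co1], [co2], [co3], [coW], [coZ] form the coframe dual to X1, X2, X3, W, Z, as [frame_pair]
    verifies. *)
Definition co1 := frame_cocomb c s 0 0 (- 1) 0 0.
Definition co2 := frame_cocomb c s 0 0 0 1 0.
Definition co3 := frame_cocomb c s 0 0 0 0 (- 1).
Definition coW := frame_cocomb c s (iD * Z_3) (- (iD * Z_1))
  (iD * (Z_3 * (1 + ka * c1) - Z_1 * (1 + kb * c3)))
  (iD * (Z_3 * (la * s1) + Z_1 * (lb * s3)))
  (- (iD * (Z_3 * (la * (c1 + ka)) + Z_1 * (lb * (c3 + kb))))).
Definition coZ := frame_cocomb c s (- (iD * W_3)) (iD * W_1)
  (iD * (W_1 * (1 + kb * c3) - W_3 * (1 + ka * c1)))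
  (- (iD * (W_1 * (lb * s3) + W_3 * (la * s1))))
  (iD * (W_1 * (lb * (c3 + kb)) + W_3 * (la * (c1 + ka)))).

Lemma row_comb (T : 'rV[A]_5) : exists x1 x3 x0 xf xl, T = comb x1 x3 x0 xf xl.
Proof.
exists (T 0 0), (T 0 2%:R), (T 0 1), (c 1 * T 0 3%:R + s 1 * T 0 4%:R),
  (c 1 * T 0 4%:R - s 1 * T 0 3%:R).
apply: row5P; rewrite !combE => //.
- by rewrite -[LHS]mul1r -(cs1 1); ring.
- by rewrite -[LHS]mul1r -(cs1 1); ring.
Qed.

Lemma frame_dec (T : 'rV[A]_5) : T = pairv T co1 *: snakeX1 + pairv T co2 *: snakeX2
  + pairv T co3 *: snakeX3 + pairv T coW *: snakeW + pairv T coZ *: snakeZ.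
Proof.
have [x1 [x3 [x0 [xf [xl ->]]]]] := row_comb T.
rewrite !comb_pair//; apply: row5P; rewrite !(rowD, rowZ, combE).
- by apply: (eq_of_sub (congr1 (fun y => - (x1 + x0 * (1 + ka * c1)
    + xf * la * s1 - xl * la * (c1 + ka)) * y) iDP)); cbv beta; ring.
- by ring.
- by apply: (eq_of_sub (congr1 (fun y => - (x3 + x0 * (1 + kb * c3)
    - xf * lb * s3 + xl * lb * (c3 + kb)) * y) iDP)); cbv beta; ring.
- by ring.
- by ring.
Qed.

Lemma frame_pair :
  ((pairv snakeX1 co1 = 1) * (pairv snakeX2 co1 = 0) * (pairv snakeX3 co1 = 0)
   * (pairv snakeW co1 = 0) * (pairv snakeZ co1 = 0)) *
  ((pairv snakeX1 co2 = 0) * (pairv snakeX2 co2 = 1) * (pairv snakeX3 co2 = 0)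
   * (pairv snakeW co2 = 0) * (pairv snakeZ co2 = 0)) *
  ((pairv snakeX1 co3 = 0) * (pairv snakeX2 co3 = 0) * (pairv snakeX3 co3 = 1)
   * (pairv snakeW co3 = 0) * (pairv snakeZ co3 = 0)) *
  ((pairv snakeX1 coW = 0) * (pairv snakeX2 coW = 0) * (pairv snakeX3 coW = 0)
   * (pairv snakeW coW = 1) * (pairv snakeZ coW = 0)) *
  ((pairv snakeX1 coZ = 0) * (pairv snakeX2 coZ = 0) * (pairv snakeX3 coZ = 0)
   * (pairv snakeW coZ = 0) * (pairv snakeZ coZ = 1)).
Proof.
rewrite !comb_pair//; do !split; first [ring | by rewrite -[RHS]iDP; ring].
Qed.

Section Symmetry.
Variables (T : 'rV[A]_5) (al be ga de : A).
Hypothesis TX1 : br D T snakeX1 = al *: snakeX1 + be *: snakeX2.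
Hypothesis TX2 : br D T snakeX2 = ga *: snakeX1 + de *: snakeX2.
Local Notation f1 := (pairv T co1).
Local Notation f2 := (pairv T co2).
Local Notation f := (pairv T co3).
Local Notation g := (pairv T coW).
Local Notation h := (pairv T coZ).
Local Notation "X *> u" := (act D X u) (at level 30, right associativity).

Let br31 : br D snakeX3 snakeX1 = snakeX2 - snakeW.
Proof. by rewrite brC -br_snakeX1_X3; apply/rowP => i; rewrite !mxE; ring. Qed.

Let E1 : br D T snakeX1 = - (f2 *: snakeX3) + f *: (snakeX2 - snakeW) - g *: (coefW1 *: snakeW + coefW2 *: snakeZ)
  - ((snakeX1 *> f1) *: snakeX1 + (snakeX1 *> f2) *: snakeX2 + (snakeX1 *> f) *: snakeX3
     + (snakeX1 *> g) *: snakeW + (snakeX1 *> h) *: snakeZ).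
Proof.
rewrite {1}(frame_dec T) !brDl !brZl brxx (brC _ snakeX2) br_snakeX1_X2 br31.
rewrite (brC _ snakeW) br_snakeX1_WE (brC _ snakeZ) br_snakeX1_Z.
by apply/rowP => i; rewrite !mxE; ring.
Qed.

Let E2 : br D T snakeX2 = f1 *: snakeX3 - f *: snakeZ - h *: (coefZ1 *: snakeW + coefZ2 *: snakeZ)
  - ((snakeX2 *> f1) *: snakeX1 + (snakeX2 *> f2) *: snakeX2 + (snakeX2 *> f) *: snakeX3
     + (snakeX2 *> g) *: snakeW + (snakeX2 *> h) *: snakeZ).
Proof.
rewrite {1}(frame_dec T) !brDl !brZl brxx br_snakeX1_X2 (brC _ snakeX3) br_snakeX2_X3.
rewrite (brC _ snakeW) br_snakeX2_W (brC _ snakeZ) br_snakeX2_ZE.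
by apply/rowP => i; rewrite !mxE; ring.
Qed.

Let pE := (pairvD, pairvN, pairvZ, frame_pair, mulr0, mulr1, addr0, add0r, oppr0).

Ltac extract E co :=
  let h0 := fresh in
  have h0 := congr1 (fun V => pairv V co) E; move: h0; rewrite ?(TX1, TX2) !pE => h0;
  first [apply: (eq_of_sub h0); ring | apply: (eq_of_sub (esym h0)); ring].

(** The ten equations are the components of [T, X1] and [T, X2] in the dual coframe. Those along X3,
    W, Z vanish because both brackets lie in D; those along X1, X2 compute al, be, ga, de. *)
Lemma sym_pde : [/\ (snakeX1 *> g = - f - coefW1 * g) /\ (snakeX2 *> g = - (coefZ1 * h)),
   (snakeX1 *> h = - (coefW2 * g)) /\ (snakeX2 *> h = - f - coefZ2 * h),
   f1 = snakeX2 *> f /\ f2 = - (snakeX1 *> f),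
   al = - (snakeX1 *> f1) /\ be = f - snakeX1 *> f2 &
   ga = - (snakeX2 *> f1) /\ de = - (snakeX2 *> f2) ].
Proof.
split; split.
- extract E1 coW.
- extract E2 coW.
- extract E1 coZ.
- extract E2 coZ.
- extract E2 co3.
- extract E1 co3.
- extract E1 co1.
- extract E1 co2.
- extract E2 co1.
- extract E2 co2.
Qed.

End Symmetry.

End SnakeFrame.

(** * The Wilczynski invariant of the abnormal curves *)

Section AbnormalFrame.
Variables (A : comNzRingType) (D : derivations A 5) (c s : 'I_5 -> A).
Hypothesis Dc : forall i j, D i (c j) = - ((j == i)%:R * s j).
Hypothesis Dsn : forall i j, D i (s j) = (j == i)%:R * c j.
Hypothesis cs1 : forall j, c j * c j + s j * s j = 1.
Hypothesis nat_inv : forall m, exists j : A, m.+1%:R * j = 1.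
Variables (ka la kb lb L : A).
Hypotheses (Dka : forall i, D i ka = 0) (Dla : forall i, D i la = 0).
Hypotheses (Dkb : forall i, D i kb = 0) (Dlb : forall i, D i lb = 0).
Hypotheses (DL : forall i, D i L = 0) (Llb : L * lb = 1).

Local Notation c1 := (c 0).
Local Notation s1 := (s 0).
Local Notation c3 := (c 2%:R).
Local Notation s3 := (s 2%:R).
Local Notation comb := (frame_comb c s).
Local Notation cocomb := (frame_cocomb c s).
Local Notation base := (base D).

(** [abn_phi] and [abn_norm] are the d/dv1 and d/dv3 components of (1 + kb c3) X1 + kb^2 L s3 X2.
    These coefficients solve a [W_3] + b [Z_3] = 0, the equation of the characteristic direction
    once v1 is forgotten. Since [abn_norm] = (1 + kb c3)^2 + (kb s3)^2, it is never negative for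
    real values. *)
Definition abn_norm := 1 + 2 * kb * c3 + kb * kb.
Definition abn_q := kb * s3.
Definition abn_phi := (1 + kb * c3) * (1 + ka * c1) - kb * kb * L * s3 * (la * s1).
(** Multiplied by lb^2 this is the frame determinant W_1 Z_3 - W_3 Z_1, so its inverse [iy] is
    available wherever the frame is nondegenerate. *)
Definition abn_y := ka * ka * la * s1 * (1 + kb * c3)
  + kb * kb * L * la * la * s3 * (1 + ka * c1).
Definition abn_der F := abn_phi * D 0 F + abn_norm * D 2%:R F.

(* r normalises abnL so that [abnL, [abnL, abnY]] + abn_k abnY is proportional
   to d/dv1. *)
Variables (r iy : A).
Hypotheses (rn : r * r * abn_norm = 1) (iyP : abn_y * iy = 1).

Let trig_der := trig_der Dc Dsn.
Let dE0 := (derD, derM, derN, der1, der0, der_nat, trig_der, Dka, Dla, Dkb, Dlb, DL).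

Let cc1 : c1 * c1 = 1 - s1 * s1.
Proof. by rewrite -(cs1 0) addrK. Qed.
Let cc3 : c3 * c3 = 1 - s3 * s3.
Proof. by rewrite -(cs1 2%:R) addrK. Qed.

(** The relation [rn] solved for a monomial, so that [ring:] can use it for rewriting. *)
Let rk : r * r * kb * kb = 1 - r * r - 2 * (r * r * kb * c3).
Proof. by apply: (eq_of_sub rn); rewrite /abn_norm; ring. Qed.

Let bka : base ka. Proof. by split; rewrite Dka. Qed.
Let bla : base la. Proof. by split; rewrite Dla. Qed.
Let bkb : base kb. Proof. by split; rewrite Dkb. Qed.
Let blb : base lb. Proof. by split; rewrite Dlb. Qed.
Let bL : base L. Proof. by split; rewrite DL. Qed.
Let bc1 : base c1 := base_c1 Dc.
Let bs1 : base s1 := base_s1 Dsn.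
Let bc3 : base c3 := base_c3 Dc.
Let bs3 : base s3 := base_s3 Dsn.

Ltac basis := repeat first [assumption | apply: base0 | apply: base1 |
  apply: base_nat | apply: baseD | apply: baseN | apply: baseM |
  apply: base_der].

Let ban : base abn_norm. Proof. by rewrite /abn_norm; basis. Qed.
Let baphi : base abn_phi. Proof. by rewrite /abn_phi; basis. Qed.
Let bay0 : base abn_y. Proof. by rewrite /abn_y; basis. Qed.
Let biy : base iy. Proof. exact: base_inv iyP bay0. Qed.
Let Dr i : 2 * D i r = - (r * r * r * D i abn_norm).
Proof.
have := congr1 (D i) rn; rewrite !derM der1 => h.
by rewrite -[LHS]mulr1 -[X in _ * X]rn; apply: (eq_of_sub (congr1 ( *%R r) h)); ring.
Qed.

Let half u v : 2 * u = 2 * v :> A -> u = v.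
Proof.
move=> h; have [j hj] := nat_inv 1.
by rewrite -[u]mul1r -[v]mul1r -hj ![_ * j]mulrC -!mulrA h.
Qed.

Let D0r : D 0 r = 0.
Proof. by apply: half; rewrite Dr /abn_norm !dE0; ring. Qed.
Let D2r : D 2%:R r = abn_q * (r * r * r).
Proof. by apply: half; rewrite Dr /abn_norm /abn_q !dE0; ring. Qed.
Let br0 : base r.
Proof.
have [a1 a3 a4] := ban.
by split; apply: half; rewrite Dr ?(a1, a3, a4); ring.
Qed.

Let dE := (D0r, D2r, dE0).
Let r3 := r * r * r.
Let br3 : base r3. Proof. by rewrite /r3; basis. Qed.

Definition abn_yY := lb * s3 * (1 + ka * c1) + (1 + kb * c3) * (la * s1).
Definition abn_z1 := abn_der abn_yY - abn_yY * D 0 abn_phi.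
Definition abn_zZ := r3 * (abn_yY * D 0 abn_z1 - abn_z1 * D 0 abn_yY).
Definition abn_psi := r * r * r * r * abn_y.
Definition abn_ipsi := abn_norm * abn_norm * iy.
Definition abn_k := r * r * r * r * (1 + kb * c3 + kb * kb).
Definition abn_x := r3 * (4 * abn_q + (abn_der abn_y - abn_y * D 0 abn_phi) * iy).

Definition abnL := comb (r3 * abn_phi) (r3 * abn_norm) (- (r3 * (1 + kb * c3)))
  (r3 * (kb * kb * L * s3)) 0.
(** The combination of X1 and X2 without d/dv3 component. Then [abnY1], [abnU] and [abnZ] have none
    either, and among these fields only l differentiates in v3. *)
Definition abnY := comb abn_yY 0 (- (lb * s3)) (- (1 + kb * c3)) 0.
Definition abnY1 := comb (r3 * abn_z1) 0 (- (r * lb * c3)) (r * kb * s3) r.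
Definition abnU := comb abn_psi 0 0 0 0.
Definition abnZ := comb abn_zZ 0 0 (r * lb * s3) (- (r * lb * (c3 + kb))).
Definition abn_zeta := (r3 * abn_der abn_zZ - abn_zZ * D 0 (r3 * abn_phi)) * abn_ipsi.
Definition abn_om := (abn_yY * D 0 abn_psi - abn_psi * D 0 abn_yY) * abn_ipsi.

Let bayY : base abn_yY. Proof. by rewrite /abn_yY; basis. Qed.
Let baz1 : base abn_z1. Proof. by rewrite /abn_z1 /abn_der; basis. Qed.
Let bazz : base abn_zZ. Proof. by rewrite /abn_zZ; basis. Qed.
Let bapsi : base abn_psi. Proof. by rewrite /abn_psi; basis. Qed.

Let psiP : abn_psi * abn_ipsi = 1.
Proof.
have e : abn_psi * abn_ipsi = (r * r * abn_norm) * (r * r * abn_norm) * (abn_y * iy).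
  by rewrite /abn_psi /abn_ipsi; ring.
by rewrite e rn iyP !mulr1.
Qed.

Lemma abnL_dec : abnL = (r3 * (1 + kb * c3)) *: snakeX1 c s ka kb
  + (r3 * (kb * kb * L * s3)) *: snakeX2 c s la lb.
Proof.
apply: row5P; rewrite !(rowD, rowZ, combE) /abn_norm /abn_phi; ring: cc3 Llb.
Qed.

Lemma abnY_dec : abnY = (lb * s3) *: snakeX1 c s ka kb - (1 + kb * c3) *: snakeX2 c s la lb.
Proof.
by apply: row5P; rewrite !(rowD, rowN, rowZ, combE) /abn_yY; ring: cc3 Llb.
Qed.

Lemma br_abnL_abnY : br D abnL abnY = abnY1.
Proof.
rewrite comb_br; try by basis.
congr frame_comb.
- by rewrite /abn_z1 /abn_der /r3 !(derM D 0) !D0r; ring.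
- by rewrite /abn_norm !dE; ring.
- by rewrite /r3 /abn_norm !dE; ring: rk.
- by rewrite /r3 /abn_norm !dE; ring: rk.
- by rewrite /r3 !dE; ring: rk cc3 Llb.
Qed.

Let act_aL F : base F -> act D abnL F = r3 * abn_der F.
Proof. by move=> bF; rewrite act_comb// /abn_der; ring. Qed.

(** The d/dv1 component of [l, Y1] + k Y = U, freed from the powers of r. *)
Let transport : abn_der abn_z1 + 3 * abn_q * abn_z1 - abn_z1 * D 0 abn_phi
  + abn_norm * (1 + kb * c3 + kb * kb) * abn_yY = abn_norm * abn_y.
Proof.
rewrite /abn_z1 /abn_der /abn_yY /abn_phi /abn_norm /abn_q /abn_y !dE.
ring: cc1 cc3 Llb.
Qed.

Lemma br_abnL_abnY1 : br D abnL abnY1 = abnU - abn_k *: abnY.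
Proof.
have -> : abnU - abn_k *: abnY = comb (abn_psi - abn_k * abn_yY) 0 (abn_k * (lb * s3))
    (abn_k * (1 + kb * c3)) 0.
  by apply: row5P; rewrite !(rowD, rowN, rowZ, combE); ring.
rewrite comb_br; try by basis.
congr frame_comb.
- have e := transport.
  transitivity (r3 * r3 * (abn_der abn_z1 + 3 * abn_q * (r * r * abn_norm) * abn_z1 - abn_z1 * D 0 abn_phi)).
    by rewrite /abn_der /r3 !(derM D 0) !(derM D 2%:R) !D0r !D2r; ring.
  rewrite rn mulr1 (_ : abn_der abn_z1 + _ - _ =
    abn_norm * abn_y - abn_norm * (1 + kb * c3 + kb * kb) * abn_yY); last by rewrite -e; ring.
  transitivity (r * r * r * r * (r * r * abn_norm)
    * (abn_y - (1 + kb * c3 + kb * kb) * abn_yY)); first by rewrite /r3; ring.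
  by rewrite rn /abn_psi /abn_k; ring.
- by rewrite !dE; ring.
- transitivity (r * r * r * r * lb * (abn_norm * s3 - abn_q * c3 * (r * r * abn_norm))).
    by rewrite /r3 !dE; ring.
  by rewrite rn /abn_norm /abn_k /abn_q; ring.
- transitivity (r * r * r * r * (kb * (abn_q * s3 * (r * r * abn_norm) + abn_norm * c3)
    + (1 + kb * c3))); first by rewrite /r3 !dE; ring.
  by rewrite rn /abn_norm /abn_k /abn_q; ring: cc3.
- transitivity (r * r * r * r * (abn_q * (r * r * abn_norm) - abn_q
    + kb * kb * s3 * c3 * (L * lb - 1))); first by rewrite /r3 !dE /abn_q; ring.
  by rewrite rn Llb; ring.
Qed.

Lemma br_abnY_abnY1 : br D abnY abnY1 = abnZ.
Proof.
rewrite comb_br; try by basis.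
congr frame_comb.
- by rewrite /abn_zZ /r3 !(derM D 0) !D0r; ring.
- by rewrite !dE; ring.
- by rewrite !dE; ring.
- by rewrite !dE; ring.
- by rewrite !dE; ring: cc3.
Qed.

Let vert F : comb F 0 0 0 0 = (F * abn_ipsi) *: abnU.
Proof.
apply: row5P; rewrite rowZ !combE; [|ring..].
by rewrite -mulrA (mulrC abn_ipsi) psiP mulr1.
Qed.

Lemma br_abnL_abnU : br D abnL abnU = abn_x *: abnU.
Proof.
rewrite comb_br; try by basis.
rewrite [LHS](_ : _ = comb (abn_psi * abn_x) 0 0 0 0).
  by rewrite vert mulrAC psiP mul1r.
congr frame_comb; [|by rewrite !dE; ring..].
have -> : abn_x = r3 * (4 * abn_q * (r * r * abn_norm) + (abn_der abn_y - abn_y * D 0 abn_phi) * iy).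
  by rewrite rn mulr1.
have -> : abn_psi * (r3 * (4 * abn_q * (r * r * abn_norm) + (abn_der abn_y - abn_y * D 0 abn_phi) * iy))
  = r3 * (4 * abn_q * (r * r * abn_norm) * abn_psi
     + r * r * r * r * (abn_der abn_y - abn_y * D 0 abn_phi) * (abn_y * iy)).
  by rewrite /abn_psi; ring.
by rewrite iyP /abn_psi /r3 /abn_der !(derM D 0) !(derM D 2%:R) !D0r !D2r; ring.
Qed.

Lemma br_abnL_abnZ : br D abnL abnZ = abn_zeta *: abnU.
Proof.
rewrite comb_br; try by basis.
rewrite [LHS](_ : _ = comb (r3 * abn_der abn_zZ - abn_zZ * D 0 (r3 * abn_phi)) 0 0 0 0).
  by rewrite vert.
congr frame_comb.
- by rewrite /abn_der; ring.
- by rewrite !dE; ring.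
- by rewrite !dE; ring.
- transitivity (r * r * r * r * lb * (abn_q * s3 * (r * r * abn_norm) + abn_norm * c3
    - (1 + kb * c3) * (c3 + kb))); first by rewrite /r3 !dE; ring.
  by rewrite rn /abn_norm /abn_q; ring: cc3.
- transitivity (r * r * r * r * lb * (abn_norm * s3 - abn_q * (c3 + kb) * (r * r * abn_norm)
    - (1 + kb * c3) * s3)); first by rewrite /r3 !dE; ring.
  by rewrite rn /abn_norm /abn_q; ring.
Qed.

Lemma br_abnY_abnU : br D abnY abnU = abn_om *: abnU.
Proof.
rewrite comb_br; try by basis.
rewrite [LHS](_ : _ = comb (abn_yY * D 0 abn_psi - abn_psi * D 0 abn_yY) 0 0 0 0).
  by rewrite vert.
by congr frame_comb; rewrite ?dE; ring.
Qed.

Definition abn_coZ := cocomb 0 (- (L * L * r)) (- (L * L * r * (1 + kb * c3)))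
  (L * r * s3) (- (L * r * (c3 + kb))).
Definition abn_coY1 := cocomb 0 (- (r * L * (c3 + kb)))
  (- (r * L * (c3 + kb) * (1 + kb * c3))) (r * s3 * (c3 + kb)) (r * s3 * s3).
Let awY := cocomb 0 (- (r * r * L * s3))
  (- (r * r * L * s3 * (1 + kb * c3 + kb * kb))) (- (r * r * c3 * (c3 + kb)))
  (- (r * r * c3 * s3)).
(** dv1 corrected by a multiple of dv3 to vanish on l, then by its values on Y, Y1 and Z, and
    finally normalised on U. *)
Definition abn_coU := abn_ipsi *: (cocomb 1 (- (r * abn_norm * r3 * abn_phi)) 0 0 0
  - abn_yY *: awY - (r3 * abn_z1) *: abn_coY1 - abn_zZ *: abn_coZ).

Lemma abn_coZ_pair : (pairv abnL abn_coZ = 0) * (pairv abnY abn_coZ = 0) * (pairv abnY1 abn_coZ = 0)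
  * (pairv abnU abn_coZ = 0) * (pairv abnZ abn_coZ = 1).
Proof.
rewrite !comb_pair// /r3; do !split; try (rewrite /abn_norm; ring: Llb cc3).
by rewrite -[RHS]rn /abn_norm; ring: Llb cc3.
Qed.

Lemma abn_coY1_pair : (pairv abnL abn_coY1 = 0) * (pairv abnY abn_coY1 = 0) * (pairv abnY1 abn_coY1 = 1)
  * (pairv abnU abn_coY1 = 0) * (pairv abnZ abn_coY1 = 0).
Proof.
rewrite !comb_pair// /r3; do !split; try (rewrite /abn_norm; ring: Llb cc3).
by rewrite -[RHS]rn /abn_norm; ring: Llb cc3.
Qed.

Let awY_pair : (pairv abnL awY = 0) * (pairv abnY awY = 1) * (pairv abnY1 awY = 0)
  * (pairv abnU awY = 0) * (pairv abnZ awY = 0).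
Proof.
rewrite !comb_pair// /r3; do !split; try (rewrite /abn_norm; ring: Llb cc3).
by rewrite -[RHS]rn /abn_norm; ring: Llb cc3.
Qed.

Let pairvBr T (v w : 'cV[A]_5) : pairv T (v - w) = pairv T v - pairv T w.
Proof. by rewrite /pairv mulmxBr !mxE. Qed.

Let pairvZr T a (w : 'cV[A]_5) : pairv T (a *: w) = a * pairv T w.
Proof. by rewrite /pairv -scalemxAr !mxE. Qed.

Lemma abn_coU_pair : (pairv abnL abn_coU = 0) * (pairv abnY abn_coU = 0) * (pairv abnY1 abn_coU = 0)
  * (pairv abnU abn_coU = 1) * (pairv abnZ abn_coU = 0).
Proof.
rewrite /abn_coU !pairvZr !pairvBr !pairvZr !awY_pair !abn_coY1_pair !abn_coZ_pair.
rewrite !comb_pair//; do !split; try ring.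
  transitivity (abn_ipsi * r3 * abn_phi * (1 - (r * r * abn_norm) * (r * r * abn_norm))).
    by rewrite /r3; ring.
  by rewrite rn; ring.
by rewrite -[RHS]psiP; ring.
Qed.

Let alM F G : abn_der (F * G) = abn_der F * G + F * abn_der G.
Proof. by rewrite /abn_der !derM; ring. Qed.

Let al_r : abn_der r = abn_q * r.
Proof.
transitivity (abn_q * r * (r * r * abn_norm)); last by rewrite rn mulr1.
by rewrite /abn_der D0r D2r; ring.
Qed.

Let al_iy : abn_der iy = - (abn_der abn_y * iy * iy).
Proof.
have : abn_der (abn_y * iy) = 0 by rewrite iyP /abn_der !der1; ring.
rewrite alM => h; transitivity (abn_der iy * (abn_y * iy)); first by rewrite iyP mulr1.
by apply: (eq_of_sub (congr1 ( *%R iy) h)); ring.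
Qed.

(* Numerators of the successive derivatives along abnL of abn_x = r^3 abnN0 / abn_y
   and of abn_k = r^6 abnK0. *)
Definition abnN0 := 4 * abn_q * abn_y + (abn_der abn_y - abn_y * D 0 abn_phi).
Definition abnN1 := abn_der abnN0 * abn_y - abnN0 * abn_der abn_y + 3 * abn_q * abnN0 * abn_y.
Definition abnN2 := abn_der abnN1 * abn_y - 2 * abnN1 * abn_der abn_y + 6 * abn_q * abnN1 * abn_y.
Definition abnN3 := abn_der abnN2 * abn_y - 3 * abnN2 * abn_der abn_y + 9 * abn_q * abnN2 * abn_y.
Definition abnK0 := abn_norm * (1 + kb * c3 + kb * kb).
Definition abnK1 := abn_der abnK0 + 6 * abn_q * abnK0.
Definition abnK2 := abn_der abnK1 + 9 * abn_q * abnK1.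
Definition abnP := 10 * abnN3 - 40 * abnN0 * abnN2 - 21 * abnN1 ^+ 2
  + 54 * abnN0 ^+ 2 * abnN1 - 9 * abnN0 ^+ 4
  + abnK0 * abn_y ^+ 2 * (46 * abnN1 - 82 * abnN0 ^+ 2) + 100 * abnK1 * abnN0 * abn_y ^+ 3
  - 30 * abnK2 * abn_y ^+ 4 - 9 * abnK0 ^+ 2 * abn_y ^+ 4.

Let bal F : base F -> base (abn_der F).
Proof. by move=> bF; rewrite /abn_der; basis. Qed.

(** In passing from N_j to N_(j+1) the terms with q come from the powers of r^3, since r has
    logarithmic derivative q along [abn_der], and the terms with the derivative of y from the powers
    of 1/y. Thus r and 1/y separate off, and what is left, [abnP], is polynomial in sines and
    cosines. *)
Lemma wilczynski_abnormal :
  wilczynski D abnL abn_k abn_x * abn_y ^+ 4 = r3 ^+ 4 * abnP.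
Proof.
have bay := bal bay0.
have bN0 : base abnN0 by rewrite /abnN0 /abn_q; basis.
have baN := bal bN0.
have bN1 : base abnN1 by rewrite /abnN1 /abn_q; basis.
have baN1 := bal bN1.
have bN2 : base abnN2 by rewrite /abnN2 /abn_q; basis.
have bK0 : base abnK0 by rewrite /abnK0; basis.
have baK := bal bK0.
have bK1 : base abnK1 by rewrite /abnK1 /abn_q; basis.
have x0 : abn_x = r3 * (abnN0 * iy).
  by rewrite /abn_x /abnN0; ring: iyP.
have x1 : act D abnL abn_x = r3 * r3 * (abnN1 * iy * iy).
  rewrite x0 act_aL; last by basis.
  by rewrite !alM al_r al_iy /r3 /abnN1; ring: iyP.
have x2 : act D abnL (act D abnL abn_x) = r3 * r3 * r3 * (abnN2 * iy * iy * iy).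
  rewrite x1 act_aL; last by basis.
  by rewrite !alM al_r al_iy /r3 /abnN2; ring: iyP.
have x3 : act D abnL (act D abnL (act D abnL abn_x)) =
    r3 * r3 * r3 * r3 * (abnN3 * iy * iy * iy * iy).
  rewrite x2 act_aL; last by basis.
  by rewrite !alM al_r al_iy /r3 /abnN3; ring: iyP.
have k0 : abn_k = r3 * r3 * abnK0.
  transitivity (abn_k * (r * r * abn_norm)); first by rewrite rn mulr1.
  by rewrite /abn_k /r3 /abnK0; ring.
have k1 : act D abnL abn_k = r3 * r3 * r3 * abnK1.
  have key F : abn_der (r3 * r3 * F) = r3 * r3 * (abn_der F + 6 * abn_q * F).
    by rewrite !alM al_r /r3; ring.
  rewrite k0 act_aL; last by basis.
  by rewrite key /abnK1; ring.
have k2 : act D abnL (act D abnL abn_k) = r3 * r3 * r3 * r3 * abnK2.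
  have key F : abn_der (r3 * r3 * r3 * F) = r3 * r3 * r3 * (abn_der F + 9 * abn_q * F).
    by rewrite !alM al_r /r3; ring.
  rewrite k1 act_aL; last by basis.
  by rewrite key /abnK2; ring.
rewrite /wilczynski x3 x2 x1 x0 k2 k1 k0 /abnP.
move: (abnN0) (abnN1) (abnN2) (abnN3) (abnK0) (abnK1) (abnK2) => n0 n1 n2 n3 m0 m1 m2.
by ring: iyP.
Qed.

End AbnormalFrame.

(** * Carrying the numerator from one ring to another *)

Section AbnormalTransfer.
Variables (A A' : comNzRingType) (D : derivations A 5) (D' : derivations A' 5).
Variable T : A -> A' -> Prop.
Hypothesis TD : forall F G F' G', T F F' -> T G G' -> T (F + G) (F' + G').
Hypothesis TM : forall F G F' G', T F F' -> T G G' -> T (F * G) (F' * G').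
Hypothesis TN : forall F F', T F F' -> T (- F) (- F').
Hypothesis T1 : T 1 1.
Hypothesis Tder : forall i F F', T F F' -> T (D i F) (D' i F').
Variables (c s : 'I_5 -> A) (c' s' : 'I_5 -> A') (ka la kb L : A) (ka' la' kb' L' : A').
Hypotheses (Tc : forall j, T (c j) (c' j)) (Ts : forall j, T (s j) (s' j)).
Hypotheses (Tka : T ka ka') (Tla : T la la') (Tkb : T kb kb') (TL : T L L').

Let Tnat m : T m.+1%:R m.+1%:R.
Proof. by elim: m => // m IH; rewrite -natr1 -[m.+2%:R in X in T _ X]natr1; exact: TD. Qed.

Let TX k F F' : T F F' -> T (F ^+ k.+1) (F' ^+ k.+1).
Proof. by move=> h; elim: k => [|k IH]; rewrite ?expr1// !(exprS _ k.+1); exact: TM. Qed.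

Ltac transfer := repeat lazymatch goal with
  | |- T (_ + _) _ => apply: TD
  | |- T (_ * _) _ => apply: TM
  | |- T (- _) _ => apply: TN
  | |- T (_ ^+ _) _ => apply: TX
  | |- T (der D _ _) _ => apply: Tder
  | |- T 1 _ => exact: T1
  | |- T _%:R _ => exact: Tnat
  | |- T (c _) _ => exact: Tc
  | |- T (s _) _ => exact: Ts
  | |- _ => assumption
  end.

Lemma transfer_abn_norm : T (abn_norm c kb) (abn_norm c' kb').
Proof. by rewrite /abn_norm; transfer. Qed.

(** A parametricity statement for the formula [abnP]. It serves twice: with T the agreement of a
    function on U with one on R^5, and with T the predicate [trig] on its first argument. *)
Lemma transfer_abnP : T (abnP D c s ka la kb L) (abnP D' c' s' ka' la' kb' L').
Proof.
have ph : T (abn_phi c s ka la kb L) (abn_phi c' s' ka' la' kb' L').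
  by rewrite /abn_phi; transfer.
have y0 : T (abn_y c s ka la kb L) (abn_y c' s' ka' la' kb' L').
  by rewrite /abn_y; transfer.
have Tan := transfer_abn_norm.
have Tal F F' : T F F' ->
    T (abn_der D c s ka la kb L F) (abn_der D' c' s' ka' la' kb' L' F').
  by move=> h; rewrite /abn_der; transfer.
have y1 := Tal _ _ y0.
have q : T (abn_q s kb) (abn_q s' kb') by rewrite /abn_q; transfer.
have n0 : T (abnN0 D c s ka la kb L) (abnN0 D' c' s' ka' la' kb' L').
  by rewrite /abnN0; transfer.
have n0' := Tal _ _ n0.
have n1 : T (abnN1 D c s ka la kb L) (abnN1 D' c' s' ka' la' kb' L').
  by rewrite /abnN1; transfer.
have n1' := Tal _ _ n1.
have n2 : T (abnN2 D c s ka la kb L) (abnN2 D' c' s' ka' la' kb' L').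
  by rewrite /abnN2; transfer.
have n2' := Tal _ _ n2.
have n3 : T (abnN3 D c s ka la kb L) (abnN3 D' c' s' ka' la' kb' L').
  by rewrite /abnN3; transfer.
have k0 : T (abnK0 c kb) (abnK0 c' kb') by rewrite /abnK0; transfer.
have k0' := Tal _ _ k0.
have k1 : T (abnK1 D c s ka la kb L) (abnK1 D' c' s' ka' la' kb' L').
  by rewrite /abnK1; transfer.
have k1' := Tal _ _ k1.
have k2 : T (abnK2 D c s ka la kb L) (abnK2 D' c' s' ka' la' kb' L').
  by rewrite /abnK2; transfer.
by rewrite /abnP; transfer.
Qed.

End AbnormalTransfer.

(** * The numerator at the straight configuration *)

Section StraightConfiguration.
Variables (A K : comNzRingType) (D : derivations A 5) (c s : 'I_5 -> A).
Hypothesis Dc : forall i j, D i (c j) = - ((j == i)%:R * s j).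
Hypothesis Dsn : forall i j, D i (s j) = (j == i)%:R * c j.
Variables (ka la kb L : A).
Hypotheses (Dka : forall i, D i ka = 0) (Dla : forall i, D i la = 0).
Hypotheses (Dkb : forall i, D i kb = 0) (DL : forall i, D i L = 0).
Variable e : {rmorphism A -> K}.
Hypotheses (es1 : e (s 0) = 0) (es3 : e (s 2%:R) = 0).
Hypotheses (ec1 : e (c 0) = 1) (ec3 : e (c 2%:R) = 1).

(** Here y is 0 and its derivative is eta, so the recursions collapse to N0, N1, N2, N3 = eta, -
    eta^2, 2 eta^3, - 6 eta^4, and every term with k carries a factor y. The constant is -60 - 80 -
    21 - 54 - 9 = -224. *)
Lemma abnP_straight :
  e (abnP D c s ka la kb L) = - 224 *
   ((1 + e kb) * (1 + e ka) * (e ka * e ka * e la * (1 + e kb))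
     + (1 + e kb) * (1 + e kb) * (e kb * e kb * e L * e la * e la * (1 + e ka))) ^+ 4.
Proof.
have tr := trig_der Dc Dsn.
have dE := (derD, derM, derN, der1, der0, der_nat, tr, Dka, Dla, Dkb, DL).
have eD x y : e (x + y) = e x + e y by exact: rmorphD.
have eN x : e (- x) = - e x by exact: rmorphN.
have eM x y : e (x * y) = e x * e y by exact: rmorphM.
have eX x k : e (x ^+ k) = e x ^+ k by exact: rmorphXn.
have e_nat k : e k%:R = k%:R by exact: rmorph_nat.
have e1 : e 1 = 1 by exact: rmorph1.
have eE := (eD, eN, eM, eX, e_nat, e1).
have yz : e (abn_y c s ka la kb L) = 0.
  by rewrite /abn_y !eE es1 es3; ring.
have eta : e (abn_der D c s ka la kb L (abn_y c s ka la kb L)) =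
    (1 + e kb) * (1 + e ka) * (e ka * e ka * e la * (1 + e kb))
     + (1 + e kb) * (1 + e kb) * (e kb * e kb * e L * e la * e la * (1 + e ka)).
  by rewrite /abn_der /abn_phi /abn_norm /abn_y !dE !eE es1 es3 ec1 ec3; ring.
rewrite -eta; move: yz => {eta}; rewrite /abnP /abnN3 /abnN2 /abnN1 /abnN0.
set y0 := abn_y _ _ _ _ _ _; set y1 := abn_der _ _ _ _ _ _ _ y0 => yz; clearbody y1; clearbody y0.
have key F G H m : e (F * y0 - m * G * y1 + H * G * y0) = - e m * e G * e y1.
  by rewrite !eE yz; ring.
have n0 F : e (4 * abn_q s kb * y0 + (y1 - y0 * F)) = e y1.
  by rewrite !eE yz; ring.
have n1 F G : e (F * y0 - G * y1 + 3 * abn_q s kb * G * y0) = - e G * e y1.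
  by rewrite !eE yz; ring.
set m0 := 4 * _ * y0 + _; set m1 := abn_der _ _ _ _ _ _ _ m0 * _ - _ + _.
set m2 := abn_der _ _ _ _ _ _ _ m1 * _ - _ + _; set m3 := abn_der _ _ _ _ _ _ _ m2 * _ - _ + _.
have em0 : e m0 = e y1 by exact: n0.
have em1 : e m1 = - e m0 * e y1 by exact: n1.
have em2 : e m2 = - 2%:R * e m1 * e y1 by rewrite -(e_nat _); exact: key.
have em3 : e m3 = - 3%:R * e m2 * e y1 by rewrite -(e_nat _); exact: key.
move: em0 em1 em2 em3; move: {+}m0 {+}m1 {+}m2 {+}m3 (abnK0 _ _) (abnK1 _ _ _ _ _ _ _) (abnK2 _ _ _ _ _ _ _).
move=> {}m0 {}m1 {}m2 {}m3 k0 k1 k2 em0 em1 em2 em3.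
rewrite !eE em3 em2 em1 em0 yz; ring.
Qed.

End StraightConfiguration.

(** * A symmetry with dilating isotropy annihilates the numerator *)

Section AbnormalObstruction.
Variables (A : comNzRingType) (D : derivations A 5) (c s : 'I_5 -> A).
Hypothesis Dc : forall i j, D i (c j) = - ((j == i)%:R * s j).
Hypothesis Dsn : forall i j, D i (s j) = (j == i)%:R * c j.
Hypothesis cs1 : forall j, c j * c j + s j * s j = 1.
Hypothesis nat_inv : forall m, exists j : A, m.+1%:R * j = 1.
Variables (ka la kb lb L : A).
Hypotheses (Dka : forall i, D i ka = 0) (Dla : forall i, D i la = 0).
Hypotheses (Dkb : forall i, D i kb = 0) (Dlb : forall i, D i lb = 0).
Hypotheses (DL : forall i, D i L = 0) (Llb : L * lb = 1).
Variables (r iy : A).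
Hypotheses (rn : r * r * abn_norm c kb = 1) (iyP : abn_y c s ka la kb L * iy = 1).
Local Notation X1 := (snakeX1 c s ka kb).
Local Notation X2 := (snakeX2 c s la lb).
Local Notation l := (abnL c s ka la kb L r).
Local Notation Y := (abnY c s ka la kb lb).
Local Notation c3 := (c 2%:R).
Local Notation s3 := (s 2%:R).
Local Notation n := (abn_norm c kb).

Variables (T : 'rV[A]_5) (al be ga de : A).
Hypothesis TX1 : br D T X1 = al *: X1 + be *: X2.
Hypothesis TX2 : br D T X2 = ga *: X1 + de *: X2.
Variables (K : numFieldType) (e : {rmorphism A -> K}).
Hypotheses (eT : forall i, e (T 0 i) = 0) (eal : e al = 1) (ebe : e be = 0).
Hypotheses (ega : e ga = 0) (ede : e de = 1).

Let cc3 : c3 * c3 = 1 - s3 * s3.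
Proof. by rewrite -(cs1 2%:R) addrK. Qed.

Let B1 := 1 + kb * c3.
Let p1 := r * n * B1.
Let p2 := r * n * (r * r * r * (kb * kb * L * s3)).
Let q1 := r * n * (lb * s3).
Let q2 := - (r * n * (r * r * r * B1)).

(** Up to the factor - r^3 this is the determinant of l, Y in the basis X1, X2. It is invertible
    because r^2 n = 1, and p1, p2, q1, q2 are the entries of the inverse. *)
Let nE : B1 * B1 + kb * kb * (L * lb) * (s3 * s3) = n.
Proof. by rewrite Llb /B1 /abn_norm; ring: cc3. Qed.

Let l_dec := abnL_dec cs1 ka la kb Llb r.
Let Y_dec := abnY_dec cs1 ka la kb Llb.

Let X1E : X1 = p1 *: l + p2 *: Y.
Proof.
have h : r * r * r * r * n * (B1 * B1 + kb * kb * (L * lb) * (s3 * s3)) = 1.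
  by rewrite nE; transitivity ((r * r * n) * (r * r * n)); [ring | rewrite rn mulr1].
rewrite l_dec Y_dec scalerDr scalerBr !scalerA.
rewrite -[LHS]scale1r -[X in X *: _ = _]h; apply/rowP => i.
move: (X1) (X2) => Xa Xb; rewrite !mxE /p1 /p2 -/B1.
by ring.
Qed.

Let X2E : X2 = q1 *: l + q2 *: Y.
Proof.
have h : r * r * r * r * n * (B1 * B1 + kb * kb * (L * lb) * (s3 * s3)) = 1.
  by rewrite nE; transitivity ((r * r * n) * (r * r * n)); [ring | rewrite rn mulr1].
rewrite l_dec Y_dec scalerDr scalerBr !scalerA.
rewrite -[LHS]scale1r -[X in X *: _ = _]h; apply/rowP => i.
move: (X1) (X2) => Xa Xb; rewrite !mxE /q1 /q2 -/B1.
by ring.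
Qed.

Let eTact a : e (act D T a) = 0.
Proof. by rewrite /act rmorph_sum big1// => i _; rewrite rmorphM eT mul0r. Qed.

(** T vanishes at the point, so derivatives of the coefficients do not contribute there and T scales
    every section of D with weight 1. Applied to l this gives nu = 1 and tau = 0. *)
Let brT a b : exists a' b', [/\ br D T (a *: X1 + b *: X2) = a' *: X1 + b' *: X2,
  e a' = e a & e b' = e b].
Proof.
exists (act D T a + a * al + b * ga), (act D T b + a * be + b * de); split.
- by rewrite brDr !brZr TX1 TX2; apply/rowP => i; rewrite !mxE; ring.
- by rewrite !rmorphD !rmorphM eTact eal ega mulr0 mulr1 addr0 add0r.
- by rewrite !rmorphD !rmorphM eTact ebe ede mulr0 mulr1 addr0 add0r.
Qed.

Lemma abnormal_obstruction : e (abnP D c s ka la kb L) = 0.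
Proof.
have [a [b [lE ea eb]]] := brT (r * r * r * (1 + kb * c3))
  (r * r * r * (kb * kb * L * s3)).
have [a' [b' [YE _ _]]] := brT (lb * s3) (- (1 + kb * c3)).
have basisE u v : u *: X1 + v *: X2 =
    (u * p1 + v * q1) *: l + (u * p2 + v * q2) *: Y.
  rewrite [X1]X1E [X2]X2E; move: (l) (Y) => l' Y'.
  by apply/rowP => i; rewrite !mxE; ring.
move: lE YE; rewrite scaleNr -l_dec -Y_dec !basisE => lE YE.
have nu1 : e (a * p1 + b * q1) = 1.
  transitivity (e (r * r * n * (r * r * (B1 * B1 + kb * kb * (L * lb) * (s3 * s3))))).
    by rewrite rmorphD !rmorphM ea eb /= -!rmorphM -rmorphD /p1 /q1 -/B1; congr (e _); ring.
  by rewrite nE !rn mulr1 rmorph1.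
have tau0 : e (a * p2 + b * q2) = 0.
  rewrite rmorphD !rmorphM ea eb /= -!rmorphM -rmorphD /p2 /q2 -/B1 -[RHS](rmorph0 e).
  by congr (e _); ring.
have z := abn_coZ_pair D cs1 ka la Llb rn; have y1 := abn_coY1_pair D cs1 ka la Llb rn.
have u := abn_coU_pair D cs1 Llb rn iyP.
have w0 : e (wilczynski D l (abn_k c kb r) (abn_x D c s ka la kb L r iy)) = 0.
  have := (@wilczynski_eq0 _ _ _ _ e _ _ _ _ _ _ _ _ _ _ _ _ _ _
    (br_abnL_abnY Dc Dsn cs1 nat_inv Dka Dla Dkb Dlb DL Llb rn)
    (br_abnL_abnY1 Dc Dsn cs1 nat_inv Dka Dla Dkb Dlb DL Llb rn)
    (br_abnL_abnU Dc Dsn nat_inv Dka Dla Dkb DL rn iyP)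
    (br_abnY_abnY1 Dc Dsn cs1 nat_inv Dka Dla Dkb Dlb DL rn)
    (br_abnL_abnZ Dc Dsn cs1 nat_inv Dka Dla Dkb Dlb DL rn iyP)
    (br_abnY_abnU Dc Dsn nat_inv Dka Dla Dkb Dlb DL rn iyP) lE YE
    (abn_coY1 c s kb L r) (abn_coU D c s ka la kb lb L r iy)
    (abn_coZ c s kb L r)); rewrite !z !y1 !u nu1 oner_eq0.
  by apply.
have := congr1 e (wilczynski_abnormal Dc Dsn nat_inv Dka Dla Dkb DL rn iyP).
rewrite rmorphM w0 mul0r rmorphM => /esym/eqP; rewrite mulf_eq0 => /orP[|/eqP//].
rewrite rmorphXn expf_eq0 !rmorphM /= !mulf_eq0 !orbb => /eqP r0.
by have /eqP := congr1 e rn; rewrite !rmorphM r0 !mul0r rmorph1 eq_sym oner_eq0.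
Qed.

End AbnormalObstruction.

(** * Jets of symmetries *)

Section SymmetryJet.
Variables (A : comNzRingType) (D : derivations A 5) (c s : 'I_5 -> A).
Hypothesis Dc : forall i j, D i (c j) = - ((j == i)%:R * s j).
Hypothesis Dsn : forall i j, D i (s j) = (j == i)%:R * c j.
Hypothesis cs1 : forall j, c j * c j + s j * s j = 1.
Hypothesis nat_inv : forall m, exists j : A, m.+1%:R * j = 1.
Variables (ka la kb lb iD : A).
Hypotheses (Dka : forall i, D i ka = 0) (Dla : forall i, D i la = 0).
Hypotheses (Dkb : forall i, D i kb = 0) (Dlb : forall i, D i lb = 0).
Hypothesis iDP : (W_1 s ka la * Z_3 c kb lb - W_3 s kb lb * Z_1 c ka la) * iD = 1.
Local Notation X1 := (snakeX1 c s ka kb).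
Local Notation X2 := (snakeX2 c s la lb).
Local Notation "X *> u" := (act D X u) (at level 30, right associativity).

Definition jet (T : 'rV[A]_5) := sym_data D X1 X2 (pairv T (co3 c s))
  (pairv T (coW c s ka la kb lb iD)) (pairv T (coZ c s ka la kb lb iD)).

Let X12 := br_snakeX1_X2 Dc Dsn cs1 Dka Dla Dkb Dlb.
Let X13 := br_snakeX1_X3 Dc Dsn cs1 Dka Dla Dkb Dlb.
Let X23 := br_snakeX2_X3 Dc Dsn cs1 Dka Dla Dkb Dlb.

Lemma frame_tangent (V : 'rV[A]_5) :
  (forall w, pairv X1 w = 0 -> pairv X2 w = 0 -> pairv V w = 0) ->
  V = pairv V (co1 c s) *: X1 + pairv V (co2 c s) *: X2.
Proof.
move=> z; rewrite {1}(frame_dec cs1 iDP V).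
by rewrite (z (co3 c s)) ?(z (coW _ _ _ _ _ _ _)) ?(z (coZ _ _ _ _ _ _ _))
  ?(frame_pair cs1 iDP)// !scale0r !addr0.
Qed.

Lemma jetD T T' k : (jet (T + T'))`_k = (jet T)`_k + (jet T')`_k.
Proof.
rewrite /jet !pairvD.
by do 14 (case: k => [|k]; rewrite /= ?actD//); rewrite !nth_nil addr0.
Qed.

Lemma jetZ a T k : (forall i, D i a = 0) -> (jet (a *: T))`_k = a * (jet T)`_k.
Proof.
move=> Da; have Xa X u : X *> (a * u) = a * (X *> u).
  by rewrite actM (_ : X *> a = 0) ?mul0r ?add0r// /act big1// => i _; rewrite Da mulr0.
rewrite /jet !pairvZ.
by do 14 (case: k => [|k]; rewrite /= ?Xa//); rewrite !nth_nil mulr0.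
Qed.

Definition jet_entry T k : A := (jet T)`_k.

Lemma jet_entryP T y : y \in jet T -> exists k : 'I_14, y = jet_entry T k.
Proof. by move=> /(nthP 0)[k k14 <-]; exists (Ordinal k14). Qed.

Lemma jet_entry_default T k : (14 <= k)%N -> jet_entry T k = 0.
Proof. by move=> k14; rewrite /jet_entry nth_default. Qed.

Lemma jet_entry_sum (K : comNzRingType) (e : {rmorphism A -> K}) n (a : 'I_n -> A)
    (T : 'I_n -> 'rV[A]_5) k : (forall j i, D i (a j) = 0) ->
  e (jet_entry (\sum_j a j *: T j) k) = \sum_j e (a j) * e (jet_entry (T j) k).
Proof.
move=> Da; transitivity (e (\sum_j a j * jet_entry (T j) k)); last first.
  by rewrite rmorph_sum; apply: eq_bigr => j _; rewrite rmorphM.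
rewrite /jet_entry; congr (e _).
elim/big_ind2: _ => [|x y z t <- <-|j _]; last exact: jetZ.
- rewrite -(scale0r (0 : 'rV[A]_5)) jetZ ?mul0r// => i; exact: der0.
- exact: jetD.
Qed.

Variables (T : 'rV[A]_5) (al be ga de : A).
Hypothesis TX1 : br D T X1 = al *: X1 + be *: X2.
Hypothesis TX2 : br D T X2 = ga *: X1 + de *: X2.

Let pde := sym_pde Dc Dsn cs1 Dka Dla Dkb Dlb iDP TX1 TX2.

(** Each coordinate derivation is a combination of X1, X2, X3, W, Z, and the last three act as
    iterated commutators of X1 and X2. Closure under X1 and X2 is therefore enough. *)
Lemma jet_closed i y : y \in jet T -> spans (jet T) (D i y).
Proof.
have [[g1 g2] [h1 h2] _ _ _] := pde.
have cl z : z \in jet T -> spans (jet T) (X1 *> z) /\ spans (jet T) (X2 *> z).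
  apply: (sym_data_closed nat_inv _ _ _ g1 g2 h1 h2); rewrite X12 X13 ?X23.
  - exact: br_snakeX1_WE.
  - exact: br_snakeX2_W.
  - exact: br_snakeX2_ZE.
have c1 z : spans (jet T) z -> spans (jet T) (X1 *> z).
  by apply: spans_act => u uj; [exact: spans_mem | have [] := cl u uj].
have c2 z : spans (jet T) z -> spans (jet T) (X2 *> z).
  by apply: spans_act => u uj; [exact: spans_mem | have [] := cl u uj].
have c3 z : spans (jet T) z -> spans (jet T) (snakeX3 c s ka la kb lb *> z).
  move=> hz; rewrite -X12 act_br; apply: spansB; [apply/c1/c2|apply/c2/c1] => //.
move=> /spans_mem hy.
have -> : D i y = delta_mx 0 i *> y.
  rewrite /act (bigD1 i)//= mxE !eqxx mul1r big1 ?addr0// => j ji.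
  by rewrite mxE (negPf ji) mul0r.
rewrite (frame_dec cs1 iDP (delta_mx 0 i)) !actDl !actZl.
apply: spansD; [apply: spansD; [apply: spansD; [apply: spansD|]|]|]; apply: spansM;
  [exact: c1 | exact: c2 | exact: c3 | |].
- by rewrite -X13 actDl act_br; apply: spansD; [apply: spansB|]; auto.
- by rewrite -X23 act_br; apply: spansB; auto.
Qed.

Section Evaluation.
Variables (K : comNzRingType) (e : {rmorphism A -> K}).

(** The components of T in the frame are X2 f, - X1 f, f, g, h, which are up to sign the first five
    entries of the jet. *)
Lemma jet_eq0 : (forall y, y \in jet T -> e y = 0) -> forall i, e (T 0 i) = 0.
Proof.
have [_ _ [f1 f2] _ _] := pde => jz i.
rewrite (frame_dec cs1 iDP T) f1 f2.
have z k : (k < 14)%N -> e (jet T)`_k = 0 by move=> k14; apply/jz/mem_nth.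
have := (z 0%N isT, z 1%N isT, z 2%N isT, z 3%N isT, z 4%N isT) => /= z5.
by rewrite !(rowD, rowZ) !rmorphD !rmorphM !rmorphN /= !z5 !(oppr0, mul0r, addr0).
Qed.

(* Entries 6 and 7 of a jet are X1 X2 f and X2 X1 f. *)
Lemma jet_euler : (forall k, e (jet_entry T k) = (k == 7%N)%:R - (k == 6%N)%:R) ->
  [/\ e al = 1, e be = 0, e ga = 0, e de = 1 & forall i, e (T 0 i) = 0].
Proof.
have [_ _ [f1 f2] [-> ->] [-> ->]] := pde; rewrite /jet_entry => jz.
have := (jz 0%N, jz 1%N, jz 2%N, jz 3%N, jz 4%N, jz 5%N, jz 6%N, jz 7%N, jz 8%N).
rewrite /= !subr0 sub0r => z.
have N X u : X *> (- u) = - (X *> u) by exact: actN.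
split; rewrite ?f1 ?f2 ?N ?opprK ?rmorphN ?rmorphD ?z ?opprK ?oppr0 ?addr0//.
move=> i; rewrite (frame_dec cs1 iDP T) f1 f2.
by rewrite !(rowD, rowZ) !rmorphD !rmorphM !rmorphN /= !z !(oppr0, mul0r, addr0).
Qed.

End Evaluation.

End SymmetryJet.

Import numFieldNormedType.Exports.

Local Open Scope classical_set_scope.
Local Open Scope ring_scope.

(** * Functions of class C^k *)

Section DirectionalDerivatives.
Context {R : realType} {V : normedModType R}.
Implicit Types (f : V -> R) (x v : V).

Lemma is_derive_line f x v (t d : R) :
  is_derive (t *: v + x) v f d <->
  is_derive t 1 (fun h => f (h *: v + x)) d.
Proof.
have e : (fun h : R => h^-1 *: ((f \o shift (t *: v + x)) (h *: v)
      - f (t *: v + x))) =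
    (fun h : R => h^-1 *: (((fun h => f (h *: v + x)) \o shift t) (h *: (1 : R))
      - f (t *: v + x))).
  apply/funext => h /=; congr (_ *: (f _ - _)).
  by rewrite [_%:A]mulr1 scalerDl addrA.
split=> -[df vf]; split.
- by move: df; rewrite /derivable e.
- by rewrite -vf /derive e.
- by move: df; rewrite /derivable e.
- by rewrite -vf /derive e.
Qed.

Lemma is_derive_line0 f x v (d : R) :
  is_derive x v f d <-> is_derive (0 : R) 1 (fun h => f (h *: v + x)) d.
Proof. by have := is_derive_line f x v 0 d; rewrite scale0r add0r. Qed.

Lemma is_derive_comp1 f (g : R -> R) x v a b :
  is_derive (f x) 1 g a -> is_derive x v f b -> is_derive x v (g \o f) (a * b).
Proof.
move=> dg /is_derive_line0 df; apply/is_derive_line0.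
apply: (@is_derive1_comp _ g (fun h => f (h *: v + x))) => //.
by rewrite scale0r add0r.
Qed.

End DirectionalDerivatives.

Section SmoothClosure.
Context {R : realType} {n : nat}.
Variables (U : set 'rV[R]_n.+1).
Hypothesis openU : open U.
Local Notation E := 'rV[R]_n.+1.
Local Notation e_ i := (delta_mx 0 i : E).
Implicit Types (f g : E -> R) (k : nat).

Lemma near_open f g u : {in U, f =1 g} -> U u -> {near u, f =1 g}.
Proof.
move=> fg Uu; near=> w; apply: fg; rewrite inE.
by near: w; exact: open_nbhs_nbhs.
Unshelve. all: by end_near. Qed.

Lemma of_class_C_ext k f g : {in U, f =1 g} -> of_class_C k U f ->
  of_class_C k U g.
Proof.
have cont f1 g1 : {in U, f1 =1 g1} -> (forall u, U u -> {for u, continuous f1}) ->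
    forall u, U u -> {for u, continuous g1}.
  move=> fg cf u Uu; have := cf u Uu.
  rewrite /prop_for /continuous_at -fg ?inE//.
  exact: (cvg_trans (@near_eq_cvg _ _ (nbhs u) _ _ _ (near_open fg Uu))).
elim: k f g => [|k IH] f g fg [cf df]; split; try exact: (cont f g).
  by [].
move=> i; have [dfi Ci] := df i; split=> [u Uu|].
  by apply: (near_eq_derivable _ (dfi u Uu)); exact: near_open.
apply: IH Ci => u; rewrite inE => Uu.
by apply: near_eq_derive; exact: near_open.
Qed.

Lemma of_class_C_succ k f (g : 'I_n.+1 -> E -> R) :
  (forall u, U u -> {for u, continuous f}) ->
  (forall i u, U u -> is_derive u (e_ i) f (g i u)) ->
  (forall i, of_class_C k U (g i)) -> of_class_C k.+1 U f.
Proof.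
move=> cf df Cg; split=> // i; split=> [u /(df i)[]//|].
apply: of_class_C_ext (Cg i) => u; rewrite inE => Uu.
by have [_ <-] := df i u Uu.
Qed.

Lemma of_class_C_is_derive k f i u : of_class_C k.+1 U f -> U u ->
  is_derive u (e_ i) f (partial i f u).
Proof. by move=> [_ /(_ i)[df _]] /df; exact: derivableP. Qed.

Lemma of_class_CW k f : of_class_C k.+1 U f -> of_class_C k U f.
Proof.
elim: k f => [|k IH] f; first by case.
by move=> [cf df]; split=> // i; have [dfi Ci] := df i; split=> //; exact: IH.
Qed.

Lemma of_class_C_cont k f : of_class_C k U f ->
  forall u, U u -> {for u, continuous f}.
Proof. by case: k => [|k] []. Qed.

Lemma of_class_C_cst k (a : R) : of_class_C k U (fun=> a).
Proof.
elim: k a => [|k IH] a; first by split=> // u _; apply: cst_continuous.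
apply: (@of_class_C_succ _ _ (fun _ _ => 0)) => [u _|i].
  exact: cst_continuous.
exact: IH.
Qed.

Lemma of_class_CD k f g : of_class_C k U f -> of_class_C k U g ->
  of_class_C k U (fun u => f u + g u).
Proof.
elim: k f g => [|k IH] f g Cf Cg.
  split=> // u Uu.
  exact: (cvgD (of_class_C_cont Cf Uu) (of_class_C_cont Cg Uu)).
apply: (@of_class_C_succ _ _ (fun i u => partial i f u + partial i g u)).
- move=> u Uu.
  exact: (cvgD (of_class_C_cont Cf Uu) (of_class_C_cont Cg Uu)).
- move=> i u Uu.
  have hf := of_class_C_is_derive i Cf Uu.
  have hg := of_class_C_is_derive i Cg Uu.
  exact: is_deriveD.
- by move=> i; apply: IH; [exact: (Cf.2 i).2 | exact: (Cg.2 i).2].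
Qed.

Lemma of_class_CM k f g : of_class_C k U f -> of_class_C k U g ->
  of_class_C k U (fun u => f u * g u).
Proof.
elim: k f g => [|k IH] f g Cf Cg.
  split=> // u Uu.
  exact: (cvgM (of_class_C_cont Cf Uu) (of_class_C_cont Cg Uu)).
apply: (@of_class_C_succ _ _
  (fun i u => f u * partial i g u + g u * partial i f u)).
- move=> u Uu.
  exact: (cvgM (of_class_C_cont Cf Uu) (of_class_C_cont Cg Uu)).
- move=> i u Uu.
  have hf := of_class_C_is_derive i Cf Uu.
  have hg := of_class_C_is_derive i Cg Uu.
  exact: is_deriveM.
- move=> i; apply: of_class_CD; apply: IH.
  + exact: of_class_CW.
  + exact: (Cg.2 i).2.
  + exact: of_class_CW.
  + exact: (Cf.2 i).2.
Qed.

Lemma of_class_CV k f : (forall u, U u -> f u != 0) -> of_class_C k U f ->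
  of_class_C k U (fun u => (f u)^-1).
Proof.
move=> f0; elim: k f f0 => [|k IH] f f0 Cf.
  by split=> // u Uu; exact: (cvgV (f0 u Uu) (of_class_C_cont Cf Uu)).
apply: (@of_class_C_succ _ _
  (fun i u => (-1 * ((f u)^-1 * (f u)^-1)) * partial i f u)).
- by move=> u Uu; exact: (cvgV (f0 u Uu) (of_class_C_cont Cf Uu)).
- move=> i u Uu; have [df vf] := of_class_C_is_derive i Cf Uu.
  split; first by apply: derivableV => //; exact: f0.
  rewrite deriveV ?f0// vf; congr (_ * _).
  by rewrite expr2 invfM mulN1r.
- move=> i; have C' : of_class_C k U (fun u => (f u)^-1).
    by apply: IH => //; exact: of_class_CW.
  apply: of_class_CM; last exact: (Cf.2 i).2.
  by apply: of_class_CM; [exact: of_class_C_cst | exact: of_class_CM].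
Qed.

Lemma of_class_C_sqrt k f : (forall u, U u -> 0 < f u) -> of_class_C k U f ->
  of_class_C k U (fun u => Num.sqrt (f u)).
Proof.
move=> f0; elim: k => [|k IH] Cf.
  split=> // u Uu; apply: continuous_comp; first exact: (of_class_C_cont Cf).
  exact: sqrt_continuous.
apply: (@of_class_C_succ _ _ (fun i u => (2 * Num.sqrt (f u))^-1 * partial i f u)).
- move=> u Uu; apply: continuous_comp; first exact: (of_class_C_cont Cf).
  exact: sqrt_continuous.
- move=> i u Uu; have hf := of_class_C_is_derive i Cf Uu.
  exact: (is_derive_comp1 (is_derive1_sqrt (f0 u Uu)) hf).
- move=> i; apply: of_class_CM; last exact: (Cf.2 i).2.
  apply: of_class_CV => [u Uu|].
    by rewrite mulf_neq0// gt_eqF// sqrtr_gt0; exact: f0.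
  apply: of_class_CM; first exact: of_class_C_cst.
  by apply: IH; exact: of_class_CW.
Qed.

Lemma is_derive_coord i j u : is_derive u (e_ i) (fun w : E => w 0 j) (j == i)%:R.
Proof.
apply/is_derive_line0.
have -> : (fun h : R => (h *: e_ i + u) 0 j) =
    (fun h : R => h * (j == i)%:R) + cst (u 0 j).
  by apply/funext => h; rewrite !mxE eqxx.
have -> : (fun h : R => h * (j == i)%:R) = (j == i)%:R \*: id.
  by apply/funext => h /=; rewrite mulrC.
by apply: is_derive_eq; rewrite addr0 [_%:A]mulr1.
Qed.

Lemma of_class_C_sincos k j : of_class_C k U (fun u => sin (u 0 j)) /\
  of_class_C k U (fun u => cos (u 0 j)).
Proof.
have cs u : {for u, continuous (fun u : E => sin (u 0 j))}.
  apply: (@continuous_comp _ _ _ (fun u : E => u 0 j) sin).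
    exact: coord_continuous.
  exact: continuous_sin.
have cc u : {for u, continuous (fun u : E => cos (u 0 j))}.
  apply: (@continuous_comp _ _ _ (fun u : E => u 0 j) cos).
    exact: coord_continuous.
  exact: continuous_cos.
elim: k => [|k [IHs IHc]]; first by split; split=> // u _.
split.
  apply: (@of_class_C_succ _ _ (fun i u => cos (u 0 j) * (j == i)%:R)) => //.
    move=> i u _.
    exact: (is_derive_comp1 (is_derive_sin (u 0 j)) (is_derive_coord i j u)).
  by move=> i; apply: of_class_CM => //; exact: of_class_C_cst.
apply: (@of_class_C_succ _ _ (fun i u => (-1 * sin (u 0 j)) * (j == i)%:R)) => //.
  move=> i u _; rewrite mulN1r.
  exact: (is_derive_comp1 (is_derive_cos (u 0 j)) (is_derive_coord i j u)).
move=> i; apply: of_class_CM; last exact: of_class_C_cst.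
by apply: of_class_CM => //; exact: of_class_C_cst.
Qed.

End SmoothClosure.

Lemma MVT0 (R : realType) (g dg : R -> R) (h : R) : 0 <= h ->
  (forall t, t \in `[0, h] -> is_derive t 1 g (dg t)) ->
  exists2 t, t \in `[0, h] & g h - g 0 = dg t * h.
Proof.
move=> h0 dgP.
have d1 t (th : t \in `]0, h[) : is_derive t 1 g (dg t).
  exact: dgP (subset_itv_oo_cc th).
have c1 : {within `[0, h], continuous g}.
  by apply: derivable_within_continuous => t /dgP[].
by have [t th] := MVT_segment h0 d1 c1; rewrite subr0; exists t.
Qed.

Lemma norm_delta_mx_le1 (R : realType) n (i : 'I_n.+1) :
  `|delta_mx 0 i : 'rV[R]_n.+1| <= 1.
Proof.
rewrite /Num.norm/= mx_normrE; apply: bigmax_le => // -[p q] _ /=.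
by rewrite mxE; case: (_ && _); rewrite ?normr1 ?normr0.
Qed.

(** * Symmetry of second derivatives *)

Section Schwarz.
Context {R : realType} {n : nat}.
Variables (U : set 'rV[R]_n.+1).
Hypothesis openU : open U.
Local Notation E := 'rV[R]_n.+1.
Local Notation e_ i := (delta_mx 0 i : E).

(** The mean value theorem is applied in direction i to the difference of f in direction j, then in
    direction j to the partial derivative. *)
Let second_difference (f : E -> R) i j u (h : R) : of_class_C 2 U f -> 0 <= h ->
  (forall s t, s \in `[0, h] -> t \in `[0, h] -> U (t *: e_ j + (s *: e_ i + u))) ->
  exists s t, [/\ s \in `[0, h], t \in `[0, h] &
    f (h *: e_ j + (h *: e_ i + u)) - f (h *: e_ i + u) - f (h *: e_ j + u) + f u =
    partial j (partial i f) (t *: e_ j + (s *: e_ i + u)) * h * h].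
Proof.
move=> Cf h0 inU.
have h0h : h \in `[0, h] by rewrite in_itv/= h0 lexx.
have h00 : 0 \in `[0, h] by rewrite in_itv/= h0 lexx.
have addAC (s t : R) : t *: e_ j + (s *: e_ i + u) = s *: e_ i + (t *: e_ j + u).
  by rewrite addrCA.
have D1 s (sh : s \in `[0, h]) :
    is_derive s 1 (fun s => f (s *: e_ i + (h *: e_ j + u)) - f (s *: e_ i + u))
    (partial i f (s *: e_ i + (h *: e_ j + u)) - partial i f (s *: e_ i + u)).
  have d1 : is_derive s 1 (fun s => f (s *: e_ i + (h *: e_ j + u)))
      (partial i f (s *: e_ i + (h *: e_ j + u))).
    have Uw : U (s *: e_ i + (h *: e_ j + u)) by rewrite -addAC; exact: inU.
    exact: ((is_derive_line _ _ _ _ _).1 (of_class_C_is_derive i Cf Uw)).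
  have d2 : is_derive s 1 (fun s => f (s *: e_ i + u)) (partial i f (s *: e_ i + u)).
    have Uw : U (s *: e_ i + u).
      by have := inU s 0 sh h00; rewrite scale0r add0r.
    exact: ((is_derive_line _ _ _ _ _).1 (of_class_C_is_derive i Cf Uw)).
  exact: is_deriveB.
have [s sh fs] := MVT0 h0 D1.
have D2 t (th : t \in `[0, h]) :
    is_derive t 1 (fun t => partial i f (t *: e_ j + (s *: e_ i + u)))
    (partial j (partial i f) (t *: e_ j + (s *: e_ i + u))).
  have Cif : of_class_C 1 U (partial i f) := (Cf.2 i).2.
  exact: ((is_derive_line _ _ _ _ _).1 (of_class_C_is_derive j Cif (inU _ _ sh th))).
have [t th ft] := MVT0 h0 D2.
exists s, t; split=> //; rewrite -ft scale0r add0r.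
move: fs; rewrite !scale0r !add0r -!addAC => <-.
by ring.
Qed.

(** The second difference over a small square is symmetric in i and j, so the two mixed derivatives
    share a value at points near u. Their continuity at u then makes them equal. *)
Lemma partial_comm f i j u : of_class_C 2 U f -> U u ->
  partial i (partial j f) u = partial j (partial i f) u.
Proof.
move=> Cf Uu; apply/eqP; rewrite -subr_eq0 -normr_le0.
apply/ler_addgt0Pl => e e0; rewrite addr0.
have cont p q : {for u, continuous (partial p (partial q f))}.
  by have [_ /(_ q)[_ [_ /(_ p)[_ [c _]]]]] := Cf; exact: c.
have e20 : 0 < e / 2 by rewrite divr_gt0.
have near_p p q : \forall w \near u,
    `|partial p (partial q f) u - partial p (partial q f) w| < e / 2.
  by have /cvgrPdist_lt := cont p q; apply.
have near_U : nbhs u U by exact: open_nbhs_nbhs.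
have near_all : \forall w \near u, [/\ U w,
    `|partial i (partial j f) u - partial i (partial j f) w| < e / 2 &
    `|partial j (partial i f) u - partial j (partial i f) w| < e / 2].
  by apply: filterS3 near_U (near_p i j) (near_p j i) => w *; split.
have [r /= r0 rP] := (nbhs_ballP _ _).1 near_all.
(* Two displacements of length at most h must stay inside the ball of radius r. *)
pose h := r / 3.
have h0 : 0 <= h by rewrite divr_ge0// ltW.
have inb p q s t : s \in `[0, h] -> t \in `[0, h] ->
    ball u r (t *: e_ q + (s *: e_ p + u)).
  rewrite !in_itv/= => /andP[s0 sh] /andP[t0 th].
  rewrite -ball_normE /ball_/= addrA opprD addrCA subrr addr0 normrN.
  have le_e (w : R) m : 0 <= w -> w <= h -> `|w *: e_ m| <= h.
    move=> w0 wh; rewrite normrZ ger0_norm// (le_trans _ wh)// ler_piMr//.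
    exact: norm_delta_mx_le1.
  apply: (le_lt_trans (ler_normD _ _)).
  apply: (@le_lt_trans _ _ (h + h)); first by apply: lerD; exact: le_e.
  by rewrite /h; lra.
have inU p q s t : s \in `[0, h] -> t \in `[0, h] ->
    U (t *: e_ q + (s *: e_ p + u)).
  by move=> sh th; have [] := rP _ (inb p q s t sh th).
have [s [t [sh th E1]]] := second_difference Cf h0 (inU i j).
have [s' [t' [sh' th' E2]]] := second_difference Cf h0 (inU j i).
have E : partial j (partial i f) (t *: e_ j + (s *: e_ i + u)) =
    partial i (partial j f) (t' *: e_ i + (s' *: e_ j + u)).
  have hn0 : h * h != 0 by rewrite mulf_neq0// gt_eqF// divr_gt0.
  have addAC : h *: e_ i + (h *: e_ j + u) = h *: e_ j + (h *: e_ i + u).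
    by rewrite addrCA.
  move: E1 E2; rewrite addAC.
  move: (partial j (partial i f) _) (partial i (partial j f) _) => X Y.
  move: (f _) (f _) (f _) => x1 x2 x3 E1 E2.
  apply: (mulIf hn0); apply: (eq_trans (mulrA _ _ _)); apply: (eq_trans (esym E1)).
  apply: (eq_trans _ (esym (mulrA _ _ _))); apply: (eq_trans _ E2).
  by congr (_ + _); exact: addrAC.
have [_ _ k1] := rP _ (inb i j s t sh th).
have [_ k2 _] := rP _ (inb j i s' t' sh' th').
set A := partial i (partial j f) u in k2 *.
set B := partial j (partial i f) u in k1 *.
rewrite -E in k2; set C := partial j _ _ in k1 k2.
have -> : A - B = (A - C) - (B - C) by ring.
apply: (le_trans (ler_normB _ _)).
by have /ltW := ltrD k2 k1; rewrite -splitr.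
Qed.

End Schwarz.

(** * Smooth functions on a domain *)

(** The distinguished point keeps the ring of functions on the domain nontrivial, as [comNzRingType]
    demands. *)
Record domain (R : realType) (n : nat) := Domain {
  domain_set :> set 'rV[R]_n.+1;
  domain_open : open domain_set;
  domain_pt : 'rV[R]_n.+1;
  domain_ptP : domain_set domain_pt }.

Section SmoothRing.
Context {R : realType} {n : nat}.
Variable U : domain R n.
Local Notation E := 'rV[R]_n.+1.

Definition pts : Type := {u : E | domain_set U u}.
HB.instance Definition _ := gen_eqMixin pts.
HB.instance Definition _ := gen_choiceMixin pts.
HB.instance Definition _ :=
  isPointed.Build pts (exist _ (domain_pt U) (domain_ptP U)).

(** Ring elements are functions on the points of U only, so that equality on U is equality.
    Extension by 0 provides a function on the whole space to differentiate; on the open set U the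
    choice of extension does not affect derivatives. *)
Definition extend (f : pts -> R) (u : E) : R :=
  if pselect (domain_set U u) is left h then f (exist _ u h) else 0.

Lemma extendE (f : pts -> R) u (Uu : domain_set U u) : extend f u = f (exist _ u Uu).
Proof.
rewrite /extend; case: pselect => // Uu'.
by rewrite (Prop_irrelevance Uu' Uu).
Qed.

Lemma extend_ext (f : pts -> R) (g : E -> R) :
  (forall p, f p = g (sval p)) -> {in (U : set E), extend f =1 g}.
Proof. by move=> fg u; rewrite inE => Uu; rewrite (extendE f Uu) fg. Qed.

Definition smooth_pred : {pred pts -> R} := fun f => `[< smooth U (extend f) >].

Lemma smooth_predP f (g : E -> R) : (forall p, f p = g (sval p)) -> smooth U g ->
  f \in smooth_pred.
Proof.
move=> fg Sg; apply/asboolP => k; apply: (of_class_C_ext (@domain_open _ _ U)) (Sg k).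
by move=> u Uu; rewrite (extend_ext fg).
Qed.

Lemma smooth_pred_subring : subring_closed smooth_pred.
Proof.
split.
- apply: (@smooth_predP _ (fun=> 1)) => // k.
  exact: of_class_C_cst (@domain_open _ _ U) _ _.
- move=> f g /asboolP Sf /asboolP Sg.
  apply: (@smooth_predP _ (fun u => extend f u + -1 * extend g u)).
    by move=> [u Uu]; rewrite /= !extendE mulN1r.
  move=> k; apply: of_class_CD (@domain_open _ _ U) _ _ _ _ _; first exact: Sf.
  apply: of_class_CM (@domain_open _ _ U) _ _ _ _ _; last exact: Sg.
  exact: of_class_C_cst (@domain_open _ _ U) _ _.
- move=> f g /asboolP Sf /asboolP Sg.
  apply: (@smooth_predP _ (fun u => extend f u * extend g u)).
    by move=> [u Uu]; rewrite /= !extendE.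
  by move=> k; apply: of_class_CM (@domain_open _ _ U) _ _ _ _ _; [exact: Sf|exact: Sg].
Qed.

HB.instance Definition _ :=
  GRing.isSubringClosed.Build (pts -> R) smooth_pred smooth_pred_subring.

Record sfun := SFun { sfun_fun : pts -> R; sfunP : sfun_fun \in smooth_pred }.
HB.instance Definition _ := [isSub for sfun_fun].
HB.instance Definition _ := [Choice of sfun by <:].
HB.instance Definition _ := [SubChoice_isSubComNzRing of sfun by <:].

Definition ev (p : pts) (F : sfun) : R := sfun_fun F p.

Lemma ev_zmod p : zmod_morphism (ev p).
Proof. by []. Qed.

Lemma ev_monoid p : monoid_morphism (ev p).
Proof. by split. Qed.

HB.instance Definition _ p := GRing.isZmodMorphism.Build sfun R (ev p) (@ev_zmod p).
HB.instance Definition _ p := GRing.isMonoidMorphism.Build sfun R (ev p) (@ev_monoid p).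

Lemma evD p F G : ev p (F + G) = ev p F + ev p G. Proof. by []. Qed.
Lemma evB p F G : ev p (F - G) = ev p F - ev p G. Proof. by []. Qed.
Lemma evN p F : ev p (- F) = - ev p F. Proof. by []. Qed.
Lemma evM p F G : ev p (F * G) = ev p F * ev p G. Proof. by []. Qed.
Lemma ev0 p : ev p 0 = 0. Proof. by []. Qed.
Lemma ev1 p : ev p 1 = 1. Proof. by []. Qed.
Lemma ev_nat p k : ev p k%:R = k%:R. Proof. exact: (rmorph_nat (ev p)). Qed.
Lemma ev_sum p I (r : seq I) (P : pred I) (F : I -> sfun) :
  ev p (\sum_(i <- r | P i) F i) = \sum_(i <- r | P i) ev p (F i).
Proof. exact: (rmorph_sum (ev p)). Qed.

Lemma sfun_eq (F G : sfun) : (forall p, ev p F = ev p G) -> F = G.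
Proof. by move=> FG; apply/val_inj/funext. Qed.

Lemma extend_smooth (F : sfun) : smooth U (extend (sfun_fun F)).
Proof. exact: asboolW (sfunP F). Qed.

Lemma smooth_partial i (f : E -> R) : smooth U f -> smooth U (partial i f).
Proof. by move=> Sf k; have [_ /(_ i)[]] := Sf k.+1. Qed.

Definition sfun_of (f : E -> R) (Sf : smooth U f) : sfun :=
  SFun (@smooth_predP (fun p => f (sval p)) f (fun=> erefl) Sf).

Definition sder (i : 'I_n.+1) (F : sfun) : sfun :=
  sfun_of (smooth_partial i (extend_smooth F)).

Lemma sderE (f : E -> R) (F : sfun) i p : (forall q, ev q F = f (sval q)) ->
  ev p (sder i F) = partial i f (sval p).
Proof.
move=> Ff; rewrite /ev /= /partial; apply: near_eq_derive.
apply: (near_open (@domain_open _ _ U)); last exact: (svalP p).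
exact: extend_ext.
Qed.

Lemma sder_is_derive i F p :
  is_derive (sval p) (delta_mx 0 i) (extend (sfun_fun F)) (ev p (sder i F)).
Proof.
exact: (of_class_C_is_derive i (extend_smooth F 1%N) (svalP p)).
Qed.

Lemma ev_extend p F : extend (sfun_fun F) (sval p) = ev p F.
Proof. by case: p => u Uu; rewrite (extendE _ Uu). Qed.

Lemma sderD i F G : sder i (F + G) = sder i F + sder i G.
Proof.
apply: sfun_eq => p; rewrite rmorphD.
rewrite (@sderE (fun u => extend (sfun_fun F) u + extend (sfun_fun G) u)); last first.
  by move=> q; rewrite rmorphD !ev_extend.
have hF := sder_is_derive i F p; have hG := sder_is_derive i G p.
by have [] := is_deriveD hF hG.
Qed.

Lemma sderM i F G : sder i (F * G) = sder i F * G + F * sder i G.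
Proof.
apply: sfun_eq => p; rewrite rmorphD !rmorphM.
rewrite (@sderE (fun u => extend (sfun_fun F) u * extend (sfun_fun G) u)); last first.
  by move=> q; rewrite rmorphM !ev_extend.
have hF := sder_is_derive i F p; have hG := sder_is_derive i G p.
have [_ e] := is_deriveM hF hG.
by rewrite /partial e !ev_extend addrC mulrC.
Qed.

Lemma sderC i j F : sder i (sder j F) = sder j (sder i F).
Proof.
apply: sfun_eq => p; have key k l : ev p (sder k (sder l F)) =
    partial k (partial l (extend (sfun_fun F))) (sval p) by exact: sderE.
rewrite !key; apply: (partial_comm (@domain_open _ _ U) _ _ _ (svalP p)).
exact: extend_smooth.
Qed.

Definition Ds : derivations sfun n.+1 := Derivations sderD sderM sderC.

End SmoothRing.

Section Units.
Context {R : realType} {n : nat}.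
Variable U : domain R n.
Local Notation A := (sfun U).

Lemma sfun_inv (F : A) : (forall p, ev p F != 0) -> exists G : A, F * G = 1.
Proof.
move=> F0.
have S : smooth U (fun u => (extend (sfun_fun F) u)^-1).
  move=> k; apply: of_class_CV (@domain_open _ _ U) _ _ _ _; last exact: extend_smooth.
  by move=> u Uu; rewrite (extendE _ Uu); exact: F0.
exists (sfun_of S); apply: sfun_eq => p; rewrite rmorphM rmorph1.
by rewrite [X in _ * X]/= ev_extend; exact: (mulfV (F0 p)).
Qed.

Lemma sfun_sqrt (F : A) : (forall p, 0 < ev p F) -> exists G : A, G * G = F.
Proof.
move=> F0.
have S : smooth U (fun u => Num.sqrt (extend (sfun_fun F) u)).
  move=> k; apply: of_class_C_sqrt (@domain_open _ _ U) _ _ _ _; last exact: extend_smooth.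
  by move=> u Uu; rewrite (extendE _ Uu); exact: F0.
exists (sfun_of S); apply: sfun_eq => p; rewrite rmorphM /ev /= ev_extend.
by rewrite -expr2 sqr_sqrtr// ltW.
Qed.

Lemma smooth_cst (a : R) : smooth U (fun=> a).
Proof. by move=> k; exact: of_class_C_cst (@domain_open _ _ U) _ _. Qed.

Definition scst a : A := sfun_of (smooth_cst a).

Lemma scst_is_zmod : zmod_morphism scst.
Proof. by move=> a b; apply: sfun_eq => p; rewrite rmorphB. Qed.

Lemma scst_is_monoid : monoid_morphism scst.
Proof. by split=> [|a b]; apply: sfun_eq => p; rewrite ?rmorph1 ?rmorphM. Qed.

HB.instance Definition _ := GRing.isZmodMorphism.Build R A scst scst_is_zmod.
HB.instance Definition _ := GRing.isMonoidMorphism.Build R A scst scst_is_monoid.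

Lemma ev_scst p a : ev p (scst a) = a. Proof. by []. Qed.

Lemma sder_scst i a : Ds U i (scst a) = 0.
Proof.
apply: sfun_eq => p; rewrite rmorph0 (@sderE _ _ _ (fun=> a))//.
exact: derive_cst.
Qed.

Lemma sfun_nat_inv m : exists j : A, m.+1%:R * j = 1.
Proof.
exists (scst m.+1%:R^-1).
by rewrite -(rmorph_nat scst) -rmorphM mulfV ?rmorph1// pnatr_eq0.
Qed.

Lemma smooth_sin j : smooth U (fun u => sin (u 0 j)).
Proof. by move=> k; have [] := of_class_C_sincos (@domain_open _ _ U) k j. Qed.

Lemma smooth_cos j : smooth U (fun u => cos (u 0 j)).
Proof. by move=> k; have [] := of_class_C_sincos (@domain_open _ _ U) k j. Qed.

Definition ssin j : A := sfun_of (smooth_sin j).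
Definition scos j : A := sfun_of (smooth_cos j).

Lemma ev_ssin p j : ev p (ssin j) = sin (sval p 0 j). Proof. by []. Qed.
Lemma ev_scos p j : ev p (scos j) = cos (sval p 0 j). Proof. by []. Qed.

Lemma scos2Dsin2 j : scos j * scos j + ssin j * ssin j = 1.
Proof.
by apply: sfun_eq => p; rewrite rmorphD !rmorphM rmorph1 -!expr2 cos2Dsin2.
Qed.

Lemma sder_ssin i j : Ds U i (ssin j) = (j == i)%:R * scos j.
Proof.
apply: sfun_eq => p; rewrite rmorphM rmorph_nat.
rewrite (@sderE _ _ _ (fun u => sin (u 0 j)))//.
have [_] := is_derive_comp1 (is_derive_sin (sval p 0 j)) (is_derive_coord i j (sval p)).
by rewrite mulrC.
Qed.

Lemma sder_scos i j : Ds U i (scos j) = - ((j == i)%:R * ssin j).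
Proof.
apply: sfun_eq => p; rewrite rmorphN rmorphM rmorph_nat.
rewrite (@sderE _ _ _ (fun u => cos (u 0 j)))//.
have [_] := is_derive_comp1 (is_derive_cos (sval p 0 j)) (is_derive_coord i j (sval p)).
by rewrite mulNr mulrC.
Qed.

End Units.

(** * Uniqueness for linear differential inequalities *)

Section LinearODE.
Context {R : realType}.

(** On so short an interval a contraction replaces the exponential bound: at a maximum point c of
    the sum N of absolute values, the mean value theorem gives N c <= (size s) C h N c with a factor
    below 1, hence N c = 0. *)
Lemma gronwall0 (I : eqType) (s : seq I) (g dg : I -> R -> R) (h C : R) :
  0 <= h -> 0 <= C -> (size s)%:R * C * h < 1 ->
  (forall k, k \in s -> forall t, t \in `[0, h] -> is_derive t 1 (g k) (dg k t)) ->
  (forall k, k \in s -> forall t, t \in `[0, h] ->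
     `|dg k t| <= C * \sum_(j <- s) `|g j t|) ->
  (forall k, k \in s -> g k 0 = 0) ->
  forall k, k \in s -> g k h = 0.
Proof.
move=> h0 C0 small der bound init.
pose N t := \sum_(j <- s) `|g j t|.
have N0 t : 0 <= N t by exact: sumr_ge0.
have contN : {within `[0, h], continuous N}.
  have : {subset s <= s} by [].
  rewrite /N; elim: {-2}s => [|k s' IH] ss'.
    rewrite (_ : (fun t => _) = cst 0); first by move=> x; exact: cst_continuous.
    by apply/funext => t; rewrite big_nil.
  rewrite (_ : (fun t => _) = (fun t => `|g k t| + \sum_(j <- s') `|g j t|)); last first.
    by apply/funext => t; rewrite big_cons.
  have ck : {within `[0, h], continuous (g k)}.
    apply: derivable_within_continuous => t th.
    by have [] := der k (ss' _ (mem_head _ _)) t th.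
  have cs' : {within `[0, h], continuous (fun t => \sum_(j <- s') `|g j t|)}.
    by apply: IH => j js; apply: ss'; rewrite inE js orbT.
  by move=> x; apply: cvgD; [apply: cvg_norm; exact: ck | exact: cs'].
have [c ch cmax] := EVT_max h0 contN.
have [c0 cleh] : 0 <= c /\ c <= h by move: ch; rewrite in_itv/= => /andP[].
have le_gk k : k \in s -> `|g k c| <= C * h * N c.
  move=> ks; have sub t : t \in `[0, c] -> t \in `[0, h].
    by rewrite !in_itv/= => /andP[-> /le_trans ->].
  have D t (th : t \in `[0, c]) : is_derive t 1 (g k) (dg k t).
    exact: der k ks t (sub t th).
  have [t /sub th] := MVT0 c0 D; rewrite init// subr0 => ->.
  rewrite normrM (ger0_norm c0).
  apply: (@le_trans _ _ (C * N t * c)).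
    by rewrite ler_wpM2r//; exact: bound.
  rewrite -!mulrA ler_wpM2l// mulrC.
  by apply: ler_pM => //; exact: cmax.
have NcE : N c <= (size s)%:R * C * h * N c.
  apply: (@le_trans _ _ (\sum_(j <- s) C * h * N c)).
    by rewrite {1}/N big_seq [leRHS]big_seq; apply: ler_sum => j; exact: le_gk.
  by rewrite big_const_seq count_predT iter_addr_0 -[leLHS]mulr_natl !mulrA.
have Nc0 : N c = 0.
  apply/eqP; rewrite eq_le N0 andbT leNgt; apply/negP => Ncp.
  by move: NcE; rewrite leNgt -[ltRHS]mul1r ltr_pM2r// small.
move=> k ks; apply/eqP; rewrite -normr_eq0 eq_le normr_ge0 andbT -Nc0.
apply: le_trans (cmax h _); last by rewrite in_itv/= h0 lexx.
rewrite /N (big_rem k)//= lerDl; exact: sumr_ge0.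
Qed.

End LinearODE.

(** * Closed linear systems of partial differential equations *)

Section ClosedSystem.
Context {R : realType} {n : nat}.
Variables (U : domain R n) (ys : seq (sfun U)).
Local Notation E := 'rV[R]_n.+1.
Local Notation e_ i := (delta_mx 0 i : E).
Local Notation N q := (\sum_(y <- ys) `|ev q y|).

Let N0 (q : pts U) : 0 <= N q.
Proof. by apply: sumr_ge0 => y _; exact: normr_ge0. Qed.

Let near_forall (x : E) (P : E -> Prop) : (forall w, P w) -> \forall w \near x, P w.
Proof. by move=> h; exact: (@filterE _ (nbhs x)). Qed.

Lemma spans_bound (p : pts U) F : spans ys F -> exists2 C : R, 0 <= C &
  \forall w \near sval p, forall q : pts U, sval q = w -> `|ev q F| <= C * N q.
Proof.
elim=> [y yin||a b _ [C C0 HC] _ [C' C'0 HC']|c a _ [C C0 HC]].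
- exists 1 => //; apply: near_forall => w q _.
  by rewrite mul1r (big_rem y)//= lerDl sumr_ge0.
- by exists 0 => //; apply: near_forall => w q _; rewrite rmorph0 normr0 mul0r.
- exists (C + C'); first exact: addr_ge0.
  apply: filterS2 HC HC' => w h h' q qw; rewrite rmorphD mulrDl.
  by apply: (le_trans (ler_normD _ _)); apply: lerD; [exact: h|exact: h'].
(* By continuity the coefficient c is bounded near p by its absolute value at p plus 1. *)
- exists ((`|ev p c| + 1) * C); first by rewrite mulr_ge0// addr_ge0.
  have cc : {for sval p, continuous (extend (sfun_fun c))}.
    exact: of_class_C_cont (extend_smooth c 0%N) _ (svalP p).
  have near_c : \forall w \near sval p,
      `|extend (sfun_fun c) (sval p) - extend (sfun_fun c) w| < 1.
    by have /cvgrPdist_lt := cc; apply.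
  apply: filterS2 HC near_c => w h hc q qw; rewrite rmorphM normrM -mulrA.
  have hq : `|ev q c| <= `|ev p c| + 1.
    move: hc; rewrite -qw !ev_extend => hc.
    rewrite -[ev q c](subrK (ev p c)) addrC (le_trans (ler_normD _ _))// lerD2l.
    by rewrite distrC ltW.
  exact: (ler_pM (normr_ge0 _) (normr_ge0 _) hq (h q qw)).
Qed.

Lemma spans_bounds (p : pts U) (zs : seq (sfun U)) : (forall z, z \in zs -> spans ys z) ->
  exists2 C : R, 0 <= C & \forall w \near sval p, forall q : pts U, sval q = w ->
    forall z, z \in zs -> `|ev q z| <= C * N q.
Proof.
elim: zs => [|z zs IH] hz.
  by exists 0 => //; apply: near_forall.
have [|C C0 HC] := IH; first by move=> y yi; apply: hz; rewrite inE yi orbT.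
have [C' C'0 HC'] := spans_bound p (hz z (mem_head _ _)).
exists (C + C'); first exact: addr_ge0.
apply: filterS2 HC HC' => w h h' q qw y.
rewrite inE mulrDl => /predU1P[->|yi].
  by apply: (le_trans (h' q qw)); rewrite lerDr mulr_ge0.
by apply: (le_trans (h q qw y yi)); rewrite lerDl mulr_ge0.
Qed.

Lemma ball_rVP (u w : E) (r : R) : 0 < r ->
  ball u r w <-> forall i, `|u 0 i - w 0 i| < r.
Proof.
move=> r0; split.
  by case=> _ h i; exact: (h 0 i).
by move=> h; split=> // i j; rewrite ord1; exact: h.
Qed.

Hypothesis closed_ys : forall y i, y \in ys -> spans ys (Ds U i y).

(* Gronwall along one coordinate axis after another. *)
Lemma closed_system_eq0 (p : pts U) : (forall y, y \in ys -> ev p y = 0) ->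
  \forall w \near sval p, forall q : pts U, sval q = w ->
    forall y, y \in ys -> ev q y = 0.
Proof.
move=> init.
have [|C C0 HC] := @spans_bounds p [seq Ds U i y | i <- enum 'I_n.+1, y <- ys].
  by move=> z /allpairsP[[i y] [_ yin ->]]; exact: closed_ys.
have near_U : nbhs (sval p) (domain_set U).
  by apply: open_nbhs_nbhs; split; [exact: domain_open | exact: svalP].
have [r0 /= r00 r0P] := (nbhs_ballP _ _).1 (filterI near_U HC).
pose K := (size ys)%:R * C.
have K0 : 0 <= K by rewrite mulr_ge0.
(* The second bound makes K h < 1 for every step h <= r, as [gronwall0] requires. *)
pose r := Num.min r0 (K + 1)^-1.
have rp : 0 < r by rewrite lt_min r00/= invr_gt0 ltr_wpDl.
have Kr h : h <= r -> K * h < 1.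
  move=> hr; apply: (@le_lt_trans _ _ (K * (K + 1)^-1)).
    by rewrite ler_wpM2l// (le_trans hr)// ge_min lexx orbT.
  by rewrite ltr_pdivrMr ?ltr_wpDl// mul1r ltrDl.
have sub w : ball (sval p) r w -> domain_set U w /\
    forall q : pts U, sval q = w -> forall i y, y \in ys ->
      `|ev q (Ds U i y)| <= C * N q.
  move=> wb; have [|Uw Hw] := r0P w.
    by apply: le_ball wb; rewrite ge_min lexx.
  split=> // q qw i y yin; apply: (Hw q qw).
  by apply/allpairsP; exists (i, y); rewrite mem_enum.
pose Y (y : sfun U) := extend (sfun_fun y).
(* The segment is parametrised by t in [0, 1] with the displacement t h, so that h may be
   negative. *)
have step (i : 'I_n.+1) (w : E) (h : R) : (forall t, t \in `[0, 1] ->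
    ball (sval p) r ((t * h) *: e_ i + w)) -> `|h| <= r ->
    (forall y, y \in ys -> Y y w = 0) ->
    forall y, y \in ys -> Y y (h *: e_ i + w) = 0.
  move=> hb hr hw.
  pose g y (t : R) := Y y ((t * h) *: e_ i + w).
  pose dg y (t : R) := h * Y (Ds U i y) ((t * h) *: e_ i + w).
  have := @gronwall0 R _ ys g dg 1 (C * `|h|).
  rewrite mulr1 !ler01 mulrA -/K => /(_ isT).
  have -> : 0 <= C * `|h| by rewrite mulr_ge0.
  move=> /(_ isT (Kr _ hr)) G y yin.
  have := G _ _ _ y yin; rewrite /g mul1r; apply.
  - move=> k kin t th; have [Uw _] := sub _ (hb t th).
    have d1 := of_class_C_is_derive i (extend_smooth k 1%N) Uw.
    have d2 := (is_derive_line _ _ _ _ _).1 d1.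
    have d3 : is_derive t 1 (fun t : R => t * h) h.
      rewrite (_ : (fun _ => _) = h \*: id); last first.
        by apply/funext => x /=; rewrite mulrC.
      by apply: is_derive_eq; rewrite [_%:A]mulr1.
    have := @is_derive1_comp _ (fun s => Y k (s *: e_ i + w)) (fun t => t * h)
      t _ _ d2 d3.
    by rewrite /dg /Y [extend (sfun_fun (Ds _ _ _)) _](extendE _ Uw) mulrC.
  - move=> k kin t th; have [Uw Hw] := sub _ (hb t th).
    rewrite /dg normrM mulrC mulrAC ler_wpM2r//.
    have := Hw (exist _ _ Uw) erefl i k kin.
    rewrite -ev_extend /= => /le_trans; apply.
    by rewrite ler_wpM2l// ler_sum// => j _; rewrite /g -ev_extend.
  - by move=> k kin; rewrite mul0r scale0r add0r; exact: hw.
apply/nbhs_ballP; exists r => //= w /(ball_rVP _ _ rp) wb q qw y yin.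
pose u := sval p.
(* The corners of the staircase from u to w. It stays in the ball because the ball is a cube. *)
pose mix j : E := \row_i (if (i < j)%N then w 0 i else u 0 i).
suff mix0 j : (j <= n.+1)%N -> forall y, y \in ys -> Y y (mix j) = 0.
  rewrite -ev_extend qw -[RHS](mix0 n.+1 (leqnn _) y yin) /Y; congr extend.
  by apply/rowP => i; rewrite mxE ltn_ord.
elim: j => [_ z zin|j IH jn].
  have -> : mix 0%N = u by apply/rowP => i; rewrite mxE.
  by rewrite /Y ev_extend init.
pose o := Ordinal jn.
have -> : mix j.+1 = (w 0 o - u 0 o) *: e_ o + mix j.
  apply/rowP => i; rewrite !mxE eqxx/= ltnS.
  case: (eqVneq i o) => [->|io] /=; first by rewrite leqnn ltnn mulr1 subrK.
  by rewrite mulr0 add0r leq_eqVlt -(inj_eq val_inj)/= in io *; rewrite (negbTE io).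
apply: step; last exact: IH (ltnW jn).
  move=> t; rewrite in_itv/= => /andP[t0 t1]; apply/(ball_rVP _ _ rp) => i.
  rewrite !mxE eqxx/=; case: (eqVneq i o) => [->|io] /=.
    rewrite ltnn mulr1 opprD addrCA subrr addr0 normrN normrM (ger0_norm t0).
    by rewrite (le_lt_trans _ (wb o))// distrC ler_piMl.
  rewrite mulr0 add0r; case: ifP => _; first exact: wb.
  by rewrite subrr normr0.
by rewrite distrC ltW.
Qed.

End ClosedSystem.

(** * Trigonometric polynomials *)

Section TrigPolynomials.
Context {R : realType}.

(* Trigonometric polynomials become polynomials in z = tan (v / 2). *)
Definition trigpoly (f : R -> R) := exists (k : nat) (p : {poly R}),
  forall v, cos v != 0 -> f (v *+ 2) = cos v ^+ (2 * k) * p.[sin v / cos v].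

Lemma trigpoly_cst a : trigpoly (fun=> a).
Proof. by exists 0%N, a%:P => v _; rewrite muln0 expr0 mul1r hornerC. Qed.

Lemma trigpoly_cos : trigpoly cos.
Proof.
exists 1%N, (1 - 'X^2) => v cv.
rewrite mulr2n cosD !hornerE -!expr2 mulrBr mulr1 expr_div_n.
by rewrite mulrC divfK// expf_neq0.
Qed.

Lemma trigpoly_sin : trigpoly sin.
Proof.
exists 1%N, (2 *: 'X) => v cv.
by rewrite mulr2n sinD hornerZ hornerX; field.
Qed.

Lemma trigpolyM f g : trigpoly f -> trigpoly g -> trigpoly (fun v => f v * g v).
Proof.
move=> [k [p fE]] [l [q gE]]; exists (k + l)%N, (p * q) => v cv.
by rewrite fE// gE// hornerM mulnDr exprD mulrACA.
Qed.

(** The two powers of cos are equalised by multiplying with powers of 1 = cos^2 (1 + z^2). *)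
Lemma trigpolyD f g : trigpoly f -> trigpoly g -> trigpoly (fun v => f v + g v).
Proof.
move=> [k [p fE]] [l [q gE]].
exists (k + l)%N, (p * (1%:P + 'X^2) ^+ l + q * (1%:P + 'X^2) ^+ k) => v cv.
have one : cos v ^+ 2 * (1 + (sin v / cos v) ^+ 2) = 1.
  by transitivity (cos v ^+ 2 + sin v ^+ 2); [field | exact: cos2Dsin2].
rewrite fE// gE// !(hornerD, hornerM, horner_exp, hornerX, hornerC) mulnDr exprD.
rewrite !exprM; set z := sin v / cos v in one *.
set C := cos v ^+ 2 in one *.
have ok m : C ^+ m * (1 + z ^+ 2) ^+ m = 1 by rewrite -exprMn one expr1n.
transitivity (C ^+ k * p.[z] * (C ^+ l * (1 + z ^+ 2) ^+ l)
  + C ^+ l * q.[z] * (C ^+ k * (1 + z ^+ 2) ^+ k)); last by ring.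
by rewrite !ok !mulr1.
Qed.

(** Local vanishing gives the polynomial in the tangent of the half angle more roots than its
    degree, so it is 0; the half-angle formula is then read at 0, where cos does not vanish. *)
Lemma trigpoly_eq0 f (v0 : R) : trigpoly f -> (\forall v \near v0, f v = 0) ->
  f 0 = 0.
Proof.
move=> [k [p fE]] near0.
suff p0 : p = 0.
  by have := fE 0; rewrite cos0 mul0rn => ->; rewrite ?oner_neq0// p0 horner0 mulr0.
have near_half (w : R) : (\forall v \near w *+ 2, f v = 0) ->
    \forall v \near w, f (v *+ 2) = 0.
  have c : {for w, continuous (fun v : R => v *+ 2)}.
    by rewrite (_ : (fun _ => _) = (fun v => v + v))//; exact: cvgD.
  by move=> h; apply: (c _ h).
have [w cw nearw] : exists2 w, cos w != 0 & \forall v \near w *+ 2, f v = 0.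
  have v0E : v0 = (v0 / 2) *+ 2 by rewrite -mulr_natr divfK// pnatr_eq0.
  case: (eqVneq (cos (v0 / 2)) 0) => [c0|]; last by exists (v0 / 2); rewrite -?v0E.
  have [e /= e0 eP] := (nbhs_ballP _ _).1 near0.
  (* If the tangent of v0 / 2 is undefined, the half angle is moved by d: d <= 1 < pi makes sin d
     positive, and doubling moves v0 by at most e / 2, which stays in the neighbourhood. *)
  pose d := Num.min 1 (e / 4).
  have d0 : 0 < d by rewrite lt_min ltr01 divr_gt0.
  have d1 : d <= 1 by rewrite ge_min lexx.
  have de : d <= e / 4 by rewrite ge_min lexx orbT.
  exists (v0 / 2 + d).
    have coefZ2 : 0 < sin d.
      by apply: sin_gt0_pi; rewrite d0/=; have := pi_ge2 R; lra.
    rewrite cosD c0 mul0r sub0r oppr_eq0 mulf_neq0//; last by rewrite gt_eqF.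
    apply/eqP => s0; have := cos2Dsin2 (v0 / 2); rewrite c0 s0 => /eqP.
    by rewrite expr0n addr0 eq_sym oner_eq0.
  apply/nbhs_ballP; exists (e / 2); first by rewrite /= divr_gt0.
  move=> v; rewrite /ball/= => hv; apply: eP; rewrite /ball/=.
  move: hv; rewrite mulrnDl -v0E => hv.
  have -> : v0 - v = (v0 + d *+ 2 - v) - d *+ 2 by ring.
  apply: (le_lt_trans (ler_normB _ _)); rewrite (ger0_norm (_ : 0 <= d *+ 2)); last first.
    by rewrite mulrn_wge0// ltW.
  by rewrite mulr2n; lra.
have near_cos : \forall v \near w, cos v != 0.
  have c : {for w, continuous (fun v : R => cos v)} := @continuous_cos R w.
  have := c _ (_ : nbhs (cos w) [set x | x != 0]); apply.
  exact: open_nbhs_nbhs (conj (@open_neq R 0) cw).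
have [e /= e0 eP] := (nbhs_ballP _ _).1 (filterI near_cos (near_half w nearw)).
pose N := size p.
(* The N = [size p] sample points w + h j lie within a distance below 1, hence below pi, so their
   tangents are distinct, and a nonzero p has fewer than [size p] roots. *)
pose h := Num.min 1 e / N.+1%:R.
have h0 : 0 < h by rewrite divr_gt0// lt_min ltr01.
pose x (j : nat) := w + h * j%:R.
have hj j : (j <= N)%N -> h * j%:R < 1 /\ h * j%:R < e.
  move=> jN; have : h * j%:R < Num.min 1 e.
    rewrite /h -mulrA gtr_pMr ?lt_min ?ltr01//.
    by rewrite mulrC ltr_pdivrMr// mul1r ltr_nat ltnS.
  by rewrite lt_min => /andP[].
have xP j : (j <= N)%N -> cos (x j) != 0 /\ f (x j *+ 2) = 0.
  move=> jN; have [] := eP (x j); last by split.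
  have hj0 : 0 <= h * j%:R by apply: mulr_ge0 => //; exact: ltW h0.
  rewrite /ball/= /x opprD addrA subrr add0r normrN (ger0_norm hj0).
  by have [] := hj j jN.
apply/eqP; apply/negPn/negP => pn0.
have := @max_poly_roots _ p [seq sin (x j) / cos (x j) | j <- iota 0 N] pn0.
rewrite size_map size_iota ltnn => roots.
suff /roots/(_ _)/negP : all (root p) [seq sin (x j) / cos (x j) | j <- iota 0 N].
  apply=> //; rewrite map_inj_in_uniq ?iota_uniq// => i j.
  rewrite !mem_iota !add0n /= => iN jN; have [ci _] := xP i (ltnW iN).
  have [cj _] := xP j (ltnW jN) => tij.
  have s0 : sin (x i - x j) = 0.
    rewrite sinB; move/eqP: tij; rewrite eqr_div// => /eqP ->.
    by rewrite [X in _ - X]mulrC subrr.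
  have key a b : (a < b)%N -> (b <= N)%N -> 0 < sin (x b - x a).
    move=> ab bN; apply: sin_gt0_pi.
    have -> : x b - x a = h * (b - a)%N%:R by rewrite /x natrB 1?ltnW//; ring.
    rewrite mulr_gt0 ?ltr0n ?subn_gt0//=.
    have [h1 _] := hj (b - a)%N (leq_trans (leq_subr _ _) bN).
    by have := pi_ge2 R; lra.
  case: (ltngtP i j) => // [ij|ji].
    have := key i j ij (ltnW jN).
    by rewrite -opprB sinN s0 oppr0 ltxx.
  by have := key j i ji (ltnW iN); rewrite s0 ltxx.
apply/allP => y /mapP[j]; rewrite mem_iota add0n /= => jN ->.
have [cj fj] := xP j (ltnW jN); apply/rootP.
have := fE _ cj; rewrite fj => /esym/eqP; rewrite mulf_eq0 => /orP[|/eqP//].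
by rewrite expf_eq0 (negbTE cj) andbF.
Qed.

End TrigPolynomials.

Section WholeSpace.
Context {R : realType}.
Local Notation E := 'rV[R]_5.

(* The invariant is analytic, so it is enough to follow it from U to the whole
   covering R^5, where the angles are independent real variables. *)
Definition whole : domain R 4 := Domain openT (domain_pt := 0) I.
Definition whole_pt (u : E) : pts whole := exist _ u I.

Inductive trig : sfun whole -> Prop :=
| trig_cst a : trig (scst whole a)
| trig_sin j : trig (ssin whole j)
| trig_cos j : trig (scos whole j)
| trigD F G : trig F -> trig G -> trig (F + G)
| trigM F G : trig F -> trig G -> trig (F * G).

Lemma trigN F : trig F -> trig (- F).
Proof.
move=> h; rewrite -mulN1r -(rmorph1 (scst whole)) -rmorphN.
by apply: trigM => //; exact: trig_cst.
Qed.

Lemma trig_nat k : trig k%:R.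
Proof. by rewrite -(rmorph_nat (scst whole)); exact: trig_cst. Qed.

Lemma trig_derivative i F : trig F -> trig (Ds whole i F).
Proof.
elim=> [a|j|j|G H _ tG _ tH|G H hG tG hH tH].
- by rewrite sder_scst; exact: (trig_nat 0).
- by rewrite sder_ssin; apply: trigM; [exact: trig_nat | exact: trig_cos].
- by rewrite sder_scos; apply/trigN/trigM; [exact: trig_nat | exact: trig_sin].
- by rewrite derD; exact: trigD.
- by rewrite derM; apply: trigD; exact: trigM.
Qed.

Definition set_coord (u : E) (i : 'I_5) (v : R) : E := \row_j if j == i then v else u 0 j.

Lemma trig_trigpoly F u i : trig F -> trigpoly (fun v => ev (whole_pt (set_coord u i v)) F).
Proof.
elim=> [a|j|j|G H _ tG _ tH|G H _ tG _ tH].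
- exact: trigpoly_cst.
- rewrite (_ : (fun _ => _) = fun v => sin (if j == i then v else u 0 j)).
    by case: (j == i); [exact: trigpoly_sin | exact: trigpoly_cst].
  by apply/funext => v; rewrite ev_ssin mxE.
- rewrite (_ : (fun _ => _) = fun v => cos (if j == i then v else u 0 j)).
    by case: (j == i); [exact: trigpoly_cos | exact: trigpoly_cst].
  by apply/funext => v; rewrite ev_scos mxE.
- exact: trigpolyD.
- exact: trigpolyM.
Qed.

(** One-variable continuation twice: for each v3 near its initial value, v1 is moved to 0, and then
    v3 is moved to 0 with v1 = 0 fixed. *)
Lemma trig_eq0 F (W : set E) (u0 : E) : trig F -> open W -> W u0 ->
  (forall u, W u -> ev (whole_pt u) F = 0) ->
  ev (whole_pt (set_coord (set_coord u0 0 0) 2%:R 0)) F = 0.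
Proof.
move=> tF oW Wu0 WF.
have [r /= r0 rW] := (nbhs_ballP _ _).1 (open_nbhs_nbhs (conj oW Wu0)).
have swap v : set_coord (set_coord u0 2%:R v) 0 0 = set_coord (set_coord u0 0 0) 2%:R v.
  apply/rowP => j; rewrite !mxE.
  by case: (eqVneq j 0) => [->|//]; case: eqP.
apply: (trigpoly_eq0 (v0 := u0 0 2%:R) (trig_trigpoly (set_coord u0 0 0) 2%:R tF)).
apply/nbhs_ballP; exists r => // v3 hv3; rewrite -swap.
apply: (trigpoly_eq0 (v0 := u0 0 0) (trig_trigpoly (set_coord u0 2%:R v3) 0 tF)).
apply/nbhs_ballP; exists r => // v1 hv1; apply: WF; apply: rW.
apply/(ball_rVP _ _ r0) => j; rewrite !mxE.
case: (eqVneq j 0) => [->|_]; first exact: hv1.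
case: (eqVneq j 2%:R) => [->|_]; first exact: hv3.
by rewrite subrr normr0.
Qed.

Variable U : domain R 4.

Definition agree (F : sfun U) (G : sfun whole) :=
  forall q : pts U, ev q F = ev (whole_pt (sval q)) G.

Lemma agree_der i F G : agree F G -> agree (Ds U i F) (Ds whole i G).
Proof.
move=> FG q; rewrite (@sderE _ _ _ (extend (sfun_fun G))) => [|p]; last first.
  by rewrite FG -ev_extend.
by rewrite [RHS](@sderE _ _ _ (extend (sfun_fun G)))// => p; rewrite -ev_extend.
Qed.

Lemma agreeD F G F' G' : agree F F' -> agree G G' -> agree (F + G) (F' + G').
Proof. by move=> hF hG q; rewrite !evD hF hG. Qed.
Lemma agreeN F F' : agree F F' -> agree (- F) (- F').
Proof. by move=> hF q; rewrite !evN hF. Qed.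
Lemma agreeM F G F' G' : agree F F' -> agree G G' -> agree (F * G) (F' * G').
Proof. by move=> hF hG q; rewrite !evM hF hG. Qed.
Lemma agree_nat k : agree k%:R k%:R.
Proof. by move=> q; rewrite !ev_nat. Qed.
Lemma agree_cst a : agree (scst U a) (scst whole a). Proof. by []. Qed.
Lemma agree_sin j : agree (ssin U j) (ssin whole j). Proof. by []. Qed.
Lemma agree_cos j : agree (scos U j) (scos whole j). Proof. by []. Qed.

Variables (ka la kb L : R).
Local Notation uP O := (abnP (Ds O) (scos O) (ssin O) (scst O ka) (scst O la) (scst O kb) (scst O L)).

Lemma agree_abn_norm : agree (abn_norm (scos U) (scst U kb)) (abn_norm (scos whole) (scst whole kb)).
Proof.
apply: (transfer_abn_norm agreeD agreeM (agree_nat 1) agree_cos); exact: agree_cst.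
Qed.

Let trigD2 (F G _ _ : sfun whole) : trig F -> trig G -> trig (F + G) := @trigD F G.
Let trigM2 (F G _ _ : sfun whole) : trig F -> trig G -> trig (F * G) := @trigM F G.
Let trigN2 (F _ : sfun whole) : trig F -> trig (- F) := @trigN F.
Let trig_der2 i (F _ : sfun whole) : trig F -> trig (Ds whole i F) := @trig_derivative i F.

Lemma trig_abn_norm : trig (abn_norm (scos whole) (scst whole kb)).
Proof.
exact: (@transfer_abn_norm _ _ (fun F _ : sfun whole => trig F) trigD2 trigM2 (trig_nat 1)
  _ (scos whole) _ (scst whole kb) trig_cos (trig_cst kb)).
Qed.

Lemma agree_abnP : agree (uP U) (uP whole).
Proof.
exact: (transfer_abnP agreeD agreeM agreeN (agree_nat 1) agree_der agree_cos agree_sin).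
Qed.

Lemma trig_abnP : trig (uP whole).
Proof.
exact: (@transfer_abnP _ _ (Ds whole) (Ds whole) (fun F _ : sfun whole => trig F)
  trigD2 trigM2 trigN2 (trig_nat 1) trig_der2 _ _ (scos whole) (ssin whole) _ _ _ _ (scst whole ka) (scst whole la)
  (scst whole kb) (scst whole L) trig_cos trig_sin (trig_cst ka) (trig_cst la) (trig_cst kb) (trig_cst L)).
Qed.

Lemma abnP_wholeE (u : E) : u 0 0 = 0 -> u 0 2%:R = 0 ->
  ev (whole_pt u) (uP whole) = - 224 *
   ((1 + kb) * (1 + ka) * (ka * ka * la * (1 + kb))
     + (1 + kb) * (1 + kb) * (kb * kb * L * la * la * (1 + ka))) ^+ 4.
Proof.
move=> u0 u2.
rewrite (@abnP_straight _ _ _ _ _ (@sder_scos _ _ whole) (@sder_ssin _ _ whole)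
  _ _ _ _ _ _ _ _ (ev (whole_pt u))) => *;
  first [exact: sder_scst | by rewrite ?ev_scos ?ev_ssin ?ev_scst /= ?u0 ?u2 ?sin0 ?cos0].
Qed.

End WholeSpace.

(** * Lifts to the universal covering *)

Section ConfigLift.
Local Open Scope quotient_scope.
Context {R : realType}.
Local Notation E := 'rV[R]_5.
Local Notation proj := (@config_proj R).

Lemma config_proj_eq (u w : E) : same_config u w -> proj u = proj w.
Proof. exact: (elimT (eqmodP (config_equiv R) u w)). Qed.

Lemma config_proj_same (u w : E) : proj u = proj w -> same_config u w.
Proof. exact: (introT (eqmodP (config_equiv R) u w)). Qed.

Lemma repr_config_proj (u : E) : exists k : 'rV[int]_5,
  [/\ k 0 3%:R = 0, k 0 4%:R = 0 &
      repr (proj u) = u + \row_i (2 * pi * (k 0 i)%:~R)].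
Proof.
suff /asboolP : same_config u (repr (proj u)) by [].
by apply: config_proj_same; rewrite /config_proj reprK.
Qed.

Lemma config_proj_shift (u : E) (k : 'rV[int]_5) : k 0 3%:R = 0 -> k 0 4%:R = 0 ->
  proj (u + \row_i (2 * pi * (k 0 i)%:~R)) = proj u.
Proof.
by move=> k3 k4; apply/esym/config_proj_eq/asboolP; exists k.
Qed.

Lemma config_proj_repr_shift (u w : E) :
  proj (w + (repr (proj u) - u)) = proj w.
Proof.
have [k [k3 k4 ->]] := repr_config_proj u.
by rewrite addrAC subrr add0r config_proj_shift.
Qed.

Lemma config_projP p : exists u, proj u = p.
Proof. by exists (repr p); exact: reprK. Qed.

Lemma partial_shift (f : E -> R) (tau u : E) i : (forall w, f (w + tau) = f w) ->
  partial i f (u + tau) = partial i f u.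
Proof.
move=> per; rewrite /partial /derive.
set F := fun h : R => _; set G := fun h : R => _.
suff -> : F = G by [].
by apply/funext => h; rewrite /F /G /= per addrA per.
Qed.

Lemma pderiv_proj i (f : config R -> R) (u : E) :
  pderiv i f (proj u) = partial i (f \o proj) u.
Proof.
have per w : (f \o proj) (w + (repr (proj u) - u)) = (f \o proj) w.
  by rewrite /= config_proj_repr_shift.
by have := partial_shift u i per; rewrite addrC subrK.
Qed.

Lemma sincosD2pi_int (x : R) (m : int) : sin (x + 2 * pi * m%:~R) = sin x /\
  cos (x + 2 * pi * m%:~R) = cos x.
Proof.
have pos (y : R) (j : nat) : sin (y + 2 * pi * j%:R) = sin y /\
    cos (y + 2 * pi * j%:R) = cos y.
  have -> : 2 * pi * j%:R = (pi *+ 2) *+ j :> R.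
    by rewrite -[RHS]mulr_natr -[pi *+ 2]mulr_natr [2 * _]mulrC.
  by split; [exact: (periodicn (@sinD2pi R)) | exact: (periodicn (@cosD2pi R))].
case: m => j; first exact: pos.
rewrite NegzE mulrNz mulrN; have [<- <-] := pos (x - 2 * pi * j.+1%:R) j.+1.
by rewrite subrK.
Qed.

Lemma sin_angle i (u : E) : sin (angle i (proj u)) = sin (u 0 i).
Proof.
rewrite /angle; have [k [_ _ ->]] := repr_config_proj u; rewrite !mxE.
by have [] := sincosD2pi_int (u 0 i) (k 0 i).
Qed.

Lemma cos_angle i (u : E) : cos (angle i (proj u)) = cos (u 0 i).
Proof.
rewrite /angle; have [k [_ _ ->]] := repr_config_proj u; rewrite !mxE.
by have [] := sincosD2pi_int (u 0 i) (k 0 i).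
Qed.

(** The preimage of the image consists of the translates of W by periods. *)
Lemma config_proj_open (W : set E) : open W -> open (proj @` W).
Proof.
move=> oW; suff : open (proj @^-1` (proj @` W)) by [].
rewrite openE => u [w Ww /config_proj_same/asboolP[k [k3 k4 ->]]].
set tau := \row_i _.
have cW : nbhs (w + tau) ((fun x => x - tau) @^-1` W).
  have c : {for (w + tau), continuous (fun x : E => x - tau)}.
    exact: (cvgB cvg_id (cvg_cst _)).
  by apply: c; rewrite /= addrK; apply: open_nbhs_nbhs.
apply: filterS cW => x /= Wx; exists (x - tau) => //.
by rewrite -[in RHS](subrK tau x) config_proj_shift.
Qed.

End ConfigLift.

Section Lifts.
Context {R : realType}.
Local Notation E := 'rV[R]_5.
Local Notation proj := (@config_proj R).
Variables (M : set (config R)) (U : domain R 4).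
Hypothesis UM : forall u, domain_set U u <-> M (proj u).
Local Notation A := (sfun U).
Implicit Types (X Y : vfield R) (Xs Ys : 'rV[A]_5).

Definition ev_row (q : pts U) Xs : E := \row_i ev q (Xs 0 i).

Definition lifts X Xs := forall q : pts U, ev_row q Xs = X (proj (sval q)).

Lemma liftsE X Xs q i : lifts X Xs -> ev q (Xs 0 i) = X (proj (sval q)) 0 i.
Proof. by move=> <-; rewrite mxE. Qed.

Lemma lifts_smooth X Xs : lifts X Xs -> smooth_on M X.
Proof.
move=> hX j k; have UE : proj @^-1` M = domain_set U.
  by apply/seteqP; split=> u /UM.
rewrite UE; apply: of_class_C_ext (@domain_open _ _ U) _ _ _ _ _.
  2: exact: (extend_smooth (Xs 0 j) k).
by move=> u; rewrite inE => Uu; rewrite (extendE _ Uu) /= -(liftsE (exist _ u Uu) j hX).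
Qed.

Lemma smooth_lifts X : smooth_on M X -> exists Xs, lifts X Xs.
Proof.
move=> SX; have UE : proj @^-1` M = domain_set U.
  by apply/seteqP; split=> u /UM.
have S j : smooth U (fun u => X (proj u) 0 j) by rewrite /= -UE; exact: SX.
by exists (\row_j sfun_of (S j)) => q; apply/rowP => j; rewrite !mxE.
Qed.

Lemma lifts_bracket X Y Xs Ys : lifts X Xs -> lifts Y Ys ->
  lifts (bracket X Y) (br (Ds U) Xs Ys).
Proof.
move=> hX hY q; apply/rowP => i; rewrite !mxE evB !ev_sum -sumrB.
apply: eq_bigr => j _; rewrite !evM !(liftsE q _ hX) !(liftsE q _ hY).
rewrite !pderiv_proj; congr (_ * _ - _ * _).
  by rewrite (@sderE _ _ _ (fun u => Y (proj u) 0 i))// => p; exact: liftsE.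
by rewrite (@sderE _ _ _ (fun u => X (proj u) 0 i))// => p; exact: liftsE.
Qed.

End Lifts.

(** * Restriction to smaller domains *)

Section Restriction.
Context {R : realType} {n : nat}.
Variables (U V : domain R n).
Hypothesis VU : forall u, domain_set V u -> domain_set U u.

Definition incl (q : pts V) : pts U := exist _ (sval q) (VU (svalP q)).

Definition restricts (F : sfun U) (G : sfun V) := forall q, ev q G = ev (incl q) F.

Lemma restricts_der i F G : restricts F G -> restricts (Ds U i F) (Ds V i G).
Proof.
move=> FG q; rewrite (@sderE _ _ _ (extend (sfun_fun F))) => [|p]; last first.
  by rewrite FG -ev_extend.
by rewrite [RHS](@sderE _ _ _ (extend (sfun_fun F)))// => p; rewrite -ev_extend.
Qed.

Lemma restriction (F : sfun U) : exists G, restricts F G.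
Proof.
have S : smooth V (extend (sfun_fun F)).
  move=> k; elim: k {F}(extend _) (extend_smooth F k) => [|k IH] f [cf df].
    by split=> // u /VU; exact: cf.
  split=> [u /VU|i]; first exact: cf.
  by split=> [u /VU|]; [exact: (df i).1 | apply: IH; exact: (df i).2].
by exists (sfun_of S) => q; rewrite -(ev_extend (incl q)).
Qed.

Lemma restricts_act (X : 'rV_n.+1) (X' : 'rV_n.+1) F F' :
  (forall i, restricts (X 0 i) (X' 0 i)) -> restricts F F' ->
  restricts (act (Ds U) X F) (act (Ds V) X' F').
Proof.
move=> hX hF q; rewrite /act !ev_sum; apply: eq_bigr => i _.
by rewrite !evM hX (restricts_der i hF).
Qed.

Lemma restricts_br (X Y : 'rV_n.+1) (X' Y' : 'rV_n.+1) :
  (forall i, restricts (X 0 i) (X' 0 i)) -> (forall i, restricts (Y 0 i) (Y' 0 i)) ->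
  forall i, restricts (br (Ds U) X Y 0 i) (br (Ds V) X' Y' 0 i).
Proof.
move=> hX hY i q; rewrite !mxE !evB.
by rewrite (restricts_act hX (hY i)) (restricts_act hY (hX i)).
Qed.

End Restriction.

Section LocalVanishing.
Context {R : realType} {n : nat}.
Variables (U : domain R n) (W : set 'rV[R]_n.+1).
Hypothesis oW : open W.

Definition vanishes (F : sfun U) := forall q : pts U, W (sval q) -> ev q F = 0.

Lemma vanishes_der i F : vanishes F -> vanishes (Ds U i F).
Proof.
move=> hF q Wq; rewrite (@sderE _ _ _ (extend (sfun_fun F))) => [|p]; last first.
  by rewrite ev_extend.
rewrite /partial (@near_eq_derive _ _ _ _ (cst 0)) ?derive_cst//.
have := open_nbhs_nbhs (conj oW Wq); apply: filterS => w Ww.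
rewrite /extend; case: pselect => // Uw.
exact: (hF (exist _ w Uw)).
Qed.

Lemma vanishes_act X F : vanishes F -> vanishes (act (Ds U) X F).
Proof.
move=> hF q Wq; rewrite /act ev_sum big1// => i _.
by rewrite evM (vanishes_der i hF)// mulr0.
Qed.

Lemma vanishes_sym_data X1 X2 f g h : vanishes f -> vanishes g -> vanishes h ->
  forall y, y \in sym_data (Ds U) X1 X2 f g h -> vanishes y.
Proof.
move=> vf vg vh y; rewrite /sym_data /= !inE.
have va := vanishes_act.
by do 13 (case/orP => [/eqP->|]; first by auto 10); move=> /eqP->; auto 10.
Qed.

End LocalVanishing.

(** * The snake fields on the covering *)

Section SnakeLift.
Context {R : realType}.
Variables (l1 l3 b : R).
Variable U : domain R 4.
Local Notation A := (sfun U).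
Local Notation proj := (@config_proj R).
Local Notation c := (scos U).
Local Notation s := (ssin U).
Local Notation ka := (scst U (b / l1)).
Local Notation la := (scst U l1^-1).
Local Notation kb := (scst U ((1 - b) / l3)).
Local Notation lb := (scst U l3^-1).
Local Notation D := (Ds U).
Local Notation lX1 := (snakeX1 c s ka kb).
Local Notation lX2 := (snakeX2 c s la lb).
Local Notation lX3 := (snakeX3 c s ka la kb lb).
Local Notation lW := (snakeW c s ka la kb lb).
Local Notation lZ := (snakeZ c s ka la kb lb).
Let Dc := @sder_scos _ _ U.
Let Dsn := @sder_ssin _ _ U.
Let cs1 := @scos2Dsin2 _ _ U.
Let Dk x i : D i (scst U x) = 0 := sder_scst U i x.

Let evE := (@evD _ _ U, @evN _ _ U, @evM _ _ U, @ev1 _ _ U, @ev0 _ _ U,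
  @ev_scst _ _ U, @ev_scos _ _ U, @ev_ssin _ _ U).

Lemma lifts_X1 : lifts (X1 l1 l3 b) lX1.
Proof.
move=> q; apply: row5P; rewrite ![ev_row _ _ _ _]mxE !combE !evE mxE /= ?cos_angle //; ring.
Qed.

Lemma lifts_X2 : lifts (X2 l1 l3) lX2.
Proof.
move=> q; apply: row5P; rewrite ![ev_row _ _ _ _]mxE !combE !evE mxE /= ?cos_angle ?sin_angle//; ring.
Qed.

Lemma lifts_X3 : lifts (X3 l1 l3 b) lX3.
Proof.
have := lifts_bracket lifts_X1 lifts_X2.
by rewrite (br_snakeX1_X2 Dc Dsn cs1 (Dk _) (Dk _) (Dk _) (Dk _)).
Qed.

Lemma lifts_X4 : lifts (X4 l1 l3 b) (lW - lX2).
Proof.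
have := lifts_bracket lifts_X1 lifts_X3.
by rewrite -(br_snakeX1_X3 Dc Dsn cs1 (Dk _) (Dk _) (Dk _) (Dk _)) addrK.
Qed.

Lemma lifts_X5 : lifts (X5 l1 l3 b) lZ.
Proof.
have := lifts_bracket lifts_X2 lifts_X3.
by rewrite (br_snakeX2_X3 Dc Dsn cs1 (Dk _) (Dk _) (Dk _) (Dk _)).
Qed.

(** The second and fourth rows get the same coefficient because W = X4 + X2, while Z = X5. *)
Let rows_free (Y1 Y2 Y3 Y4 Y5 : 'rV[R]_5) x y :
  (\matrix_(i < 5) [:: Y1; Y2; Y3; Y4; Y5]`_i) \in unitmx ->
  (forall i, x * Y2 0 i + x * Y4 0 i + y * Y5 0 i = 0) -> x = 0 /\ y = 0.
Proof.
set N := \matrix_(i < 5) _ => uN xy.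
set v : 'rV[R]_5 := row5 0 x 0 x y.
have vN : v *m N = 0.
  by apply/rowP => i; rewrite !mxE big_ord5 !mxE /= -[RHS](xy i); ring.
have v0 : v = 0 by rewrite -(mulmxK uN v) vN mul0mx.
by have := (congr1 (fun u : 'rV__ => u 0 1) v0, congr1 (fun u : 'rV__ => u 0 4%:R) v0);
  rewrite !mxE /= => -[].
Qed.

Lemma frame_free (q : pts U) x y : frame_at l1 l3 b (proj (sval q)) ->
  (forall i, x * ev q (lW 0 i) + y * ev q (lZ 0 i) = 0) -> x = 0 /\ y = 0.
Proof.
move=> fr xy; apply: (rows_free fr) => i; rewrite -[RHS](xy i).
rewrite -(liftsE q i lifts_X2) -(liftsE q i lifts_X4) -(liftsE q i lifts_X5).
by rewrite rowD rowN evD evN; ring.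
Qed.

Lemma frame_unit : (forall q : pts U, frame_at l1 l3 b (proj (sval q))) ->
  exists iD, (W_1 s ka la * Z_3 c kb lb - W_3 s kb lb * Z_1 c ka la) * iD = 1.
Proof.
move=> fr; apply: sfun_inv => q; apply/eqP => e0.
have row x y (e1 : x * ev q (W_1 s ka la) + y * ev q (Z_1 c ka la) = 0)
    (e2 : x * ev q (W_3 s kb lb) + y * ev q (Z_3 c kb lb) = 0) : x = 0 /\ y = 0.
  apply: (frame_free (fr q)) => i; elim/(@ord5P): i; rewrite !combE ?mulr0 ?subrr ?addr0 ?evE //; ring.
move: e0; rewrite evB (evM q (W_1 s ka la)) (evM q (W_3 s kb lb)); move: row.
move: (ev q (W_1 _ _ _)) (ev q (W_3 _ _ _)) (ev q (Z_1 _ _ _)) (ev q (Z_3 _ _ _)).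
move=> p1 p3 q1 q3 row e0.
(* If the determinant vanishes, then (q3, - p3) and (q1, - p1) are relations between the rows (p1,
   p3) and (q1, q3), so all four entries vanish; then (0, 1) is a relation too, which is absurd. *)
have [z3 w3] : q3 = 0 /\ - p3 = 0.
  by apply: row; [rewrite -[RHS]e0; ring | ring].
have [z1 w1] : q1 = 0 /\ - p1 = 0.
  by apply: row; [ring | rewrite -[RHS]oppr0 -e0; ring].
have [_ /eqP] : (0 : R) = 0 /\ (1 : R) = 0.
  by apply: row; rewrite ?z1 ?z3; ring.
by rewrite oner_eq0.
Qed.

End SnakeLift.

(** * Symmetries of the snake robot *)

Section Symmetries.
Context {R : realType}.
Variables (l1 l3 b : R).
Hypotheses (l1_gt0 : 0 < l1) (l3_gt0 : 0 < l3).
Variables (M : set (config R)) (U : domain R 4).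
Local Notation A := (sfun U).
Local Notation E := 'rV[R]_5.
Local Notation proj := (@config_proj R).
Hypothesis UM : forall u, domain_set U u <-> M (proj u).
Local Notation c := (scos U).
Local Notation s := (ssin U).
Local Notation ka := (scst U (b / l1)).
Local Notation la := (scst U l1^-1).
Local Notation kb := (scst U ((1 - b) / l3)).
Local Notation lb := (scst U l3^-1).
Local Notation D := (Ds U).
Local Notation lX1 := (snakeX1 c s ka kb).
Local Notation lX2 := (snakeX2 c s la lb).
Variable iD : A.
Hypothesis iDP : (W_1 s ka la * Z_3 c kb lb - W_3 s kb lb * Z_1 c ka la) * iD = 1.
Let Dc := @sder_scos _ _ U.
Let Dsn := @sder_ssin _ _ U.
Let cs1 := @scos2Dsin2 _ _ U.
Let Dk x i : D i (scst U x) = 0 := sder_scst U i x.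
Local Notation jet := (jet D c s ka la kb lb iD).
Local Notation sym := (infinitesimal_symmetries M (snake_distribution l1 l3 b)).

Definition preserves (T : 'rV[A]_5) := exists al be ga de,
  br D T lX1 = al *: lX1 + be *: lX2 /\ br D T lX2 = ga *: lX1 + de *: lX2.

(* X1 and X2 themselves need not vanish outside M. *)
Let within_M (X : vfield R) : vfield R := fun p => if `[< M p >] then X p else 0.

Let lifts_within (X : vfield R) Xs : lifts X (Xs : 'rV[A]_5) -> lifts (within_M X) Xs.
Proof. by move=> hX q; rewrite hX /within_M asboolT//; apply/UM/(svalP q). Qed.

Let section_within (X : vfield R) Xs : lifts X (Xs : 'rV[A]_5) ->
  (forall p, snake_distribution l1 l3 b p (X p)) ->
  sections M (snake_distribution l1 l3 b) (within_M X).
Proof.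
move=> hX XD; split; last by move=> p Mp; rewrite /within_M asboolT.
split; first exact: (lifts_smooth UM (lifts_within hX)).
by move=> p Mp; rewrite /within_M asboolF.
Qed.

(** [snake_distribution_span] supplies coefficients only point by point; the dual coframe makes them
    smooth functions. *)
Let tangent (V : 'rV[A]_5) :
  (forall q, snake_distribution l1 l3 b (proj (sval q)) (ev_row q V)) ->
  exists x y, V = x *: lX1 + y *: lX2.
Proof.
move=> VD; exists (pairv V (co1 c s)), (pairv V (co2 c s)).
apply: (frame_tangent cs1 iDP) => w.
  move=> w1 w2; apply: sfun_eq => q.
  have [x [y xy]] := (snake_distribution_span _ l1_gt0 l3_gt0 _ _).1 (VD q).
  have evp (X : 'rV[A]_5) : ev q (pairv X w) = \sum_i ev q (X 0 i) * ev q (w i 0).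
    by rewrite /pairv mxE ev_sum; apply: eq_bigr => i _; rewrite evM.
  transitivity (x * ev q (pairv lX1 w) + y * ev q (pairv lX2 w)); last first.
    by rewrite w1 w2 !ev0 !mulr0 addr0.
  rewrite !evp !mulr_sumr -big_split; apply: eq_bigr => i _ /=.
  rewrite (liftsE q i (@lifts_X1 _ l1 l3 b U)) (liftsE q i (@lifts_X2 _ l1 l3 U)).
  have -> : ev q (V 0 i) = ev_row q V 0 i by rewrite mxE.
  by rewrite xy rowD !rowZ mulrDl !mulrA.
Qed.

Lemma symmetry_preserves S T : sym S -> lifts S T -> preserves T.
Proof.
move=> [_ symS] hT.
have key X Xs : lifts X (Xs : 'rV[A]_5) ->
    (forall p, snake_distribution l1 l3 b p (X p)) ->
    exists x y, br D T Xs = x *: lX1 + y *: lX2.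
  move=> hX XD; apply: tangent => q.
  have [_ SXD] := symS _ (section_within hX XD).
  rewrite (lifts_bracket hT (lifts_within hX)); apply: SXD.
  exact/UM/(svalP q).
have [|al [be h1]] := key _ _ (@lifts_X1 _ l1 l3 b U).
  by move=> p; apply/snake_distribution_span => //; exists 1, 0; rewrite scale1r scale0r addr0.
have [|ga [de h2]] := key _ _ (@lifts_X2 _ l1 l3 U).
  by move=> p; apply/snake_distribution_span => //; exists 0, 1; rewrite scale1r scale0r add0r.
by exists al, be, ga, de.
Qed.

Lemma symmetry_lifts S : sym S -> exists2 T, lifts S T & preserves T.
Proof.
move=> symS; have [[SS _] _] := symS; have [T hT] := smooth_lifts UM SS.
by exists T => //; exact: symmetry_preserves symS hT.
Qed.

Lemma jet_eq0_near S T (q : pts U) : lifts S T -> preserves T ->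
  (forall y, y \in jet T -> ev q y = 0) ->
  \forall p \near proj (sval q), S p = 0.
Proof.
move=> hT [al [be [ga [de [h1 h2]]]]] jz.
have cl y i : y \in jet T -> spans (jet T) (D i y).
  exact: (jet_closed Dc Dsn cs1 (@sfun_nat_inv _ _ U) (Dk _) (Dk _) (Dk _) (Dk _) iDP h1 h2).
have : nbhs (sval q) [set w | forall q' : pts U, sval q' = w ->
    forall y, y \in jet T -> ev q' y = 0] := closed_system_eq0 cl jz.
rewrite nbhsE => -[N [oN Nq] NZ].
suff : nbhs (proj (sval q)) [set p | S p = 0] by [].
rewrite nbhsE; exists (proj @` (N `&` domain_set U)).
  split; last by exists (sval q) => //; split=> //; exact: (svalP q).
  by apply: config_proj_open; apply: openI => //; exact: domain_open.
move=> _ [u [Nu Uu] <-] /=; pose q' : pts U := exist _ u Uu.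
rewrite -(hT q'); apply/rowP => i; rewrite !mxE.
apply: (jet_eq0 Dc Dsn cs1 (Dk _) (Dk _) (Dk _) (Dk _) iDP h1 h2 (e := ev q')).
exact: (NZ u Nu q' erefl).
Qed.

Lemma vanishes_jet (W : set E) (T : 'rV[A]_5) : open W -> (forall i, vanishes W (T 0 i)) ->
  forall y : A, y \in jet T -> vanishes W y.
Proof.
move=> oW vT; have vp w : vanishes W (pairv T w).
  by move=> q Wq; rewrite /pairv mxE ev_sum big1// => i _; rewrite evM (vT i q Wq) mul0r.
exact: vanishes_sym_data (vp _) (vp _) (vp _).
Qed.

(** The interior of the zero set of S is also closed in M: at a limit point all jet entries vanish
    by continuity, and then S vanishes nearby by [jet_eq0_near]. Connectedness of M does the
    rest. *)
Lemma jet_determines S T (q : pts U) : connected M -> sym S -> lifts S T ->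
  (forall y, y \in jet T -> ev q y = 0) -> forall p, S p = 0.
Proof.
move=> cM symS hT jz p; have [[_ S0] _] := symS.
have pT := symmetry_preserves symS hT.
have [Mp|/S0//] := pselect (M p).
pose Z := [set p : config R | S p = 0]°.
have oZ : open Z by exact: open_interior.
have BM : M `&` Z = M.
  apply: cM.
  - exists (proj (sval q)); split; first exact/UM/(svalP q).
    exact: jet_eq0_near jz.
  - by exists Z.
  exists (closure (M `&` Z)); first exact: closed_closure.
  apply/seteqP; split=> [x xMZ|x [Mx clx]].
    by split; [case: xMZ | exact: subset_closure].
  split=> //; have [u ux] := config_projP x; subst x.
  have Uu : domain_set U u by apply/UM.
  pose qx : pts U := exist _ u Uu.
  apply: (jet_eq0_near (q := qx) hT pT) => y yj.
  have oW : open (proj @^-1` Z) by exact: oZ.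
  have vT i : vanishes (proj @^-1` Z) (T 0 i).
    move=> q' Zq'; have /= := hT q' => /(congr1 (fun v : 'rV_5 => v 0 i)).
    by rewrite mxE => ->; rewrite (interior_subset Zq') mxE.
  have vy := vanishes_jet oW vT yj.
  apply/eqP/negP => /negP yn0.
  have ct : {for u, continuous (extend (sfun_fun y))}.
    by have [ct _] := extend_smooth y 0%N; exact: ct.
  have : nbhs u [set w | extend (sfun_fun y) w != 0].
    apply: (ct [set x : R | x != 0]); apply: open_nbhs_nbhs; split.
      exact: open_neq.
    by rewrite /= (ev_extend qx y).
  move=> /(filterI (open_nbhs_nbhs (conj (@domain_open _ _ U) Uu))).
  rewrite nbhsE => -[N [oN Nu] NZ].
  have : nbhs (proj u) (proj @` N).
    by apply: open_nbhs_nbhs; split; [exact: config_proj_open | exists u].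
  move=> /clx[x [[_ Zw] [w Nw wE]]]; move: Zw; rewrite -wE => Zw; have [Uw /eqP] := NZ w Nw; apply.
  by rewrite (extendE _ Uw); exact: (vy (exist _ w Uw)).
have : (M `&` Z) p by rewrite BM.
by case=> _ /interior_subset.
Qed.

End Symmetries.

(** * Vanishing of the numerator on the snake configurations *)

Section Obstruction.
Context {R : realType}.
Variables (l1 l3 b : R).
Hypotheses (l1_gt0 : 0 < l1) (l3_gt0 : 0 < l3).
Local Notation E := 'rV[R]_5.
Local Notation proj := (@config_proj R).
Local Notation ka O := (scst O (b / l1)).
Local Notation la O := (scst O l1^-1).
Local Notation kb O := (scst O ((1 - b) / l3)).
Local Notation lb O := (scst O l3^-1).
Local Notation L O := (scst O l3).
Local Notation lX1 O := (snakeX1 (scos O) (ssin O) (ka O) (kb O)).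
Local Notation lX2 O := (snakeX2 (scos O) (ssin O) (la O) (lb O)).
Local Notation n O := (abn_norm (scos O) (kb O)).
Local Notation P O := (abnP (Ds O) (scos O) (ssin O) (ka O) (la O) (kb O) (L O)).

Lemma symmetric_point_obstruction (U : domain R 4) (q : pts U) (T : 'rV[sfun U]_5) al be ga de :
  (forall q : pts U, frame_at l1 l3 b (proj (sval q))) ->
  (forall q : pts U, ev q (n U) != 0) ->
  br (Ds U) T (lX1 U) = al *: lX1 U + be *: lX2 U ->
  br (Ds U) T (lX2 U) = ga *: lX1 U + de *: lX2 U ->
  [/\ ev q al = 1, ev q be = 0, ev q ga = 0, ev q de = 1 &
    forall i, ev q (T 0 i) = 0] ->
  ev q (P U) = 0.
Proof.
move=> fr n0 TX1 TX2 [eal ebe ega ede eT].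
have [iD iDP] := frame_unit fr.
have Llb : L U * lb U = 1 by rewrite -rmorphM mulfV ?gt_eqF// rmorph1.
have [r rn] : exists r, r * r * n U = 1.
  have [g gg] : exists g, g * g = n U.
    apply: sfun_sqrt => q'; rewrite lt_neqAle eq_sym n0 andTb.
    have -> : ev q' (n U) = (1 + (1 - b) / l3 * cos (sval q' 0 2%:R)) ^+ 2
        + ((1 - b) / l3 * sin (sval q' 0 2%:R)) ^+ 2.
      rewrite /abn_norm !(evD, evM) ?ev_nat ?ev1 ev_scst ev_scos.
      have := cos2Dsin2 (sval q' 0 2%:R).
      move: (cos _) (sin _) (_ / l3) => x y k xy.
      by apply: (eq_of_sub (congr1 (fun z => - (k ^+ 2) * z) xy)); ring.
    by rewrite addr_ge0 ?sqr_ge0.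
  have [r gr] : exists r, g * r = 1.
    apply: sfun_inv => q'; apply/eqP => g0; have := n0 q'.
    by rewrite -gg evM g0 mul0r eqxx.
  exists r; rewrite -gg; transitivity ((g * r) * (g * r)); first by ring.
  by rewrite gr mulr1.
(* The frame determinant inverted by [iD] is lb^2 times [abn_y], by L lb = 1. *)
have yP : abn_y (scos U) (ssin U) (ka U) (la U) (kb U) (L U) * (lb U * lb U * iD) = 1.
  rewrite -[RHS]iDP /W_1 /Z_3 /W_3 /Z_1 /abn_y.
  have e : lb U * (lb U * L U) = lb U by rewrite [_ * L U]mulrC Llb mulr1.
  move: (ka U) (la U) (kb U) (L U) (lb U) (scos U) (ssin U) e => x y z t w c s e.
  by apply: (eq_of_sub (congr1 (fun u => z * z * y * y * s 2%:R * (1 + x * c 0) * iD * u) e)); ring.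
exact: (abnormal_obstruction (@sder_scos _ _ U) (@sder_ssin _ _ U) (@scos2Dsin2 _ _ U)
  (@sfun_nat_inv _ _ U) (sder_scst U ^~ _) (sder_scst U ^~ _) (sder_scst U ^~ _)
  (sder_scst U ^~ _) (sder_scst U ^~ _) Llb rn yP TX1 TX2 (e := ev q) eT eal ebe ega ede).
Qed.

Lemma pts_inj (U : domain R 4) (p q : pts U) : sval p = sval q -> p = q.
Proof.
case: p q => [u hu] [w hw] /= uw; subst w.
by rewrite (Prop_irrelevance hu hw).
Qed.

Lemma restricts_snake (U V : domain R 4) (VU : forall u, domain_set V u -> domain_set U u) :
  (forall i, restricts VU (lX1 U 0 i) (lX1 V 0 i)) /\
  (forall i, restricts VU (lX2 U 0 i) (lX2 V 0 i)).
Proof. by split; elim/(@ord5P) => q; rewrite !combE. Qed.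

(** Where [abn_norm] vanishes the product is 0 trivially. At any other point everything is
    restricted to the open set where [abn_norm] is nonzero, so that its inverse square root r is
    smooth on the whole domain. *)
Lemma restricted_obstruction (U : domain R 4) (q : pts U) (T : 'rV[sfun U]_5) al be ga de :
  (forall q : pts U, frame_at l1 l3 b (proj (sval q))) ->
  br (Ds U) T (lX1 U) = al *: lX1 U + be *: lX2 U ->
  br (Ds U) T (lX2 U) = ga *: lX1 U + de *: lX2 U ->
  [/\ ev q al = 1, ev q be = 0, ev q ga = 0, ev q de = 1 &
    forall i, ev q (T 0 i) = 0] ->
  ev (whole_pt (sval q)) (P whole * n whole) = 0.
Proof.
move=> fr TX1 TX2 [eal ebe ega ede eT]; rewrite evM.
have [->|n0] := eqVneq (ev (whole_pt (sval q)) (n whole)) 0; first by rewrite mulr0.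
pose N := extend (sfun_fun (n whole)) @^-1` [set x | x != 0].
have NE u : N u = (ev (whole_pt u) (n whole) != 0) :> Prop.
  by rewrite -(ev_extend (whole_pt u)).
have oN : open N.
  apply: open_comp; last exact: open_neq.
  by move=> u _; have [ct _] := extend_smooth (n whole) 0%N; exact: ct.
rewrite -NE in n0.
pose V : domain R 4 := Domain (openI (@domain_open _ _ U) oN) (conj (svalP q) n0).
have VU u : domain_set V u -> domain_set U u by case.
have [r1 r2] := restricts_snake VU.
have [T' rT] : exists T' : 'rV[sfun V]_5, forall i, restricts VU (T 0 i) (T' 0 i).
  have [t ht] := choice (fun i => restriction VU (T 0 i)).
  by exists (\row_i t i) => i q'; rewrite mxE; exact: ht.
have [al' ral] := restriction VU al; have [be' rbe] := restriction VU be.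
have [ga' rga] := restriction VU ga; have [de' rde] := restriction VU de.
have TX1' : br (Ds V) T' (lX1 V) = al' *: lX1 V + be' *: lX2 V.
  apply/rowP => i; apply: sfun_eq => q'.
  rewrite (restricts_br rT r1) TX1 !rowD !rowZ !evD !evM.
  by rewrite ral rbe r1 r2.
have TX2' : br (Ds V) T' (lX2 V) = ga' *: lX1 V + de' *: lX2 V.
  apply/rowP => i; apply: sfun_eq => q'.
  rewrite (restricts_br rT r2) TX2 !rowD !rowZ !evD !evM.
  by rewrite rga rde r1 r2.
pose q' : pts V := exist _ (sval q) (conj (svalP q) n0).
have qE : incl VU q' = q by exact: pts_inj.
rewrite -(@agree_abnP _ V (b / l1) l1^-1 ((1 - b) / l3) l3 q').
rewrite (symmetric_point_obstruction _ _ TX1' TX2') ?mul0r//.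
- by move=> x; exact: (fr (incl VU x)).
- by move=> x; rewrite (@agree_abn_norm _ V ((1 - b) / l3) x); rewrite -NE; case: (svalP x).
- by split=> [||||i]; rewrite ?ral ?rbe ?rga ?rde ?rT qE.
Qed.

End Obstruction.

Section MaximalSymmetry.
Context {R : realType}.
Variables (l1 l3 b : R).
Hypotheses (l1_gt0 : 0 < l1) (l3_gt0 : 0 < l3).
Variables (M : set (config R)) (U : domain R 4).
Local Notation proj := (@config_proj R).
Hypothesis UM : forall u, domain_set U u <-> M (proj u).
Hypothesis cM : connected M.
Hypothesis frM : forall p, M p -> frame_at l1 l3 b p.
Local Notation sym := (infinitesimal_symmetries M (snake_distribution l1 l3 b)).
Local Notation P O := (abnP (Ds O) (scos O) (ssin O) (scst O (b / l1)) (scst O l1^-1)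
  (scst O ((1 - b) / l3)) (scst O l3)).

Lemma maximal_symmetry_obstruction (q : pts U) : has_dim sym 14 ->
  ev (whole_pt (sval q)) (P whole * abn_norm (scos whole) (scst whole ((1 - b) / l3))) = 0.
Proof.
move=> [B [free symE]].
have fr (q' : pts U) : frame_at l1 l3 b (proj (sval q')).
  by apply/frM/UM/(svalP q').
have [iD iDP] := frame_unit fr.
have symB i : sym (B i).
  rewrite symE; exists (fun j => (j == i)%:R).
  by rewrite (bigD1 i)//= eqxx scale1r big1 ?addr0// => j /negPf->; rewrite scale0r.
have [Tb hTb] := choice (fun i => let: ex_intro2 T hT _ :=
  symmetry_lifts l1_gt0 l3_gt0 UM iDP (symB i) in ex_intro (lifts (B i)) T hT).
pose T (a : 'rV[R]_14) := \sum_i scst U (a 0 i) *: Tb i.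
pose S (a : 'rV[R]_14) : vfield R := \sum_i a 0 i *: B i.
have hT a : lifts (S a) (T a).
  move=> q'; rewrite /S fct_sumE; apply/rowP => i.
  rewrite mxE /T !summxE ev_sum; apply: eq_bigr => k _.
  by rewrite rowZ evM ev_scst (liftsE q' i (hTb k)) mxE.
have symS a : sym (S a) by rewrite symE; exists (fun i => a 0 i).
pose J := jet_entry (Ds U) (scos U) (ssin U) (scst U (b / l1)) (scst U l1^-1)
  (scst U ((1 - b) / l3)) (scst U l3^-1) iD.
pose G : 'M[R]_14 := \matrix_(i, k) ev q (J (Tb i) k).
have JTG v (k : 'I_14) : ev q (J (T v) k) = (v *m G) 0 k.
  rewrite mxE (jet_entry_sum _ _ _ _ _ _ _ (ev q)) => [|j i]; last exact: sder_scst.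
  by apply: eq_bigr => i _; rewrite mxE.
(* A combination with zero jet at q is the zero symmetry by [jet_determines], so the 14 by 14 matrix
   of jets has independent rows. Equality of the two dimensions is what makes every jet occur. *)
have uG : G \in unitmx.
  rewrite -row_free_unit; apply: inj_row_free => a aG.
  apply/rowP => i; rewrite mxE; apply: (free (fun i => a 0 i)); apply/funext.
  apply: (jet_determines l1_gt0 l3_gt0 UM iDP (q := q) cM (symS a) (hT a)).
  by move=> y /jet_entryP[k ->]; rewrite JTG aG mxE.
(* The coefficients of the symmetry whose jet at q is that of the dilation required by [jet_euler]:
   X2 X1 f = 1, X1 X2 f = -1, all other entries 0. *)
pose a : 'rV[R]_14 := (\row_k ((k == 7%N :> nat)%:R - (k == 6%N :> nat)%:R)) *m invmx G.
have [al [be [ga [de [h1 h2]]]]] := symmetry_preserves l1_gt0 l3_gt0 UM iDP (symS a) (hT a).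
apply: (restricted_obstruction l3_gt0 fr h1 h2).
apply: (jet_euler (@sder_scos _ _ U) (@sder_ssin _ _ U) (@scos2Dsin2 _ _ U)
  (sder_scst U ^~ _) (sder_scst U ^~ _) (sder_scst U ^~ _) (sder_scst U ^~ _) iDP h1 h2
  (e := ev q)) => k.
have [k14|k14] := ltnP k 14.
  by have := JTG a (Ordinal k14); rewrite mulmxKV// mxE => <-.
rewrite jet_entry_default // !gtn_eqF ?(leq_trans _ k14) // subrr; exact: ev0.
Qed.

End MaximalSymmetry.

(** The factor (1 + kb)^2 is the value of [abn_norm] at the straight configuration. Both summands of
    eta are nonnegative, and a positive ka or kb makes one of them positive. *)
Lemma straight_neq0 (R : realFieldType) (ka kb la L : R) :
  0 <= ka -> 0 <= kb -> 0 < la -> 0 < L -> 0 < ka \/ 0 < kb ->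
  - 224 * ((1 + kb) * (1 + ka) * (ka * ka * la * (1 + kb))
     + (1 + kb) * (1 + kb) * (kb * kb * L * la * la * (1 + ka))) ^+ 4
    * (1 + kb) ^+ 2 != 0.
Proof.
move=> ka0 kb0 la0 L0 kab.
have ka1 : 0 < 1 + ka by rewrite ltr_wpDr.
have kb1 : 0 < 1 + kb by rewrite ltr_wpDr.
rewrite mulf_neq0 ?expf_neq0 ?(gt_eqF kb1)// mulf_neq0 ?oppr_eq0 ?pnatr_eq0//.
rewrite expf_neq0// gt_eqF//; case: kab => k0.
- by apply: ltr_wpDr; rewrite ?mulr_gt0// !mulr_ge0// ltW.
- by apply: ltr_wpDl; rewrite ?mulr_gt0// !mulr_ge0// ltW.
Qed.

Theorem theorem13 (R : realType) (l1 l3 b : R)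
    (l1_gt0 : 0 < l1) (l3_gt0 : 0 < l3) (b_ge0 : 0 <= b) (b_le1 : b <= 1)
    (M : set (config R)) (M_adm : admissible l1 l3 b M) :
  ~ has_dim (infinitesimal_symmetries M (snake_distribution l1 l3 b)) 14.
Proof.
case: M_adm => -[p0 Mp0] cM oM _ frM dim14.
have [u0 u0p] := config_projP p0; subst p0.
pose U : domain R 4 := @Domain R 4 (@config_proj R @^-1` M) oM u0 Mp0.
have F0 u : domain_set U u -> ev (whole_pt u) (abnP (Ds whole) (scos whole) (ssin whole)
    (scst whole (b / l1)) (scst whole l1^-1) (scst whole ((1 - b) / l3))
    (scst whole l3) * abn_norm (scos whole) (scst whole ((1 - b) / l3))) = 0.
  move=> Uu; apply: (maximal_symmetry_obstruction l1_gt0 l3_gt0 (U := U) _ cM frM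
    (exist _ u Uu) dim14).
  by [].
(* The base point is straightened to v1 = v3 = 0 with v2, x, y unchanged. The new point lies outside
   U, which is why the function on all of R^5 is evaluated. *)
have := trig_eq0 (trigM (trig_abnP _ _ _ _) (trig_abn_norm _)) (@domain_open _ _ U) Mp0 F0.
set v := set_coord _ _ _.
have v2 : v 0 2%:R = 0 by rewrite /v mxE eqxx.
have v0 : v 0 0 = 0 by rewrite /v !mxE eqxx.
rewrite evM abnP_wholeE // => /eqP; apply/negP.
have ka0 : 0 <= b / l1 by rewrite divr_ge0// ltW.
have kb0 : 0 <= (1 - b) / l3 by rewrite divr_ge0 ?subr_ge0// ltW.
have la0 : 0 < l1^-1 by rewrite invr_gt0.
(* b and 1 - b cannot both vanish, so at least one of the two wheel offsets contributes to eta. *)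
have kab : 0 < b / l1 \/ 0 < (1 - b) / l3.
  have [b0|b0] := ltP 0 b; [left|right]; rewrite divr_gt0//.
  by rewrite subr_gt0 (le_lt_trans b0).
have -> : ev (whole_pt v) (abn_norm (scos whole) (scst whole ((1 - b) / l3))) =
    (1 + (1 - b) / l3) ^+ 2.
  rewrite /abn_norm !(evD, evM) ?ev_nat ?ev1 ev_scst ev_scos.
  rewrite (_ : sval (whole_pt v) 0 2%:R = 0) ?cos0//.
  by move: (_ / l3) => k; ring.
exact: straight_neq0.
Qed.
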